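(* Let $p\ge1$, $k\ge1$ be integers and $m>0$. Consider estimating $\theta$ in the model $X\sim N_p(\theta,\sigma^2I_p)$, $S^2\sim\sigma^2\chi^2_k$, independent, under the loss $\|d-\theta\|^2/\sigma^2$, with parameter space $\Theta(m)=\{(\theta,\sigma)\in\mathbb{R}^p\times(0,\infty):\|\theta\|/\sigma\le m\}$. Let $T=\|X\|^2/S^2$, $\delta_{BU,l}(X,S^2)=h(m,l,T)X$ and $\delta_{\mathrm{mle}}(X,S^2)=h_{\mathrm{mle}}(T)X$, with $h(m,l,\cdot)$ and $h_{\mathrm{mle}}$ as in the context. (a) If either $p\ge2$ and $k\ge2$, or $k=1$ and $m\le\sqrt p$, then $\delta_{\mathrm{mle}}$ dominates the unbiased estimator $X$. (b) If $m\le\sqrt p$ and either $p\ge2$ or $(p,k)=(1,1)$, then $\delta_{BU,0}$ dominates $\delta_{\mathrm{mle}}$. (c) If $m\le\sqrt p$ and $l\in[0,k+p)$, then $\delta_{BU,l}$ dominates $X$. (d) For all $(m,p)$ and all $l\in(0,k+p)$, $\delta_{BU,l}$ is inadmissible and dominated by $\delta_{BU,0}$. (e) If $m>\sqrt p$, $p\ge2$ and $k\ge2$, then $\delta_{\mathrm{mle}}$ is inadmissible and dominated by $\delta_h(X,S^2)=h(T)X$ with $h(t)=\min\{h_{\mathrm{mle}}(t),h(m,0,t)\}$.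
   Context: The risk of an estimator $\delta$ is $R((\theta,\sigma),\delta)=\sigma^{-2}E_{\theta,\sigma}\|\delta(X,S^2)-\theta\|^2$ on $\Theta(m)$; $\delta_2$ dominates $\delta_1$ if its risk is $\le$ that of $\delta_1$ on all of $\Theta(m)$, with strict inequality somewhere; $\delta_1$ is inadmissible if it is dominated by some estimator. For $l<k+p$ and $t\ge0$, $$h(m,l,t)=\frac{m^2}{p}\,\frac{F\left(\frac{k+p-l}{2}+1,\frac p2+1,\frac{m^2t}{2(1+t)}\right)}{F\left(\frac{k+p-l}{2}+1,\frac p2,\frac{m^2t}{2(1+t)}\right)},$$ where $F(a,b,z)=\sum_{i\ge0}\frac{(a)_i}{(b)_i}\frac{z^i}{i!}$, $(c)_0=1$, $(c)_i=\prod_{j=0}^{i-1}(c+j)$. The estimator $\delta_{BU,l}$ is the (generalized) Bayes estimator for the prior $\theta|\sigma^2\sim$ Uniform on the sphere of radius $m\sigma$ centered at the origin, $\sigma^2\sim(\sigma^2)^{l/2-1}$. The maximum likelihood estimator of $\theta$ on $\Theta(m)$ has multiplier $$h_{\mathrm{mle}}(t)=\min\left\{\frac{m^2}{2(p+k)}\left(\sqrt{1+\frac{4(k+p)}{m^2}\,\frac{1+t}{t}}-1\right),\,1\right\}\quad(t>0),\qquad h_{\mathrm{mle}}(0)=1.$$ *)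

(* Defs.v *)
From HB Require Import structures.
From mathcomp Require Import all_boot all_order all_algebra.
From mathcomp Require Import all_classical all_reals all_analysis.
From mathcomp Require Import measurable_realfun.

Set Implicit Arguments.
Unset Strict Implicit.
Unset Printing Implicit Defensive.

Import Order.TTheory GRing.Theory Num.Theory.
Import numFieldNormedType.Exports.

Local Open Scope classical_set_scope.
Local Open Scope ring_scope.

(* Points of R^n are n.-tuples of reals: tuples carry the library's product
   sigma-algebra, whereas row vectors have no measurable structure (and their
   library norm is the sup norm, not the Euclidean one). *)

Section euclidean.
Context {R : realType}.

Definition sumsq (n : nat) (x : n.-tuple R) : R := \sum_(i < n) tnth x i ^+ 2.

Definition enorm (n : nat) (x : n.-tuple R) : R := Num.sqrt (sumsq x).

Definition scale_tuple (n : nat) (c : R) (x : n.-tuple R) : n.-tuple R :=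
  [tuple c * tnth x i | i < n].

Definition sub_tuple (n : nat) (x y : n.-tuple R) : n.-tuple R :=
  [tuple tnth x i - tnth y i | i < n].

Definition cons_pair (n : nat) (u : R * n.-tuple R) : n.+1.-tuple R :=
  [tuple of u.1 :: u.2].

Definition scaler (c x : R) : R := c * x.

Local Notation T := (measurableTypeR R).

Lemma measurable_sumsq n :
  measurable_fun [set: n.-tuple T] (@sumsq n : n.-tuple T -> T).
Proof.
apply: measurable_sum => i; apply: measurable_funX; exact: measurable_tnth.
Qed.

Lemma measurable_cons_pair n :
  measurable_fun [set: T * n.-tuple T]
    (@cons_pair n : T * n.-tuple T -> n.+1.-tuple T).
Proof. exact: measurable_cons. Qed.

Lemma measurable_scaler c : measurable_fun [set: T] (scaler c : T -> T).
Proof. exact: mulrl_measurable. Qed.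

HB.instance Definition _ n := isMeasurableFun.Build _ _ (n.-tuple T) T
  (@sumsq n : n.-tuple T -> T) (@measurable_sumsq n).
HB.instance Definition _ n :=
  isMeasurableFun.Build _ _ (T * n.-tuple T)%type (n.+1.-tuple T)
    (@cons_pair n : T * n.-tuple T -> n.+1.-tuple T) (@measurable_cons_pair n).
HB.instance Definition _ c := isMeasurableFun.Build _ _ T T
  (scaler c : T -> T) (measurable_scaler c).

End euclidean.

Section model.
Context {R : realType}.

(* Joint law of n independent real variables, the i-th one with law P i. *)
Fixpoint indep_law (n : nat) :
    ('I_n -> probability (measurableTypeR R) R) ->
    probability (n.-tuple (measurableTypeR R)) R :=
  match n with
  | 0 => fun _ => \d_[tuple]
  | n'.+1 => fun P =>
      distribution (P ord0 \x indep_law (fun i => P (lift ord0 i)))%E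
        (@cons_pair R n')
  end.

Lemma indep_law_box (n : nat) (P : 'I_n -> probability (measurableTypeR R) R)
    (A : 'I_n -> set (measurableTypeR R)) :
  (forall i, measurable (A i)) ->
  indep_law P [set x | forall i, A i (tnth x i)] = (\prod_(i < n) P i (A i))%E.
Proof.
elim: n P A => [|n IH] P A mA.
  rewrite big_ord0 /= diracE mem_set//; by case.
rewrite big_ord_recl -IH; last by move=> i; exact: mA.
rewrite /= /distribution /pushforward.
have -> : @cons_pair R n @^-1` [set x | forall i, A i (tnth x i)] =
    A ord0 `*` [set x | forall i, A (lift ord0 i) (tnth x i)].
  apply/seteqP; split=> -[a x] /=.
    move=> h; split; first exact: (h ord0).
    by move=> i; have := h (lift ord0 i); rewrite tnthS.
  move=> [h0 h] i; case: (unliftP ord0 i) => [j ->|->] //=.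
  by rewrite tnthS; exact: h.
rewrite product_measure1E//.
rewrite (_ : [set x | _] = \bigcap_(i in [set: 'I_n])
    ((@tnth _ _)^~ i @^-1` A (lift ord0 i))); last first.
  by apply/seteqP; split => x h i; [move=> _; exact: h | exact: h].
apply: fin_bigcap_measurable => // i _.
by rewrite -[X in measurable X]setTI; exact: measurable_tnth.
Qed.

(* Law of N_p(theta, sigma^2 I_p); the second argument of the library's
   normal_prob is the standard deviation. *)
Definition mvnormal (p : nat) (theta : p.-tuple R) (sigma : R) :
    probability (p.-tuple (measurableTypeR R)) R :=
  indep_law (fun i => normal_prob (tnth theta i) sigma).

Definition chi2 (k : nat) : probability (measurableTypeR R) R :=
  distribution (indep_law (fun _ : 'I_k => normal_prob (0 : R) 1)) (@sumsq R k).

(* Law of (X, S^2). *)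
Definition model_law (p k : nat) (theta : p.-tuple R) (sigma : R) :
    probability (p.-tuple (measurableTypeR R) * measurableTypeR R)%type R :=
  (mvnormal theta sigma \x distribution (chi2 k) (scaler (sigma ^+ 2)))%E.

Definition param_space (p : nat) (m : R) : set (p.-tuple R * R) :=
  [set ts | 0 < ts.2 /\ enorm ts.1 / ts.2 <= m].

Definition decision (p : nat) : Type := p.-tuple R * R -> p.-tuple R.

Definition is_estimator (p : nat) (delta : decision p) : Prop :=
  measurable_fun
    [set: (p.-tuple (measurableTypeR R) * measurableTypeR R)%type]
    (delta : _ -> p.-tuple (measurableTypeR R)).

Definition risk (p k : nat) (ts : p.-tuple R * R) (delta : decision p) : \bar R :=
  ((ts.2 ^- 2)%:E *
   'E_(model_law k ts.1 ts.2)[fun xs => (enorm (sub_tuple (delta xs) ts.1) ^+ 2)%R])%E.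

(* The degrees of freedom k are explicit since decision p does not see them. *)
Definition dominates (p k : nat) (m : R) (delta2 delta1 : decision p) : Prop :=
  (forall ts, param_space m ts -> (risk k ts delta2 <= risk k ts delta1)%E) /\
  (exists2 ts, param_space m ts & (risk k ts delta2 < risk k ts delta1)%E).

Definition inadmissible (p k : nat) (m : R) (delta1 : decision p) : Prop :=
  exists2 delta2, is_estimator delta2 & dominates k m delta2 delta1.

End model.

Section estimators.
Context {R : realType}.

Definition pochhammer (c : R) (i : nat) : R := \prod_(j < i) (c + j%:R).

Definition hyp1F1 (a b z : R) : R :=
  limn (series (fun i => pochhammer a i / pochhammer b i * (z ^+ i / i`!%:R))).

Definition hBU (p k : nat) (m l t : R) : R :=
  let a := (k%:R + p%:R - l) / 2 + 1 in
  let z := m ^+ 2 * t / (2 * (1 + t)) in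
  m ^+ 2 / p%:R * (hyp1F1 a (p%:R / 2 + 1) z / hyp1F1 a (p%:R / 2) z).

Definition hmle (p k : nat) (m t : R) : R :=
  if 0 < t then
    Num.min
      (m ^+ 2 / (2 * (p%:R + k%:R)) *
       (Num.sqrt (1 + 4 * (k%:R + p%:R) / m ^+ 2 * ((1 + t) / t)) - 1))
      1
  else 1.

(* The estimator h(T) X with T = |X|^2 / S^2; the event S^2 = 0, where the
   division is by convention 0, is null. *)
Definition equivariant (p : nat) (h : R -> R) : decision p :=
  fun xs => scale_tuple (h (enorm xs.1 ^+ 2 / xs.2)) xs.1.

Definition delta_BU (p k : nat) (m l : R) : decision p :=
  equivariant (hBU p k m l).

Definition delta_mle (p k : nat) (m : R) : decision p :=
  equivariant (hmle p k m).

Definition delta_X (p : nat) : decision p := fun xs : p.-tuple R * R => xs.1.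

End estimators.

Arguments delta_BU {R} p k m l.
Arguments delta_mle {R} p k m.
Arguments delta_X {R} p.

(* Main.v *)
Require Import Defs.
From mathcomp Require Import all_boot all_order all_algebra.
From mathcomp Require Import all_classical all_reals all_analysis.
From mathcomp Require Import measurable_realfun ring lra.
Set Implicit Arguments.
Unset Strict Implicit.
Unset Printing Implicit Defensive.
Import Order.TTheory GRing.Theory Num.Theory.
Import numFieldNormedType.Exports.
Local Open Scope classical_set_scope.
Local Open Scope ring_scope.

(* Let [v = eta . x] with [eta = theta / sigma]. The risk of [h(T) X] is an
   integral against the standard law tilted by [exp v]; averaging over
   [x |-> - x] turns the exponential into [cosh v] and [v sinh v]. Expanding
   these in power series and computing the moments of [f(|x|^2) (eta . x)^(2j)]
   in polar coordinates rewrites [E(q(T) v sinh v)] and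
   [E(q(T) |x|^2 cosh v)] as integrals over the law of [T] whose integrands
   have ratio exactly [hBU] with [l = 0] and [m = |eta|]. That ratio increases
   with [|eta|], so [h1] dominates [h2] as soon as [0 <= h1 <= h2] and
   [hBU p k m 0 <= h1] wherever [h1 < h2]. The five claims are then comparisons
   of multipliers: writing [hBU] as a mean over the weights of a hypergeometric
   series gives its monotonicity by Chebyshev's sum inequality, and
   [hBU p k m 0] is below the unconstrained maximum likelihood multiplier
   because a variance is positive. *)

(** Given [T], the symmetrized loss is a quadratic in the multiplier whose minimizer is [hBU] at
    [l = 0] and [m = |eta|]. Lowering a multiplier reduces the risk as long as the minimizer is not
    passed: [h2 ^+ 2 - h1 ^+ 2 = (h2 - h1) * (h1 + h2)], and [h1 + h2] is at least twice the
    minimizer. This is why only the smaller multiplier is compared with [hBU], and at the largest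
    admissible norm [m]. No conditional expectation is formed: an arbitrary nonnegative [q(T)]
    stands for the conditioning. Since integrals of nonnegative functions may be infinite, no risks
    are subtracted; differences are written as equalities between sums of nonnegative terms, and a
    term is cancelled only after it is shown finite. Strict improvement is established at
    [theta = 0], where the [v sinh v] term vanishes. The exceptional dimension is [p = 1], where the
    second parameter [p / 2] of the series is below [1] and the variance argument no longer
    suffices; [p = k = 1] is rescued by an exact first-order recurrence. *)

(** * Chebyshev's sum inequality for series, with an explicit gap *)

Section Chebyshev.
Context {R : realType}.
Implicit Types u v f : nat -> R.

(* Expanding [\sum_(i, j) (f i - f j) * (v i * u j - u i * v j)], whose terms
   are nonnegative; [i, j <= 1] already contribute twice the gap. *)
Lemma chebyshev_sum u v f n : (1 < n)%N ->
  {homo f : i j / (i <= j)%N >-> i <= j} ->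
  (forall i j, (i <= j)%N -> u j * v i <= u i * v j) ->
  (\sum_(0 <= i < n) f i * u i) * (\sum_(0 <= i < n) v i)
    + (f 1%N - f 0%N) * (u 0%N * v 1%N - u 1%N * v 0%N)
  <= (\sum_(0 <= i < n) f i * v i) * (\sum_(0 <= i < n) u i).
Proof.
move=> n1 fh uv.
pose s i j := (f i - f j) * (v i * u j - u i * v j).
have s_ge0 i j : 0 <= s i j.
  rewrite /s; have [ij|/ltnW ij] := leqP i j.
    by apply: mulr_le0; [rewrite subr_le0; exact: fh|
      have := uv _ _ ij; rewrite subr_le0 mulrC].
  apply: mulr_ge0; first by rewrite subr_ge0; exact: fh.
  by have := uv _ _ ij; rewrite subr_ge0 (mulrC (v i)).
have sE : \sum_(0 <= i < n) \sum_(0 <= j < n) s i j =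
   2 * ((\sum_(0 <= i < n) f i * v i) * (\sum_(0 <= i < n) u i)
     - (\sum_(0 <= i < n) f i * u i) * (\sum_(0 <= i < n) v i)).
  have e i : \sum_(0 <= j < n) s i j =
    (f i * v i) * (\sum_(0 <= j < n) u j) - (f i * u i) * (\sum_(0 <= j < n) v j)
    - v i * (\sum_(0 <= j < n) f j * u j) + u i * (\sum_(0 <= j < n) f j * v j).
    rewrite !mulr_sumr -!sumrB -big_split/=; apply: eq_bigr => j _.
    by rewrite /s; ring.
  rewrite (eq_bigr _ (fun i _ => e i)) big_split/= !sumrB -!mulr_suml.
  by ring.
suff : s 0%N 1%N + s 1%N 0%N <= \sum_(0 <= i < n) \sum_(0 <= j < n) s i j.
  by rewrite sE /s; lra.
have ge_row i (m : nat) : (i < m)%N -> forall w : nat -> R, (forall j, 0 <= w j) ->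
    w i <= \sum_(0 <= j < m) w j.
  move=> im w w0; rewrite big_mkord (bigD1 (Ordinal im))//= lerDl.
  by apply: sumr_ge0.
case: n n1 {sE} => // -[//|n] _.
rewrite big_nat_recl// big_nat_recl// addrA -[leLHS]addr0.
apply: lerD; last by apply: sumr_ge0 => i _; apply: sumr_ge0.
apply: lerD; first exact: (ge_row 1%N n.+2 isT (s 0%N) (s_ge0 _)).
exact: (ge_row 0%N n.+2 isT (s 1%N) (s_ge0 _)).
Qed.

(** The gap does not depend on [n], so it survives the limit, where a mere strict inequality between
    partial sums would be lost. It is the source of strictness in [hyp1F1_ratio_quadratic] and
    [hBU_lt_l]. *)
Lemma chebyshev_series u v f :
  {homo f : i j / (i <= j)%N >-> i <= j} ->
  (forall i j, (i <= j)%N -> u j * v i <= u i * v j) ->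
  cvgn (series u) -> cvgn (series v) ->
  cvgn (series (f \* u)) -> cvgn (series (f \* v)) ->
  limn (series (f \* u)) * limn (series v)
    + (f 1%N - f 0%N) * (u 0%N * v 1%N - u 1%N * v 0%N)
  <= limn (series (f \* v)) * limn (series u).
Proof.
move=> fh uv cu cv cfu cfv.
pose d := (f 1%N - f 0%N) * (u 0%N * v 1%N - u 1%N * v 0%N).
have cl : series (f \* u) n * series v n + d @[n --> \oo] -->
    limn (series (f \* u)) * limn (series v) + d.
  by apply: cvgD; [exact: cvgM|exact: cvg_cst].
have cr : series (f \* v) n * series u n @[n --> \oo] -->
    limn (series (f \* v)) * limn (series u) by exact: cvgM.
rewrite -(cvg_lim _ cl)// -(cvg_lim _ cr)//; apply: ler_lim.
- exact: (cvgP _ cl).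
- exact: (cvgP _ cr).
- by exists 2%N => // n /= n1; exact: chebyshev_sum.
Qed.

End Chebyshev.

(** * Convergence and positivity of the confluent hypergeometric series *)

Section hyp1F1.
Context {R : realType}.
Implicit Types a b z : R.

Definition hyp_term a b z (i : nat) : R :=
  pochhammer a i / pochhammer b i * (z ^+ i / i`!%:R).

Lemma hyp1F1E a b z : hyp1F1 a b z = limn (series (hyp_term a b z)).
Proof. by []. Qed.

Lemma pochhammer0 a : pochhammer a 0 = 1.
Proof. by rewrite /pochhammer big_ord0. Qed.

Lemma pochhammerS a i : pochhammer a i.+1 = pochhammer a i * (a + i%:R).
Proof. by rewrite /pochhammer big_ord_recr. Qed.

Lemma pochhammerSl a i : pochhammer a i.+1 = a * pochhammer (a + 1) i.
Proof.
rewrite /pochhammer big_ord_recl addr0; congr (_ * _).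
by apply: eq_bigr => j _; rewrite lift0 -addrA -natr1 (addrC 1).
Qed.

Lemma pochhammer_gt0 a i : 0 < a -> 0 < pochhammer a i.
Proof. by move=> a0; apply: prodr_gt0 => j _; rewrite ltr_wpDr. Qed.

Lemma hyp_term0 a b z : hyp_term a b z 0 = 1.
Proof. by rewrite /hyp_term !pochhammer0 expr0 fact0 !divr1 mulr1. Qed.

Lemma hyp_termS a b z i : 0 < b ->
  (i.+1%:R * (b + i%:R)) * hyp_term a b z i.+1 = z * (a + i%:R) * hyp_term a b z i.
Proof.
move=> b0; rewrite /hyp_term !pochhammerS factS natrM exprS.
have h1 := lt0r_neq0 (pochhammer_gt0 i b0).
have h2 : b + i%:R != 0 by rewrite gt_eqF// ltr_wpDr.
have h3 : i`!%:R != 0 :> R by rewrite pnatr_eq0 -lt0n fact_gt0.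
have h4 : i.+1%:R != 0 :> R by rewrite pnatr_eq0.
rewrite -natr1 in h4 *.
by field; rewrite h1 h2 h3 h4.
Qed.

Lemma hyp_term_ge0 a b z i : 0 < a -> 0 < b -> 0 <= z -> 0 <= hyp_term a b z i.
Proof.
move=> a0 b0 z0; apply: mulr_ge0; apply: divr_ge0; rewrite ?exprn_ge0//;
  by apply/ltW/pochhammer_gt0.
Qed.

Lemma hyp_term_gt0 a b z i : 0 < a -> 0 < b -> 0 < z -> 0 < hyp_term a b z i.
Proof.
move=> a0 b0 z0; apply: mulr_gt0; apply: divr_gt0; rewrite ?exprn_gt0//;
  by rewrite ?pochhammer_gt0// ltr0n fact_gt0.
Qed.

(** Factor by factor, [(a + j) / (b + j) <= 1 + a / b], so an exponential series dominates. *)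
Lemma hyp_term_bound a b z i : 0 < a -> 0 < b ->
  `|hyp_term a b z i| <= exp_coeff ((1 + a / b) * `|z|) i.
Proof.
move=> a0 b0; rewrite /hyp_term /exp_coeff /= exprMn -[leRHS]mulrA normrM.
apply: ler_pM => //; last first.
  by rewrite normrM normrX normfV (ger0_norm (ler0n _ i`!)).
rewrite ger0_norm; last by apply: divr_ge0; apply/ltW/pochhammer_gt0.
rewrite /pochhammer -prodf_div -[X in _ ^+ X](card_ord i) -prodr_const.
apply: ler_prod => j _; rewrite divr_ge0 ?addr_ge0// ?(ltW a0) ?(ltW b0)//=.
have bj : 0 < b + j%:R by rewrite ltr_wpDr.
rewrite ler_pdivrMr// mulrDl mul1r mulrDr divfK ?gt_eqF//.
have : 0 <= a / b * j%:R by rewrite mulr_ge0// divr_ge0// ltW.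
lra.
Qed.

(** Geometric growth of [c] is absorbed into the argument of the dominating exponential. The base
    [4] suits [i ^+ 2 <= 4 ^+ i], needed for second moments of the weights. *)
Lemma cvg_hyp_scaled a b z (c : nat -> R) (K : R) : 0 < a -> 0 < b ->
  (forall i, `|c i| <= K * 4 ^+ i) ->
  cvgn (series (c \* hyp_term a b z)).
Proof.
move=> a0 b0 cK; apply: normed_cvg.
apply: (@series_le_cvg _ _ (fun i => K * exp_coeff (4 * ((1 + a / b) * `|z|)) i)).
- by move=> i /=.
- move=> i; have K0 : 0 <= K by have := cK 0%N; rewrite expr0 mulr1; apply: le_trans.
  rewrite mulr_ge0// exp_coeff_ge0// !mulr_ge0//.
  by rewrite addr_ge0// divr_ge0// ltW.
- move=> i /=; rewrite normrM.
  apply: (le_trans (ler_pM _ _ (cK i) (hyp_term_bound z i a0 b0))) => //.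
  by rewrite /exp_coeff/= [in leRHS]exprMn !mulrA.
- have -> : series (fun i => K * exp_coeff (4 * ((1 + a / b) * `|z|)) i) =
     K \*: series (exp_coeff (4 * ((1 + a / b) * `|z|))) :> (nat -> R).
    by apply/funext => n; rewrite /series/= scaler_sumr.
  by apply: is_cvgZl_tmp; exact: is_cvg_series_exp_coeff.
Qed.

Lemma cvg_hyp a b z : 0 < a -> 0 < b -> cvgn (series (hyp_term a b z)).
Proof.
move=> a0 b0; have := @cvg_hyp_scaled a b z (fun=> 1) 1 a0 b0.
rewrite (_ : (fun=> 1) \* _ = hyp_term a b z); last first.
  by apply/funext => i /=; rewrite mul1r.
by apply => i; rewrite normr1 mul1r exprn_ege1// ler1n.
Qed.

Lemma hyp1F1_ge1 a b z : 0 < a -> 0 < b -> 0 <= z -> 1 <= hyp1F1 a b z.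
Proof.
move=> a0 b0 z0; rewrite hyp1F1E.
have := @nondecreasing_cvgn_le _ (series (hyp_term a b z)) _ (@cvg_hyp a b z a0 b0) 1%N.
rewrite /series/= big_nat1 hyp_term0; apply.
by apply/nondecreasing_seqP => n; rewrite -subr_ge0 seriesSB/= hyp_term_ge0.
Qed.

End hyp1F1.

(** * Monotonicity of hypergeometric quotients, as means over weights *)

Section hyp1F1_ratio.
Context {R : realType}.
Implicit Types (a b z : R) (u v : nat -> R).

Local Notation sums u l := (series u @ \oo --> (l : R)).

Lemma sumsD u v (x y : R) : sums u x -> sums v y -> sums (fun i => u i + v i) (x + y).
Proof.
move=> ux vy; rewrite (_ : series _ = (fun n => series u n + series v n)).
  exact: cvgD.
by apply/funext => n; rewrite /series/= big_split.
Qed.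

Lemma sumsZ (c : R) u x : sums u x -> sums (fun i => c * u i) (c * x).
Proof.
move=> ux; rewrite (_ : series _ = (fun n => c * series u n)).
  by apply: cvgM => //; exact: cvg_cst.
by apply/funext => n; rewrite /series/= mulr_sumr.
Qed.

Lemma sums_shift u x : sums (fun i => u i.+1) x -> sums u (u 0%N + x).
Proof.
move=> ux; rewrite -cvg_shiftS.
rewrite (_ : (fun n => _) = (fun n => u 0%N + series (fun i => u i.+1) n)).
  by apply: cvgD => //; exact: cvg_cst.
by apply/funext => n; rewrite /series/= big_nat_recl.
Qed.

Lemma eq_sums u v x : u =1 v -> sums u x -> sums v x.
Proof. by move=> /funext ->. Qed.

Lemma sums_unique u x y : sums u x -> sums u y -> x = y.
Proof. by move=> ux uy; rewrite -(cvg_lim _ ux)// (cvg_lim _ uy). Qed.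

Lemma sums_ler u v x y : (forall i, u i <= v i) -> sums u x -> sums v y -> x <= y.
Proof.
move=> uv ux vy; rewrite -(cvg_lim _ ux)// -(cvg_lim _ vy)//.
by apply: lim_series_le => //; [exact: cvgP ux|exact: cvgP vy].
Qed.

Lemma sums_hyp a b z : 0 < a -> 0 < b -> sums (hyp_term a b z) (hyp1F1 a b z).
Proof. by move=> a0 b0; exact: cvg_hyp. Qed.

Lemma sums_chebyshev u v (f : nat -> R) x y x' y' :
  {homo f : i j / (i <= j)%N >-> i <= j} ->
  (forall i j, (i <= j)%N -> u j * v i <= u i * v j) ->
  sums u x -> sums v y ->
  sums (fun i => f i * u i) x' -> sums (fun i => f i * v i) y' ->
  x' * y + (f 1%N - f 0%N) * (u 0%N * v 1%N - u 1%N * v 0%N) <= y' * x.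
Proof.
move=> fh uv ux vy ux' vy'.
have := chebyshev_series fh uv (cvgP _ ux) (cvgP _ vy) (cvgP _ ux') (cvgP _ vy').
by rewrite (cvg_lim _ ux)// (cvg_lim _ vy)// (cvg_lim _ ux')// (cvg_lim _ vy').
Qed.

Lemma hyp_termDb a b z i : 0 < b ->
  hyp_term a (b + 1) z i = b / (b + i%:R) * hyp_term a b z i.
Proof.
move=> b0; rewrite /hyp_term.
have h1 := lt0r_neq0 (pochhammer_gt0 i b0).
have h2 : b + i%:R != 0 by rewrite gt_eqF// ltr_wpDr.
have -> : pochhammer (b + 1) i = pochhammer b i * (b + i%:R) / b.
  by rewrite -pochhammerS pochhammerSl mulrC mulKf// gt_eqF.
have h3 : i`!%:R != 0 :> R by rewrite pnatr_eq0 -lt0n fact_gt0.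
by field; rewrite h1 h2 h3 gt_eqF.
Qed.

Lemma hyp_termBa a b z i : 1 < a ->
  (a - 1 + i%:R) * hyp_term (a - 1) b z i = (a - 1) * hyp_term a b z i.
Proof.
move=> a1; have e : (a - 1 + i%:R) * pochhammer (a - 1) i = (a - 1) * pochhammer a i.
  by rewrite mulrC -pochhammerS pochhammerSl subrK.
by rewrite /hyp_term -!mulrA mulrA e -mulrA.
Qed.

(** Exhibits [F(a, b + 1, z) / F(a, b, z)] as the mean of the decreasing function [b / (b + i)]
    under the weights [hyp_term a b z]. *)
Lemma sums_hypDb a b z : 0 < a -> 0 < b ->
  sums (fun i => b / (b + i%:R) * hyp_term a b z i) (hyp1F1 a (b + 1) z).
Proof.
move=> a0 b0; have := @sums_hyp a (b + 1) z a0 (addr_gt0 b0 ltr01).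
by apply: eq_sums => i; rewrite hyp_termDb.
Qed.

(** Shifting the index absorbs the factor [z]: the same quotient times [z] is the mean, under the
    same weights, of [b * i / (a - 1 + i)], which increases because [1 < a]. *)
Lemma sums_mul_hyp a b z : 1 < a -> 0 < b ->
  sums (fun i => b * i%:R / (a - 1 + i%:R) * hyp_term a b z i)
    (z * hyp1F1 a (b + 1) z).
Proof.
move=> a1 b0; have a0 : 0 < a by lra.
have := @sumsZ z _ _ (@sums_hypDb _ _ z a0 b0) => h.
have := @sums_shift (fun i => b * i%:R / (a - 1 + i%:R) * hyp_term a b z i).
move=> /(_ (z * hyp1F1 a (b + 1) z)); rewrite mulr0 !mul0r add0r; apply.
apply: eq_sums h => i.
have bi : 0 < b + i%:R by rewrite ltr_wpDr.
have ai : 0 < a + i%:R by rewrite ltr_wpDr.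
have := hyp_termS a z i b0; rewrite -natr1.
rewrite (_ : a - 1 + (i%:R + 1) = a + i%:R); last by ring.
set x := hyp_term _ _ _ _; set y := hyp_term _ _ _ _ => e.
have -> : z * (b / (b + i%:R) * y) = b / (b + i%:R) / (a + i%:R) * (z * (a + i%:R) * y).
  by field; rewrite !gt_eqF.
by rewrite -e; field; rewrite !gt_eqF.
Qed.

Lemma hyp1F1Db_le a b z : 0 < a -> 0 < b -> 0 <= z ->
  hyp1F1 a (b + 1) z <= hyp1F1 a b z.
Proof.
move=> a0 b0 z0; apply: sums_ler (@sums_hypDb _ _ z a0 b0) (@sums_hyp _ _ z a0 b0) => i.
rewrite ler_piMl ?hyp_term_ge0//.
by rewrite ler_pdivrMr ?mul1r ?lerDl// ltr_wpDr.
Qed.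

(** Passing from [a] to [a'] multiplies the weights by [pochhammer a' i / pochhammer a i], which
    increases with [i], so the mean of [b / (b + i)] falls. The extra term on the left is the
    Chebyshev gap at indices [0] and [1]. *)
Lemma hyp1F1_ratio_decr a a' b z : 0 < a -> a <= a' -> 0 < b -> 0 <= z ->
  hyp1F1 a' (b + 1) z * hyp1F1 a b z + (1 - b / (b + 1)) * ((a' - a) / b * z)
  <= hyp1F1 a (b + 1) z * hyp1F1 a' b z.
Proof.
move=> a0 aa' b0 z0; have a'0 := lt_le_trans a0 aa'.
pose f i : R := - (b / (b + i%:R)).
have fh : {homo f : i j / (i <= j)%N >-> i <= j}.
  move=> i j ij; rewrite lerN2 ler_pM2l// lef_pV2 ?posrE ?ltr_wpDr//.
  by rewrite lerD2l ler_nat.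
have uv i j : (i <= j)%N -> hyp_term a b z j * hyp_term a' b z i <=
    hyp_term a b z i * hyp_term a' b z j.
  move=> ij; rewrite /hyp_term.
  rewrite (_ : _ * _ = (pochhammer a j * pochhammer a' i) *
     ((pochhammer b j)^-1 * (z ^+ j / j`!%:R) *
      ((pochhammer b i)^-1 * (z ^+ i / i`!%:R)))); last by ring.
  rewrite [leRHS](_ : _ * _ = (pochhammer a i * pochhammer a' j) *
     ((pochhammer b j)^-1 * (z ^+ j / j`!%:R) *
      ((pochhammer b i)^-1 * (z ^+ i / i`!%:R)))); last by ring.
  apply: ler_wpM2r.
    by apply: mulr_ge0; apply: mulr_ge0;
      rewrite ?divr_ge0 ?invr_ge0 ?exprn_ge0 ?ler0n// ltW ?pochhammer_gt0.
  elim: j ij => [|j IH]; first by rewrite leqn0 => /eqP ->.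
  rewrite leq_eqVlt => /predU1P[->//|/IH h].
  rewrite !pochhammerS mulrAC [leRHS]mulrA.
  apply: ler_pM => //; last by rewrite lerD2r.
  - by rewrite mulr_ge0// ltW ?pochhammer_gt0.
  - by rewrite addr_ge0// ltW.
have fs c : 0 < c -> sums (fun i => f i * hyp_term c b z i) (- hyp1F1 c (b + 1) z).
  move=> c0; have := @sumsZ (-1) _ _ (@sums_hypDb _ _ z c0 b0); rewrite mulN1r.
  by apply: eq_sums => i; rewrite /f mulN1r mulNr.
have := sums_chebyshev fh uv (@sums_hyp _ _ z a0 b0) (@sums_hyp _ _ z a'0 b0)
  (fs _ a0) (fs _ a'0).
rewrite /f addr0 divff ?gt_eqF// !hyp_term0.
rewrite /hyp_term !pochhammerS !pochhammer0 expr1 divr1 !addr0 !mul1r !mulr1.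
rewrite (_ : a' / b * z - a / b * z = (a' - a) / b * z); last by ring.
lra.
Qed.

(** A larger [z] moves the weights towards large [i]. The quotient alone is the mean of a decreasing
    function; with the factor [z] it becomes the mean of an increasing one. *)
Lemma hyp1F1_ratio_incr a b z z' : 1 < a -> 0 < b -> 0 <= z -> z <= z' ->
  z * hyp1F1 a (b + 1) z * hyp1F1 a b z' <= z' * hyp1F1 a (b + 1) z' * hyp1F1 a b z.
Proof.
move=> a1 b0 z0 zz'; have z'0 := le_trans z0 zz'; have a0 : 0 < a by lra.
pose f i : R := b * i%:R / (a - 1 + i%:R).
have fh : {homo f : i j / (i <= j)%N >-> i <= j}.
  move=> i j ij; rewrite /f -!mulrA ler_pM2l//.
  have c0 : 0 < a - 1 by rewrite subr_gt0.
  set c := a - 1 in c0 *.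
  have pos (n : nat) : 0 < c + n%:R by rewrite ltr_wpDr.
  rewrite ler_pdivrMr ?pos// mulrAC ler_pdivlMr ?pos//.
  rewrite -subr_ge0 (_ : _ - _ = c * (j%:R - i%:R)); last by ring.
  by rewrite mulr_ge0 ?subr_ge0 ?ler_nat// ltW.
have uv i j : (i <= j)%N -> hyp_term a b z j * hyp_term a b z' i <=
    hyp_term a b z i * hyp_term a b z' j.
  move=> ij; rewrite /hyp_term.
  set x := pochhammer a j / _; set y := pochhammer a i / _.
  have [x0 y0] : 0 <= x /\ 0 <= y.
    by split; apply: divr_ge0; apply/ltW/pochhammer_gt0.
  have : 0 <= i`!%:R^-1 :> R by rewrite invr_ge0.
  have : 0 <= j`!%:R^-1 :> R by rewrite invr_ge0.
  move: x y i`!%:R^-1 j`!%:R^-1 x0 y0 => x y p q x0 y0 q0 p0.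
  rewrite -subr_ge0 (_ : _ - _ = x * y * (p * q) *
    (z ^+ i * z' ^+ j - z ^+ j * z' ^+ i)); last by ring.
  apply: mulr_ge0; first by rewrite !mulr_ge0.
  rewrite -(subnK ij) !exprD (_ : _ - _ = z ^+ i * z' ^+ i *
    (z' ^+ (j - i) - z ^+ (j - i))); last by ring.
  by rewrite !mulr_ge0 ?exprn_ge0 ?subr_ge0 ?lerXn2r.
have := sums_chebyshev fh uv (@sums_hyp _ _ z a0 b0) (@sums_hyp _ _ z' a0 b0)
  (@sums_mul_hyp _ _ z a1 b0) (@sums_mul_hyp _ _ z' a1 b0).
apply: le_trans; rewrite lerDl mulr_ge0 ?subr_ge0 ?fh//.
by rewrite (uv 0%N 1%N).
Qed.

End hyp1F1_ratio.

(** * The quadratic inequality that places the Bayes multiplier below the likelihood root *)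

Section bayes_multiplier.
Context {R : realType}.
Implicit Types (a b z : R).

Local Notation sums u l := (series u @ \oo --> (l : R)).

Lemma sums_hyp_poly a b z (n : nat) : 0 < a -> 0 < b -> (n <= 2)%N ->
  cvgn (series (fun i => i%:R ^+ n * hyp_term a b z i)).
Proof.
move=> a0 b0 n2; apply: (@cvg_hyp_scaled _ a b z (fun i => i%:R ^+ n) 1) => // i.
rewrite mul1r ger0_norm ?exprn_ge0// -natrX -natrX ler_nat.
rewrite (_ : 4 = 2 * 2)%N// expnMn mulnn.
have i2 : (i <= 2 ^ i)%N by apply/ltnW/ltn_expl.
have h2 : (1 <= 2 ^ i)%N by rewrite expn_gt0.
case: n n2 => [|[|[|]]]// _; first by rewrite expn0 -mulnn muln_gt0 !h2.
  by rewrite expn1 (leq_trans i2)// -mulnn leq_pmulr.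
by rewrite leq_sqr.
Qed.

(* With [w = hyp_term (a - 1) b z], the claim is [W1 ^+ 2 < W0 * z * (a - 1) * F],
   where [Wn] is the sum of [i ^+ n * w i]; the contiguity relation
   [W2 + (b - 1) * W1 = z * (a - 1) * F] reduces it to [0 < Var + (b - 1) * E]
   for the distribution of weights [w]. *)
Lemma hyp1F1_ratio_quadratic a b z : 1 < a -> 0 < z ->
  1 <= b \/ (a = 2 /\ b = 1 / 2) ->
  z * ((a - 1) * hyp1F1 a (b + 1) z ^+ 2 + b * hyp1F1 a (b + 1) z * hyp1F1 a b z)
  < b ^+ 2 * hyp1F1 a b z ^+ 2.
Proof.
move=> a1 z0 ab.
have b0 : 0 < b by case: ab => [|[_ ->]]; lra.
have a0 : 0 < a by lra.
pose A := a - 1; have A0 : 0 < A by rewrite subr_gt0.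
set F := hyp1F1 a b z; set G := hyp1F1 a (b + 1) z.
pose w := hyp_term A b z.
have wS i := @hyp_termS R A b z i b0.
have w0 i : 0 < w i by exact: hyp_term_gt0.
have hW0 : sums w (hyp1F1 A b z) by exact: sums_hyp.
set W0 := hyp1F1 A b z in hW0.
have hW1 : sums (fun i => i%:R * w i) (A * z * G / b).
  have := @sums_mul_hyp _ a b z a1 b0 => /(@sumsZ _ (A / b)).
  rewrite (_ : A / b * _ = A * z * G / b); last by rewrite -/G; ring.
  apply: eq_sums => i; have Ai : 0 < A + i%:R by rewrite ltr_wpDr.
  have e := @hyp_termBa _ a b z i a1.
  rewrite -/A -/(w i) in e *.
  have -> : A / b * (b * i%:R / (A + i%:R) * hyp_term a b z i) =
    i%:R / (A + i%:R) * (A * hyp_term a b z i) by field; rewrite !gt_eqF.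
  by rewrite -e; field; rewrite gt_eqF.
set W1 := A * z * G / b in hW1.
have WF : A * W0 + W1 = A * F.
  have := sumsD (@sumsZ _ A _ _ hW0) hW1.
  move/sums_unique; apply.
  have := @sumsZ _ A _ _ (@sums_hyp _ a b z a0 b0).
  by apply: eq_sums => i; rewrite -mulrDl (hyp_termBa b z i a1).
suff : W1 ^+ 2 < W0 * z * (A * F).
  have -> : W0 = F - W1 / A.
    by move: WF; set x := A * F => e; rewrite /x in e; apply: (mulfI (lt0r_neq0 A0));
      rewrite mulrBr -e mulrCA divff ?gt_eqF// mulr1 addrK.
  rewrite /W1 => h; rewrite -/A -subr_gt0.
  rewrite -(@pmulr_rgt0 _ (A * z / b ^+ 2)); last by rewrite divr_gt0 ?mulr_gt0 ?exprn_gt0.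
  move: h; rewrite -subr_gt0; congr (0 < _).
  by field; rewrite !gt_eqF.
have W00 : 1 <= W0 by exact: hyp1F1_ge1 (ltW z0).
have F0 : 1 <= F by exact: hyp1F1_ge1 (ltW z0).
case: ab => [b1|[a2 b2]].
  have hW2 := @sums_hyp_poly A b z 2 A0 b0 isT.
  set W2 := limn (series (fun i => i%:R ^+ 2 * w i)).
  have hW2' : sums (fun i => i%:R * (i%:R * w i)) W2.
    by move: hW2; apply: eq_sums => i; rewrite mulrA -expr2.
  have hW1' : sums (fun i => i%:R * w i) W1 := hW1.
  have id2 : W2 + (b - 1) * W1 = z * (A * F).
    have h := sumsD hW2' (@sumsZ _ (b - 1) _ _ hW1).
    apply: (sums_unique h).
    have := @sums_shift _ (fun i => i%:R * (i%:R * w i) + (b - 1) * (i%:R * w i)) (z * (A * F)).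
    rewrite !mul0r mulr0 !add0r; apply.
    rewrite -WF; have := @sumsZ _ z _ _ (sumsD (@sumsZ _ A _ _ hW0) hW1).
    apply: eq_sums => i; rewrite -mulrDl mulrA -wS -/w -natr1; ring.
  have fh : {homo (fun i : nat => i%:R : R) : i j / (i <= j)%N >-> i <= j}.
    by move=> i j; rewrite ler_nat.
  have uv i j : (i <= j)%N -> w j * (i%:R * w i) <= w i * (j%:R * w j).
    move=> ij; rewrite mulrCA (mulrCA (w i)) (mulrC (w j)).
    by apply: ler_wpM2r; [rewrite mulr_ge0// ltW|rewrite ler_nat].
  (* Chebyshev with [f i = i], [u = w] and [v i = i * w i] reads [W1 ^+ 2 + w 0 * w 1 <= W2 * W0]:
     the variance is positive. *)
  have := sums_chebyshev fh uv hW0 hW1 hW1 hW2'.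
  rewrite subr0 !mul1r !mul0r !mulr0 subr0 -expr2 => CS.
  rewrite -mulrA -id2 mulrDr (mulrC W0 W2).
  have h1 : 0 < w 0%N * w 1%N by rewrite mulr_gt0.
  have h2 : 0 <= W0 * ((b - 1) * W1).
    have G1 : 1 <= G by apply: hyp1F1_ge1; lra.
    have W1_ge0 : 0 <= W1 by rewrite /W1 divr_ge0 ?mulr_ge0//; lra.
    by apply: mulr_ge0; [lra|apply: mulr_ge0 => //; lra].
  by lra.
(* This is [p = k = 1]. Now [b - 1] is negative and the variance alone does not conclude, but
   [A = 1] cancels a factor [i + 1] in the recurrence for [w]. Hence [W1] is explicit in terms of
   [W0], and [W0 - 1 <= 2 * (z * W0)] closes the inequality. *)
have A1 : A = 1 by rewrite /A a2; lra.
have wS' i : (i%:R + 1 / 2) * w i.+1 = z * w i.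
  have := wS i; rewrite -/w A1 b2 -natr1 => e.
  have i0 : (i%:R + 1 : R) != 0 by rewrite natr1 pnatr_eq0.
  by apply: (mulfI i0); rewrite mulrA (addrC i%:R (1 / 2)) e; ring.
have zw : sums (fun i => z * w i) (z * W0) by exact: (@sumsZ _ z _ _ hW0).
have e1 : W1 - W0 / 2 = z * W0 - 1 / 2.
  have h := sumsD hW1 (@sumsZ _ (- 1 / 2) _ _ hW0).
  rewrite (_ : W1 - W0 / 2 = W1 + -1 / 2 * W0); last by ring.
  apply: (sums_unique h).
  have := @sums_shift _ (fun i => i%:R * w i + - 1 / 2 * w i) (z * W0).
  rewrite mul0r add0r.
  rewrite (_ : w 0%N = 1); last exact: hyp_term0.
  rewrite mulr1 (_ : -1 / 2 + z * W0 = z * W0 - 1 / 2); last by ring.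
  apply; move: zw; apply: eq_sums => i.
  by rewrite -wS' -natr1; field.
have e2 : W0 <= 1 + 2 * (z * W0).
  have hs := @sums_shift _ w (W0 - 1).
  have hS : sums (fun i => w i.+1) (W0 - 1).
    rewrite -cvg_shiftS in hW0.
    have -> : series (fun i => w i.+1) = (fun n => series w n.+1 - 1).
      apply/funext => n; rewrite /series/= big_nat_recl//= (_ : w 0%N = 1).
        by rewrite [1 + _]addrC addrK.
      exact: hyp_term0.
    by apply: cvgB => //; exact: cvg_cst.
  rewrite addrC -lerBlDr; apply: sums_ler hS (@sumsZ _ 2 _ _ zw) => i.
  rewrite -wS' mulrA ler_peMl ?(ltW (w0 _))//.
  have : (0 : R) <= i%:R by [].
  lra.
have AF : A * F = W0 + W1 by rewrite -WF A1 mul1r.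
rewrite AF.
have -> : W1 = z * W0 + (W0 - 1) / 2 by lra.
have zW0 : 0 < z * W0 by rewrite mulr_gt0//; lra.
rewrite -subr_gt0.
have -> : W0 * z * (W0 + (z * W0 + (W0 - 1) / 2)) - (z * W0 + (W0 - 1) / 2) ^+ 2
  = (z * W0 * (W0 + 1) - (W0 - 1) ^+ 2 / 2) / 2 by field.
have : (W0 - 1) ^+ 2 <= (W0 - 1) * (2 * (z * W0)).
  by rewrite expr2 ler_wpM2l; lra.
nra.
Qed.

End bayes_multiplier.

(** * Bounds and monotonicity of the Bayes and maximum likelihood multipliers *)

Section multipliers.
Context {R : realType} (p k : nat).
Hypotheses (p_gt0 : (0 < p)%N) (k_gt0 : (0 < k)%N).
Implicit Types m l t x : R.

Local Notation a l := ((k%:R + p%:R - l) / 2 + 1 : R).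
Local Notation b := (p%:R / 2 : R).
Local Notation z m t := (m ^+ 2 * t / (2 * (1 + t)) : R).

Let b_gt0 : 0 < b. Proof. by rewrite divr_gt0// ltr0n. Qed.

Let a_gt1 l : l < k%:R + p%:R -> 1 < a l.
Proof. by move=> lkp; rewrite ltrDr divr_gt0// subr_gt0. Qed.

Let z_ge0 m t : 0 <= t -> 0 <= z m t.
Proof. by move=> t0; apply: divr_ge0; [rewrite mulr_ge0 ?sqr_ge0|rewrite mulr_ge0 ?addr_ge0]. Qed.

Let z_gt0 m t : 0 < m -> 0 < t -> 0 < z m t.
Proof. by move=> m0 t0; apply: divr_gt0; rewrite mulr_gt0 ?exprn_gt0 ?addr_gt0. Qed.

Lemma hBU_ge0 m l t : l < k%:R + p%:R -> 0 <= t -> 0 <= hBU p k m l t.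
Proof.
move=> lkp t0; have a0 := lt_trans ltr01 (a_gt1 lkp).
rewrite /hBU; apply: mulr_ge0; first by rewrite divr_ge0 ?sqr_ge0.
apply: divr_ge0; apply: (le_trans ler01); apply: hyp1F1_ge1 => //;
  by rewrite ?z_ge0 ?addr_gt0.
Qed.

Lemma hBU_le m l t : l < k%:R + p%:R -> 0 <= t -> hBU p k m l t <= m ^+ 2 / p%:R.
Proof.
move=> lkp t0; have a0 := lt_trans ltr01 (a_gt1 lkp).
rewrite /hBU ler_piMr ?divr_ge0 ?sqr_ge0// ler_pdivrMr ?mul1r ?hyp1F1Db_le ?z_ge0//.
by rewrite (lt_le_trans ltr01)// hyp1F1_ge1 ?z_ge0.
Qed.

(** [l] enters only through the first parameter, which decreases in [l]; the quotient is decreasing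
    in that parameter. *)
Lemma hBU_homo_l m l l' t : l <= l' -> l' < k%:R + p%:R -> 0 <= t ->
  hBU p k m l t <= hBU p k m l' t.
Proof.
move=> ll' l'kp t0; have a0 := lt_trans ltr01 (a_gt1 l'kp).
have aa : a l' <= a l by lra.
have z0 := z_ge0 m t0.
have h := @hyp1F1_ratio_decr R (a l') (a l) b (z m t) a0 aa b_gt0 z0.
have F0 c : 1 < c -> 0 < hyp1F1 c b (z m t).
  by move=> c1; rewrite (lt_le_trans ltr01)// hyp1F1_ge1// (lt_trans _ c1).
have F1 := F0 _ (a_gt1 l'kp); have F2 := F0 _ (a_gt1 (le_lt_trans ll' l'kp)).
rewrite /hBU ler_wpM2l ?divr_ge0 ?sqr_ge0// ler_pdivrMr// [leRHS]mulrAC ler_pdivlMr//.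
apply: le_trans h; rewrite lerDl mulr_ge0//.
  by rewrite subr_ge0 ler_pdivrMr ?addr_gt0// mul1r lerDl.
by rewrite mulr_ge0// divr_ge0 ?subr_ge0// ltW.
Qed.

Lemma hBU_lt_l m l l' t : 0 < m -> l < l' -> l' < k%:R + p%:R -> 0 < t ->
  hBU p k m l t < hBU p k m l' t.
Proof.
move=> m0 ll' l'kp t0; have a0 := lt_trans ltr01 (a_gt1 l'kp).
have aa : a l' <= a l by lra.
have z0 := z_gt0 m0 t0.
have h := @hyp1F1_ratio_decr R (a l') (a l) b (z m t) a0 aa b_gt0 (ltW z0).
have F0 c : 1 < c -> 0 < hyp1F1 c b (z m t).
  by move=> c1; rewrite (lt_le_trans ltr01)// hyp1F1_ge1 ?(ltW z0)// (lt_trans _ c1).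
have F1 := F0 _ (a_gt1 l'kp); have F2 := F0 _ (a_gt1 (lt_trans ll' l'kp)).
have mp : 0 < m ^+ 2 / p%:R by rewrite divr_gt0 ?exprn_gt0 ?ltr0n.
have d0 : 0 < 1 - b / (b + 1) by rewrite subr_gt0 ltr_pdivrMr ?addr_gt0// mul1r ltrDl.
rewrite /hBU ltr_pM2l// ltr_pdivrMr// [ltRHS]mulrAC ltr_pdivlMr//.
apply: lt_le_trans h; rewrite ltrDl mulr_gt0// mulr_gt0// divr_gt0//.
by lra.
Qed.

(** Written as [2 * (1 + t) / (t * p)] times [z F(a, b + 1, z) / F(a, b, z)], the multiplier depends
    on [m] only through [z]. This is what lets the single bound [m] serve for every [|eta| <= m]. *)
Lemma hBU_homo_m m m' t : 0 <= m -> m <= m' -> 0 < t ->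
  hBU p k m 0 t <= hBU p k m' 0 t.
Proof.
move=> m0 mm' t0.
have a1 : 1 < a 0 by apply: a_gt1; rewrite -natrD ltr0n addn_gt0 p_gt0 orbT.
have t1 : 0 < 1 + t by rewrite addr_gt0.
have zz : z m t <= z m' t.
  rewrite ler_pM2r ?invr_gt0 ?mulr_gt0// ler_pM2r//.
  by rewrite lerXn2r// ?nnegrE// (le_trans m0).
have h := hyp1F1_ratio_incr a1 b_gt0 (z_ge0 m (ltW t0)) zz.
have F0 n : 0 < hyp1F1 (a 0) b (z n t).
  by rewrite (lt_le_trans ltr01)// hyp1F1_ge1 ?z_ge0 ?ltW// (lt_trans _ a1).
have e n : hBU p k n 0 t = 2 * (1 + t) / (t * p%:R) *
    (z n t * hyp1F1 (a 0) (b + 1) (z n t) / hyp1F1 (a 0) b (z n t)).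
  have F1 := F0 n; rewrite /hBU.
  move: (hyp1F1 _ (b + 1) _) (hyp1F1 _ b _) F1 => G F F1.
  by field; rewrite !gt_eqF// ltr0n.
rewrite !e ler_pM2l; last by rewrite divr_gt0// mulr_gt0// ltr0n.
by rewrite ler_pdivrMr// [leRHS]mulrAC ler_pdivlMr.
Qed.

(* The positive root [x] of [(p + k) / m ^+ 2 * x ^+ 2 + x = (1 + t) / t], of
   which [hmle] is the minimum with [1]. *)
Definition mle_root m t : R := m ^+ 2 / (2 * (p%:R + k%:R)) *
   (Num.sqrt (1 + 4 * (k%:R + p%:R) / m ^+ 2 * ((1 + t) / t)) - 1).

Lemma hmleE m t : 0 < t -> hmle p k m t = Num.min (mle_root m t) 1.
Proof. by move=> t0; rewrite /hmle t0. Qed.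

Lemma lt_mle_root m t x : 0 < m -> 0 < t -> 0 <= x ->
  (p%:R + k%:R) / m ^+ 2 * x ^+ 2 + x < (1 + t) / t -> x < mle_root m t.
Proof.
move=> m0 t0 x0 h; rewrite /mle_root.
have pk0 : 0 < p%:R + k%:R :> R by rewrite -natrD ltr0n addn_gt0 p_gt0.
have C0 : 0 < m ^+ 2 / (2 * (p%:R + k%:R)) by rewrite divr_gt0 ?exprn_gt0 ?mulr_gt0.
have kp0 : 0 < k%:R + p%:R :> R by rewrite addrC.
have C0' : 0 < (m ^+ 2 / (2 * (p%:R + k%:R)))^-1 by rewrite invr_gt0.
rewrite -ltr_pdivrMl//.
rewrite ltrBrDr -[ltLHS]ger0_norm; last first.
  by rewrite addr_ge0// mulr_ge0// ltW.
rewrite -sqrtr_sqr ltr_sqrt; last first.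
  rewrite addr_gt0// mulr_gt0//; first by rewrite divr_gt0 ?mulr_gt0 ?exprn_gt0.
  by rewrite divr_gt0 ?addr_gt0.
rewrite -subr_gt0.
have c0 : 0 < 4 * (p%:R + k%:R) / m ^+ 2 :> R.
  by rewrite ?divr_gt0 ?mulr_gt0 ?exprn_gt0 ?divr_gt0 ?exprn_gt0.
move: h; rewrite -subr_gt0 -(pmulr_rgt0 _ c0); congr (0 < _).
by field; rewrite !gt_eqF// -natrD ltr0n addn_gt0 p_gt0.
Qed.

(** At [x = 1] the quadratic defining the root is [(p + k) / m ^+ 2 + 1], which exceeds
    [(1 + t) / t = 1 + 1 / t] exactly beyond this threshold. *)
Lemma mle_root_lt1 m t : 0 < m -> m ^+ 2 / (p%:R + k%:R) < t -> mle_root m t < 1.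
Proof.
move=> m0 h; rewrite /mle_root.
have pk0 : 0 < p%:R + k%:R :> R by rewrite -natrD ltr0n addn_gt0 p_gt0.
have C0 : 0 < m ^+ 2 / (2 * (p%:R + k%:R)) by rewrite divr_gt0 ?exprn_gt0 ?mulr_gt0.
have kp0 : 0 < k%:R + p%:R :> R by rewrite addrC.
have C0' : 0 < (m ^+ 2 / (2 * (p%:R + k%:R)))^-1 by rewrite invr_gt0.
have t0 : 0 < t by apply: le_lt_trans h; rewrite divr_ge0 ?sqr_ge0 ?ltW.
rewrite -ltr_pdivlMl//.
rewrite ltrBlDr -[ltRHS]ger0_norm; last first.
  by rewrite addr_ge0// mulr_ge0// ltW.
rewrite -sqrtr_sqr ltr_sqrt; last first.
  by rewrite exprn_gt0// addr_gt0// mulr_gt0.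
rewrite -subr_gt0.
have c0 : 0 < 4 * ((p%:R + k%:R) / m ^+ 2) ^+ 2 / t :> R.
  by apply: divr_gt0 => //; apply: mulr_gt0 => //; rewrite exprn_gt0 ?divr_gt0 ?exprn_gt0.
move: h; rewrite -subr_gt0 -(pmulr_rgt0 _ c0); congr (0 < _).
by field; rewrite !gt_eqF// -natrD ltr0n addn_gt0 p_gt0.
Qed.

Lemma mle_root_ge0 m t : 0 < m -> 0 < t -> 0 <= mle_root m t.
Proof.
move=> m0 t0; have pk0 : 0 < p%:R + k%:R :> R by rewrite -natrD ltr0n addn_gt0 p_gt0.
have C0 : 0 < m ^+ 2 / (2 * (p%:R + k%:R)) by rewrite divr_gt0 ?exprn_gt0 ?mulr_gt0.
have kp0 : 0 < k%:R + p%:R :> R by rewrite addrC.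
have C0' : 0 < (m ^+ 2 / (2 * (p%:R + k%:R)))^-1 by rewrite invr_gt0.
have h : 0 <= 4 * (k%:R + p%:R) / m ^+ 2 * ((1 + t) / t).
  apply/ltW/mulr_gt0; last by rewrite divr_gt0 ?addr_gt0.
  by rewrite divr_gt0 ?mulr_gt0 ?exprn_gt0.
rewrite /mle_root mulr_ge0//; first by rewrite divr_ge0 ?sqr_ge0 ?mulr_ge0 ?ltW.
by rewrite subr_ge0 -[leLHS]sqrtr1 ler_wsqrtr// lerDl.
Qed.

(** Multiplied by [(1 + t) / t / (b * F) ^+ 2], [hyp1F1_ratio_quadratic] is exactly the condition of
    [lt_mle_root] at [x = hBU]. The two cases for [(p, k)] become [1 <= b] and [a = 2],
    [b = 1 / 2]. *)
Lemma hBU_lt_mle_root m t : 0 < m -> 0 < t ->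
  (2 <= p)%N \/ (p = 1%N /\ k = 1%N) -> hBU p k m 0 t < mle_root m t.
Proof.
move=> m0 t0 pk.
have lkp : (0 : R) < k%:R + p%:R by rewrite -natrD ltr0n addn_gt0 p_gt0 orbT.
apply: lt_mle_root => //; first by apply: hBU_ge0 => //; exact: ltW.
have a1 := a_gt1 lkp; have z0 := z_gt0 m0 t0.
have pk' : 1 <= b \/ (a 0 = 2 /\ b = 1 / 2).
  case: pk => [p2|[-> ->]]; last by right; split => //; lra.
  by left; rewrite ler_pdivlMr// mul1r ler_nat.
have := hyp1F1_ratio_quadratic a1 z0 pk'.
rewrite /hBU; set F := hyp1F1 _ b _; set G := hyp1F1 _ (b + 1) _.
have F0 : 0 < F.
  by rewrite (lt_le_trans ltr01)// hyp1F1_ge1 ?(ltW z0)// (lt_trans _ a1).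
have c0 : 0 < (1 + t) / t / (b * F) ^+ 2.
  by rewrite divr_gt0// ?divr_gt0// ?addr_gt0// exprn_gt0// mulr_gt0.
have p0 : 0 < p%:R :> R by rewrite ltr0n.
move: p%:R k%:R (F) (G) p0 F0 c0 => P K F' G' P0 F0 c0.
rewrite -subr_gt0 -(pmulr_rgt0 _ c0) => h; rewrite -subr_gt0; move: h.
by congr (0 < _); field; rewrite !gt_eqF// addr_gt0.
Qed.

Lemma hmle_ge0 m t : 0 < m -> 0 <= hmle p k m t.
Proof.
by move=> m0; rewrite /hmle; case: ifPn => // t0; rewrite le_min mle_root_ge0 ?ler01.
Qed.

Lemma hmle_le1 m t : hmle p k m t <= 1.
Proof. by rewrite /hmle; case: ifPn => // _; rewrite ge_min lexx orbT. Qed.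

End multipliers.

(** * Dilations and reflection of Lebesgue measure *)

Section lebesgue_change_of_variable.
Context {R : realType}.
Local Open Scope ereal_scope.
Local Notation mu := (@lebesgue_measure R).
Implicit Types f : measurableTypeR R -> \bar R.

(** Lebesgue measure is [c] times its image under [x |-> c * x], because the two agree on half-open
    intervals. *)
Lemma ge0_integral_lebesgue_scale (c : R) f : (0 < c)%R ->
  measurable_fun setT f -> (forall x, 0 <= f x) ->
  \int[mu]_x f x = c%:E * \int[mu]_x f (c * x)%R.
Proof.
move=> c0 mf f0.
have mc : measurable_fun setT (fun x : measurableTypeR R => (c * x)%R : measurableTypeR R).
  exact: mulrl_measurable.
pose nu : {measure set (measurableTypeR R) -> \bar R} := mscale (NngNum (ltW c0))
  (measure_function_pushforward__canonical__measure_function_Measure mu mc).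
have muE A : measurable A -> mu A = nu A.
  apply: lebesgue_measure_unique => _ [[a b]] _ <-.
  rewrite /nu /mscale /=.
  rewrite -[X in _ = _ * X]/(mu ((fun x => c * x)%R @^-1` [set` Interval (BRight a) (BRight b)])).
  rewrite (_ : _ @^-1` _ = `](a / c)%R, (b / c)%R]%classic); last first.
    apply/seteqP; split => x /=; rewrite !in_itv/=;
      by rewrite ltr_pdivrMr// ler_pdivlMr// (mulrC x).
  rewrite !lebesgue_measure_itv/= !lte_fin ltr_pM2r ?invr_gt0//.
  case: ifPn => _; last by rewrite mule0.
  by rewrite -!EFinB -EFinM -mulrBl mulrC divfK// gt_eqF.
rewrite (eq_measure_integral nu); last by move=> A mA _; exact: muE.
rewrite ge0_integral_mscale//; congr (_ * _).
by rewrite ge0_integral_pushforward//.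
Qed.

Lemma ge0_integral_lebesgue_opp f :
  measurable_fun setT f -> (forall x, 0 <= f x) ->
  \int[mu]_x f x = \int[mu]_x f (- x)%R.
Proof.
move=> mf f0.
rewrite (eq_measure_integral (pushforward mu (-%R : _ -> measurableTypeR R))); last first.
  by move=> A mA _; exact/esym/lebesgue_measureN.
by rewrite ge0_integral_pushforward.
Qed.

End lebesgue_change_of_variable.

(** * Integration against a measure given by a density *)

Section density.
Context d (T : measurableType d) (R : realType).
Local Open Scope ereal_scope.
Import HBNNSimple.
Variables (mu nu : {measure set T -> \bar R}) (g : T -> R).
Hypotheses (mg : measurable_fun setT g) (g0 : forall x, (0 <= g x)%R).
Hypothesis nuE : forall A, measurable A -> nu A = \int[mu]_(x in A) (g x)%:E.

Let density_nnsfun (h : {nnsfun T >-> R}) :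
  \int[nu]_x (h x)%:E = \int[mu]_x ((h x)%:E * (g x)%:E).
Proof.
have mE : measurable_fun setT (fun x => (g x)%:E) by exact/measurable_EFinP.
under [LHS]eq_integral do rewrite fimfunE -fsumEFin//.
rewrite [LHS]ge0_integral_fsum//; last 2 first.
  - by move=> r; exact/measurable_EFinP/measurableT_comp.
  - by move=> n x _; rewrite EFinM nnfun_muleindic_ge0.
under [RHS]eq_integral.
  move=> x _; rewrite fimfunE -fsumEFin// ge0_mule_fsuml; last first.
    by move=> r; rewrite EFinM nnfun_muleindic_ge0.
  over.
rewrite [RHS]ge0_integral_fsum//; last 2 first.
  - by move=> r; apply: emeasurable_funM => //; exact/measurable_EFinP/measurableT_comp.
  - by move=> n x _; rewrite mule_ge0 ?lee_fin// -lee_fin EFinM nnfun_muleindic_ge0.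
apply: eq_fsbigr => r _; have [r0|r0] := ltP r 0%R.
  rewrite !integral0_eq// => x _; rewrite (preimage_nnfun0 _ r0) indic0 mulr0//.
  by rewrite mul0e.
rewrite integralZl_indic_nnsfun//= integral_indic// setIT nuE//.
rewrite integral_mkcond -ge0_integralZl//; last 2 first.
  - apply/(measurable_restrictT _ _).1 => //; exact: measurable_funTS.
  - by move=> x _; apply: erestrict_ge0 => y _; rewrite lee_fin.
apply: eq_integral => x _; rewrite EFinM -muleA; congr (_ * _).
by rewrite patchE indicE; case: ifP => _; rewrite ?mul1e ?mul0e.
Qed.

Lemma ge0_integral_density (f : T -> \bar R) :
  measurable_fun setT f -> (forall x, 0 <= f x) ->
  \int[nu]_x f x = \int[mu]_x (f x * (g x)%:E).
Proof.
move=> mf f0; pose f_ := nnsfun_approx measurableT mf.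
have mE : measurable_fun setT (fun x => (g x)%:E) by exact/measurable_EFinP.
transitivity (limn (fun n => \int[nu]_x (f_ n x)%:E)).
  rewrite -monotone_convergence//=.
  - apply: eq_integral => x _; apply/esym/cvg_lim => //=.
    exact: cvg_nnsfun_approx.
  - by move=> n; exact/measurable_EFinP.
  - by move=> n x _; rewrite lee_fin.
  - by move=> x _ m n mn; rewrite lee_fin; exact/lefP/nd_nnsfun_approx.
under eq_fun do rewrite density_nnsfun.
rewrite -monotone_convergence//=.
- apply: eq_integral => x _; apply/cvg_lim => //=.
  by apply: cvgeZr => //; exact: cvg_nnsfun_approx.
- by move=> n; apply: emeasurable_funM => //; exact/measurable_EFinP.
- by move=> n x _; rewrite mule_ge0// lee_fin.
- move=> x _ m n mn; rewrite lee_wpmul2r ?lee_fin//.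
  exact/lefP/nd_nnsfun_approx.
Qed.

End density.

(** * One-dimensional normal integrals: tilting, reflection, folding *)

Section standard_normal.
Context {R : realType}.
Local Open Scope ereal_scope.
Local Notation mu := (@lebesgue_measure R).
Local Notation T := (measurableTypeR R).
Local Notation N01 := (normal_prob (0 : R) 1).
Implicit Types f : T -> \bar R.

(** Unnormalized density of the chi law with [n + 1] degrees of freedom. The indicator is part of
    the weight so that every integral runs over the whole line. *)
Definition chi_weight (n : nat) (r : R) : R :=
  \1_`]0%R, +oo[%classic r * (r ^+ n * expR (- r ^+ 2 / 2)).

Lemma chi_weightE n r :
  chi_weight n r = if (0 < r)%R then (r ^+ n * expR (- r ^+ 2 / 2))%R else 0%R.
Proof.
rewrite /chi_weight indicE; case: ifPn => r0.
  by rewrite mem_set/= ?mul1r// in_itv/= r0.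
by rewrite memNset/= ?mul0r// in_itv/= andbT; exact/negP.
Qed.

Lemma chi_weight_ge0 n r : (0 <= chi_weight n r)%R.
Proof.
by rewrite chi_weightE; case: ifPn => // r0; rewrite mulr_ge0 ?expR_ge0// exprn_ge0// ltW.
Qed.

Lemma measurable_chi_weight n : measurable_fun [set: T] (chi_weight n : T -> T).
Proof.
apply: measurable_funM; first exact: measurable_indic.
apply: measurable_funM; first exact: measurable_funX.
apply: measurableT_comp => //; apply: measurable_funM => //.
by apply: measurableT_comp => //; exact: measurable_funX.
Qed.

Lemma ge0_integral_normal (m s : R) f :
  measurable_fun setT f -> (forall x, 0 <= f x) ->
  \int[normal_prob m s]_x f x = \int[mu]_x (f x * (normal_pdf m s x)%:E).
Proof.
move=> mf f0; apply: ge0_integral_density => //.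
- exact: measurable_normal_pdf.
- by move=> x; exact: normal_pdf_ge0.
Qed.

Lemma normal_pdf01 (x : R) : normal_pdf 0 1 x = (normal_peak 1 * expR (- x ^+ 2 / 2))%R.
Proof.
by rewrite normal_pdfE ?oner_eq0// /normal_fun subr0 expr1n.
Qed.

Lemma normal_pdf_tilt (m s u : R) : (0 < s)%R ->
  (s * normal_pdf m s (s * u) =
   expR (m / s * u - (m / s) ^+ 2 / 2) * normal_pdf 0 1 u)%R.
Proof.
move=> s0; rewrite normal_pdf01 normal_pdfE ?gt_eqF//.
have -> : (normal_peak s = s^-1 * normal_peak 1)%R.
  rewrite /normal_peak expr1n mul1r -mulrnAr sqrtrM ?sqr_ge0//.
  by rewrite sqrtr_sqr gtr0_norm// invfM.
rewrite mulrA mulrA divff ?gt_eqF// mul1r mulrCA -expRD; congr (_ * expR _)%R.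
by field; rewrite gt_eqF.
Qed.

(** The dilation [x = s * u] normalizes the variance; the remaining shift by [m / s] is a likelihood
    ratio against the standard law. *)
Lemma ge0_integral_normal_tilt (m s : R) f : (0 < s)%R ->
  measurable_fun setT f -> (forall x, 0 <= f x) ->
  \int[normal_prob m s]_x f x =
  \int[N01]_u (f (s * u)%R * (expR (m / s * u - (m / s) ^+ 2 / 2))%:E).
Proof.
move=> s0 mf f0; rewrite ge0_integral_normal//.
have mfs : measurable_fun setT (fun u : T => f (s * u)%R).
  by apply: (measurableT_comp mf); exact: mulrl_measurable.
have me : measurable_fun setT (fun u : T => (expR (m / s * u - (m / s) ^+ 2 / 2))%:E).
  apply/measurable_EFinP; apply: measurableT_comp => //.
  by apply: measurable_funB => //; exact: mulrl_measurable.
have mp : measurable_fun setT (fun u : T => (normal_pdf m s u)%:E).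
  by apply/measurable_EFinP; exact: measurable_normal_pdf.
have mps : measurable_fun setT (fun u : T => (normal_pdf m s (s * u))%:E).
  by apply: (measurableT_comp mp); exact: mulrl_measurable.
rewrite (ge0_integral_lebesgue_scale s0); last 2 first.
- exact: emeasurable_funM.
- by move=> x; rewrite mule_ge0// lee_fin normal_pdf_ge0.
rewrite ge0_integral_normal; last 2 first.
- exact: emeasurable_funM.
- by move=> x; rewrite mule_ge0// lee_fin expR_ge0.
rewrite -ge0_integralZl//; last 3 first.
- exact: emeasurable_funM.
- by move=> x _; rewrite mule_ge0// lee_fin normal_pdf_ge0.
- by rewrite lee_fin ltW.
apply: eq_integral => u _; rewrite muleCA -muleA -!EFinM.
by rewrite normal_pdf_tilt.
Qed.

Lemma ge0_integral_normal_opp f :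
  measurable_fun setT f -> (forall x, 0 <= f x) ->
  \int[N01]_x f x = \int[N01]_x f (- x)%R.
Proof.
move=> mf f0.
have mo : measurable_fun setT (fun x : T => (- x)%R : T) by exact: oppr_measurable.
have mp : measurable_fun setT (fun u : T => (normal_pdf 0 1 u)%:E).
  by apply/measurable_EFinP; exact: measurable_normal_pdf.
rewrite !ge0_integral_normal//; last exact: (measurableT_comp mf).
have mF : measurable_fun setT (fun x : T => f x * (normal_pdf 0 1 x)%:E).
  exact: emeasurable_funM.
have F0 (x : R) : 0 <= f x * (normal_pdf 0 1 x)%:E.
  by rewrite mule_ge0// lee_fin normal_pdf_ge0.
apply: (etrans (ge0_integral_lebesgue_opp mF F0)).
by apply: eq_integral => x _; rewrite !normal_pdf01 sqrrN.
Qed.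

Lemma ge0_integral_even f :
  measurable_fun setT f -> (forall x, 0 <= f x) -> (forall x, f (- x)%R = f x) ->
  \int[mu]_x f x = 2%:E * \int[mu]_x (f x * (\1_`]0%R, +oo[%classic x)%:E).
Proof.
move=> mf f0 fe.
have mo : measurable_fun setT (fun x : T => (- x)%R : T) by exact: oppr_measurable.
have mi : measurable_fun setT (fun x : T => (\1_`]0%R, +oo[%classic x : R)%:E).
  by apply/measurable_EFinP; exact: measurable_indic.
have mio : measurable_fun setT (fun x : T => (\1_`]0%R, +oo[%classic (- x)%R : R)%:E).
  exact: (measurableT_comp mi).
have i0 (x : R) : 0 <= (\1_`]0%R, +oo[%classic x : R)%:E by rewrite lee_fin.
(* The origin is removed so that the two open half-lines cover the domain; both indicators vanish
   there. *)
rewrite -(@integral_setD1 _ _ 0%R); last exact: measurable_funTS.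
rewrite integral_mkcond.
transitivity (\int[mu]_x (f x * (\1_`]0%R, +oo[%classic x)%:E +
                         f (- x)%R * (\1_`]0%R, +oo[%classic (- x)%R)%:E)).
  apply: eq_integral => x _; rewrite patchE fe -ge0_muleDr//.
  rewrite !indicE -EFinD -natrD.
  case: ifPn => [/set_mem/=[_ /eqP x0]|/negP xn].
    have [x1|x1|x1] := ltgtP x 0%R; last by rewrite x1 eqxx in x0.
      rewrite memNset ?mem_set/= ?mule1//; first by rewrite in_itv/= andbT oppr_gt0.
      by rewrite in_itv/= andbT; apply/negP; rewrite -leNgt ltW.
    rewrite mem_set ?memNset/= ?addn0 ?mule1//; last by rewrite in_itv/= andbT.
    by rewrite in_itv/= andbT oppr_gt0; apply/negP; rewrite -leNgt ltW.
  have -> : x = 0%R.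
    by apply/eqP; apply/negPn/negP => x0; apply: xn; rewrite inE/=; split => //; exact/eqP.
  by rewrite oppr0 memNset ?mule0//= in_itv/= ltxx.
rewrite ge0_integralD//; last 4 first.
- by move=> x _; rewrite mule_ge0.
- exact: emeasurable_funM.
- by move=> x _; rewrite mule_ge0.
- by apply: emeasurable_funM => //; exact: (measurableT_comp mf).
rewrite -(ge0_integral_lebesgue_opp
  (f := fun x => f x * (\1_`]0%R, +oo[%classic x)%:E)); last 2 first.
- exact: emeasurable_funM.
- by move=> x; rewrite mule_ge0.
by rewrite [in RHS](_ : 2%:E = 1 + 1)// ge0_muleDl ?mul1e ?lee_fin.
exact: measurableD.
Qed.

Lemma ge0_integral_normal_sqr f (n : nat) :
  measurable_fun setT f -> (forall x, 0 <= f x) ->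
  \int[N01]_x (f (x ^+ 2)%R * (x ^+ n.*2)%:E) =
  (2 * normal_peak 1)%:E * \int[mu]_r (f (r ^+ 2)%R * (chi_weight n.*2 r)%:E).
Proof.
move=> mf f0.
have mf2 : measurable_fun setT (fun x : T => f (x ^+ 2)%R).
  by apply: (measurableT_comp mf); exact: measurable_funX.
have mx : measurable_fun setT (fun x : T => (x ^+ n.*2)%:E).
  by apply/measurable_EFinP; exact: measurable_funX.
have mp : measurable_fun setT (fun u : T => (normal_pdf 0 1 u)%:E).
  by apply/measurable_EFinP; exact: measurable_normal_pdf.
have x0 (x : R) : (0 <= x ^+ n.*2)%R by rewrite -muln2 exprM sqr_ge0.
have mw : measurable_fun setT (fun u : T => (chi_weight n.*2 u)%:E).
  by apply/measurable_EFinP; exact: measurable_chi_weight.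
rewrite ge0_integral_normal; last 2 first.
- exact: emeasurable_funM.
- by move=> x; rewrite mule_ge0// lee_fin.
rewrite ge0_integral_even; last 3 first.
- by apply: emeasurable_funM => //; exact: emeasurable_funM.
- by move=> x; rewrite !mule_ge0// lee_fin// normal_pdf_ge0.
- by move=> x; rewrite -!mul2n !exprM !normal_pdf01 !sqrrN.
rewrite EFinM -muleA; congr (_ * _).
rewrite -ge0_integralZl//; last 3 first.
- exact: emeasurable_funM.
- by move=> x _; rewrite mule_ge0// lee_fin chi_weight_ge0.
- by rewrite lee_fin normal_peak_ge0.
apply: eq_integral => x _; rewrite normal_pdf01 /chi_weight.
rewrite muleCA -!muleA; congr (_ * _); rewrite -!EFinM; congr EFin.
by ring.
Qed.

End standard_normal.

(** * Total masses of the chi weights and their recurrence *)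

Section chi_mass.
Context {R : realType}.
Local Open Scope ereal_scope.
Local Notation mu := (@lebesgue_measure R).
Local Notation T := (measurableTypeR R).

Let mw n : measurable_fun [set: T] (fun r : T => (chi_weight n r)%:E).
Proof. by apply/measurable_EFinP; exact: measurable_chi_weight. Qed.

Let w0 n (r : T) : 0 <= (chi_weight n r)%:E.
Proof. by rewrite lee_fin chi_weight_ge0. Qed.

Let W n := \int[mu]_r (chi_weight n r)%:E.

Let W_ge0 n : 0 <= W n. Proof. exact: integral_ge0. Qed.

(** The weight with its Gaussian factor dilated by [s] and its power left alone. Comparing it with
    [s = 1] takes the place of integration by parts. *)
Let g n (s r : R) := (s^-1 ^+ n * chi_weight n (s * r))%R.

Let gE n s r : (0 < s)%R ->
  g n s r = if (0 < r)%R then (r ^+ n * expR (- (s * r) ^+ 2 / 2))%R else 0%R.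
Proof.
move=> s0; rewrite /g chi_weightE pmulr_rgt0//; case: ifPn => _; last by rewrite mulr0.
by rewrite mulrA exprMn exprVn mulKf// expf_neq0// gt_eqF.
Qed.

Let mg n s : measurable_fun [set: T] (fun r : T => (g n s r)%:E).
Proof.
under eq_fun do rewrite EFinM.
by apply: measurable_funeM; apply: (measurableT_comp (mw n)); exact: mulrl_measurable.
Qed.

Let g0 n s r : (0 < s)%R -> 0 <= (g n s r)%:E.
Proof.
by move=> s0; rewrite lee_fin mulr_ge0 ?chi_weight_ge0// exprn_ge0// invr_ge0 ltW.
Qed.

Let int_g n s : (0 < s)%R -> \int[mu]_r (g n s r)%:E = (s^-1 ^+ n.+1)%:E * W n.
Proof.
move=> s0; rewrite /W (ge0_integral_lebesgue_scale s0 (mw n) (w0 n)).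
rewrite muleA -EFinM exprSr mulrVK ?unitfE ?gt_eqF//.
rewrite -ge0_integralZl ?lee_fin ?exprn_ge0 ?invr_ge0 ?(ltW s0)//.
by apply: (measurableT_comp (mw n)); exact: mulrl_measurable.
Qed.

(* The next two bounds integrate [1 + x <= expR x] with
   [x = (s ^+ 2 - 1) * r ^+ 2 / 2] and its opposite; the recurrence
   [W n.+2 = n.+1 * W n] follows by letting [s] tend to [1]. *)
Let W_ub n s : (1 < s)%R ->
  ((s ^+ 2 - 1) / 2 * s^-1 ^+ n.+3)%:E * W n.+2 + (s^-1 ^+ n.+1)%:E * W n <= W n.
Proof.
move=> s1; have s0 : (0 < s)%R by lra.
have c0 : (0 <= (s ^+ 2 - 1) / 2)%R by rewrite divr_ge0// subr_ge0 exprn_ege1// ltW.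
rewrite EFinM -muleA -!int_g// -ge0_integralZl//; last by move=> r _; exact: g0.
rewrite -ge0_integralD//; last 3 first.
- by move=> r _; rewrite mule_ge0 ?g0.
- exact: measurable_funeM.
- by move=> r _; exact: g0.
apply: ge0_le_integral => //.
- by move=> r _; rewrite adde_ge0 ?mule_ge0 ?g0.
- by apply: emeasurable_funD => //; exact: measurable_funeM.
move=> r _; rewrite -EFinM -EFinD lee_fin !gE// chi_weightE.
case: ifPn => r0; last by rewrite mulr0 addr0.
have -> : (- r ^+ 2 / 2 = (s ^+ 2 - 1) / 2 * r ^+ 2 + - (s * r) ^+ 2 / 2)%R by field.
rewrite expRD; set e := expR (- (s * r) ^+ 2 / 2).
rewrite (_ : _ + _ = r ^+ n * ((1 + (s ^+ 2 - 1) / 2 * r ^+ 2) * e))%R; last first.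
  by rewrite !exprS; ring.
rewrite ler_wpM2l ?exprn_ge0 ?(ltW r0)// ler_wpM2r ?expR_ge0//.
exact: expR_ge1Dx.
Qed.

Let W_lb n s : (1 < s)%R ->
  W n <= (s^-1 ^+ n.+1)%:E * W n + ((s ^+ 2 - 1) / 2)%:E * W n.+2.
Proof.
move=> s1; have s0 : (0 < s)%R by lra.
have c0 : (0 <= (s ^+ 2 - 1) / 2)%R by rewrite divr_ge0// subr_ge0 exprn_ege1// ltW.
rewrite -!int_g// -ge0_integralZl// -ge0_integralD//; last 3 first.
- by move=> r _; exact: g0.
- by move=> r _; rewrite mule_ge0.
- exact: measurable_funeM.
apply: ge0_le_integral => //.
  by apply: emeasurable_funD => //; exact: measurable_funeM.
move=> r _; rewrite -EFinM -EFinD lee_fin !gE// !chi_weightE.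
case: ifPn => r0; last by rewrite mulr0 addr0.
have -> : (- (s * r) ^+ 2 / 2 = - ((s ^+ 2 - 1) / 2 * r ^+ 2) + - r ^+ 2 / 2)%R by field.
rewrite expRD; set e := expR (- r ^+ 2 / 2); set x := ((s ^+ 2 - 1) / 2 * r ^+ 2)%R.
rewrite [leRHS](_ : _ = r ^+ n * ((expR (- x) + x) * e))%R; last first.
  by rewrite /x !exprS; ring.
rewrite ler_wpM2l ?exprn_ge0 ?(ltW r0)// ler_peMl ?expR_ge0//.
by have := expR_ge1Dx (- x)%R; lra.
Qed.

(** [W_ub] at [s = 2] bounds a positive multiple of [W n.+2] by [W n]. *)
Let W_fin n : W n \is a fin_num -> W n.+2 \is a fin_num.
Proof.
move=> Wn; have h12 : (1 < 2 :> R)%R by lra.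
have := @W_ub n _ h12; have := W_ge0 n.+2; move: (W n) Wn (W_ge0 n) => [x| |]// _ x0.
case: (W n.+2) => [y| |]//.
rewrite gt0_muley//.
by rewrite lte_fin mulr_gt0// ?exprn_gt0// divr_gt0// subr_gt0 expr2; lra.
Qed.

(** The standard normal law has mass [1]; folding it on the half-line gives twice the peak times
    this integral. *)
Lemma chi_mass0 : \int[mu]_r (chi_weight 0 r)%:E = ((2 * normal_peak 1)^-1)%:E :> \bar R.
Proof.
have := @ge0_integral_normal_sqr R (cst 1) 0 (measurable_cst _) (fun=> lee01).
under eq_integral do rewrite mul1e expr0.
rewrite integral_cst// [X in 1 * X](probability_setT (normal_prob 0 1)) mul1e.
under eq_integral do rewrite mul1e.
rewrite -/(W 0).
have p0 : (0 < 2 * normal_peak 1 :> R)%R by rewrite mulr_gt0// normal_peak_gt0// oner_eq0.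
move: (W_ge0 0); case: (W 0) => [x| |]//; last by rewrite gt0_muley ?lte_fin.
move=> _; rewrite -EFinM => -[e]; congr EFin.
by apply: (mulfI (lt0r_neq0 p0)); rewrite -e divff// gt_eqF.
Qed.

(** From [r <= 1 + r ^+ 2]. It links the two parities: finiteness of [W 1] comes from [W 0] and
    [W 2], positivity of [W 1] from [W 2 <= W 1 + W 3]. *)
Let W_le2 n : W n.+1 <= W n + W n.+2.
Proof.
rewrite -ge0_integralD//; apply: ge0_le_integral => //.
  exact: emeasurable_funD.
move=> r _; rewrite -EFinD lee_fin !chi_weightE; case: ifPn => r0; last by rewrite addr0.
rewrite -mulrDl ler_wpM2r ?expR_ge0// !exprS.
rewrite (_ : r ^+ n + r * (r * r ^+ n) = (1 + r * r) * r ^+ n)%R; last by ring.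
by rewrite ler_wpM2r ?exprn_ge0 ?ltW//; nra.
Qed.

Let W_fin_all n : W n \is a fin_num.
Proof.
have W0 : W 0 \is a fin_num by rewrite /W chi_mass0.
have W1 : W 1 \is a fin_num.
  rewrite ge0_fin_numE// (le_lt_trans (W_le2 0))// lte_add_pinfty// -ge0_fin_numE//.
  exact: W_fin.
by have [] : W n \is a fin_num /\ W n.+1 \is a fin_num;
  first by elim: n => [|n [? ?]]; split => //; exact: W_fin.
Qed.

Definition chi_mass n : R := fine (\int[mu]_r (chi_weight n r)%:E).

Lemma chi_massE n : \int[mu]_r (chi_weight n r)%:E = (chi_mass n)%:E.
Proof. by rewrite /chi_mass fineK//; exact: W_fin_all. Qed.

Lemma chi_mass_ge0 n : (0 <= chi_mass n)%R.
Proof. by apply: fine_ge0; exact: W_ge0. Qed.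

(** With [exprB1_ge], two-sided bounds on [(s ^+ N - 1) / (s - 1)] that stand for the derivative of
    [s ^+ N] at [1]. *)
Let exprB1_le (s : R) N : (1 <= s)%R -> (s ^+ N - 1 <= N%:R * (s ^+ N * (s - 1)))%R.
Proof.
move=> s1; elim: N => [|N IH]; first by rewrite expr0 subrr mul0r.
rewrite exprS -natr1; have h : (1 <= s ^+ N)%R by exact: exprn_ege1.
move: IH; set x := (s ^+ N)%R; set y := (N%:R * (x * (s - 1)))%R.
rewrite (_ : (N%:R + 1) * (s * x * (s - 1)) = s * y + s * x * (s - 1))%R; last by rewrite /y; ring.
move=> IH; have s0 : (0 <= s)%R by lra.
have := ler_wpM2l s0 IH.
have : (0 <= (s - 1) * (s * x - 1))%R by rewrite mulr_ge0 ?subr_ge0// mulr_ege1.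
by lra.
Qed.

Let exprB1_ge (s : R) N : (1 <= s)%R -> (N%:R * (s - 1) <= s ^+ N - 1)%R.
Proof.
move=> s1; elim: N => [|N IH]; first by rewrite expr0 subrr mul0r.
rewrite exprS -natr1; have h : (1 <= s ^+ N)%R by exact: exprn_ege1.
by nra.
Qed.

Let le_expr_lim (x y : R) M : (0 <= y)%R ->
  (forall s, 1 < s -> x <= s ^+ M * y)%R -> (x <= y)%R.
Proof.
move=> y0 h; rewrite leNgt; apply/negP => yx.
have cvg1 : (s ^+ M * y @[s --> (1 : R)^'+] --> 1 ^+ M * y)%R.
  apply: cvgM; last exact: cvg_cst.
  by apply: cvg_at_right_filter; exact: exprn_continuous.
have : (x <= 1 ^+ M * y)%R.
  apply: (cvgr_to_ge cvg1); near=> s; apply: h.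
  by near: s; exact: nbhs_right_gt.
by rewrite expr1n mul1r leNgt yx.
Unshelve. all: by end_near. Qed.

Lemma chi_massSS n : chi_mass n.+2 = (n.+1%:R * chi_mass n)%R.
Proof.
have C0 := chi_mass_ge0 n; have C2 := chi_mass_ge0 n.+2.
apply/eqP; rewrite eq_le; apply/andP; split.
  apply: (@le_expr_lim _ _ n.+3); first by rewrite mulr_ge0.
  move=> s s1; have := W_ub n s1; rewrite /W !chi_massE -!EFinM -EFinD lee_fin => h.
  have s0 : (0 < s)%R by lra.
  have b := @exprB1_le s n.+1 (ltW s1).
  have sn : (0 < s ^+ n.+3)%R by rewrite exprn_gt0.
  have e3 : (s ^+ n.+3 * s^-1 ^+ n.+3 = 1)%R by rewrite -exprMn divff ?gt_eqF// expr1n.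
  have e1 : (s ^+ n.+3 * s^-1 ^+ n.+1 = s ^+ 2)%R.
    by rewrite -(addn2 n.+1) exprD mulrAC -exprMn divff ?gt_eqF// expr1n mul1r.
  move: h; rewrite -(ler_pM2l sn).
  rewrite [(_ * (_ + _))%R](_ : _ = (s ^+ 2 - 1) / 2 * (s ^+ n.+3 * s^-1 ^+ n.+3) * chi_mass n.+2
    + s ^+ n.+3 * s^-1 ^+ n.+1 * chi_mass n)%R; last by ring.
  rewrite e3 e1 mulr1.
  rewrite -(addn2 n.+1) exprD; move: b.
  set t := (s ^+ n.+1)%R; move: (chi_mass n) (chi_mass n.+2) C0 C2 => x y x0 y0 b h.
  have : ((t - 1) * (s ^+ 2 * x) <= n.+1%:R * (t * (s - 1)) * (s ^+ 2 * x))%R.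
    by rewrite ler_wpM2r// mulr_ge0// sqr_ge0.
  (* Restoring the common factor [s - 1] makes the goal linear in the bounds at hand;
     [(s ^+ 2 - 1) / 2] exceeds [s - 1] by [(s - 1) ^+ 2 / 2]. *)
  move=> b'; rewrite -(@ler_pM2l _ (s - 1)) ?subr_gt0//.
  have : (0 <= (s - 1) ^+ 2 * y)%R by rewrite mulr_ge0// sqr_ge0.
  by move: h b'; rewrite !expr2; lra.
apply: (@le_expr_lim _ _ n.+2) => // s s1.
have := W_lb n s1; rewrite /W !chi_massE -!EFinM -EFinD lee_fin => h.
have s0 : (0 < s)%R by lra.
have b := @exprB1_ge s n.+1 (ltW s1).
have sn : (0 < s ^+ n.+1)%R by rewrite exprn_gt0.
move: h; rewrite -(ler_pM2l sn) mulrDr mulrA -exprMn divff ?gt_eqF// expr1n mul1r.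
rewrite [(s ^+ n.+2)%R]exprS; move: b.
set t := (s ^+ n.+1)%R in sn *; move: (chi_mass n) (chi_mass n.+2) C0 C2 => x y x0 y0 b h.
have b' : (n.+1%:R * (s - 1) * x <= (t - 1) * x)%R by rewrite ler_wpM2r.
rewrite -(@ler_pM2l _ (s - 1)) ?subr_gt0//.
have : (0 <= (s - 1) ^+ 2 * (t * y))%R by rewrite mulr_ge0 ?sqr_ge0// mulr_ge0// ltW.
by move: h b'; rewrite !expr2; lra.
Qed.

Lemma chi_mass_gt0 n : (0 < chi_mass n)%R.
Proof.
have C0 : (0 < chi_mass 0)%R.
  by rewrite /chi_mass chi_mass0/= invr_gt0 mulr_gt0// normal_peak_gt0// oner_eq0.
have C1 : (0 < chi_mass 1)%R.
  have := W_le2 1; rewrite /W !chi_massE -EFinD lee_fin !chi_massSS mul1r.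
  by move=> h; lra.
have [] : (0 < chi_mass n)%R /\ (0 < chi_mass n.+1)%R => //.
by elim: n => [|n [? ?]]; split => //; rewrite chi_massSS mulr_gt0// ltr0n.
Qed.

End chi_mass.

(** * Polar coordinates for a pair of radii *)

Section polar.
Context {R : realType}.
Local Open Scope ereal_scope.
Local Notation mu := (@lebesgue_measure R).
Local Notation T := (measurableTypeR R).

(* The density, up to a constant, of the ratio of two independent variables
   with densities proportional to [chi_weight b] and [chi_weight a]. *)
Definition ratio_weight (a b : nat) (t : R) : R :=
  \1_`]0%R, +oo[%classic t * (t ^+ b / Num.sqrt (1 + t ^+ 2) ^+ (a + b).+2).

Lemma ratio_weightE a b t : ratio_weight a b t =
  if (0 < t)%R then (t ^+ b / Num.sqrt (1 + t ^+ 2) ^+ (a + b).+2)%R else 0%R.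
Proof.
rewrite /ratio_weight indicE; case: ifPn => r0.
  by rewrite mem_set/= ?mul1r// in_itv/= r0.
by rewrite memNset/= ?mul0r// in_itv/= andbT; exact/negP.
Qed.

Lemma ratio_weight_ge0 a b t : (0 <= ratio_weight a b t)%R.
Proof.
rewrite ratio_weightE; case: ifPn => // t0.
by rewrite divr_ge0 ?exprn_ge0 ?sqrtr_ge0 ?ltW.
Qed.

Let c_gt0 (t : R) : (0 < Num.sqrt (1 + t ^+ 2))%R.
Proof. by rewrite sqrtr_gt0 ltr_pwDl ?ltr01 ?sqr_ge0. Qed.

Let measurable_c : measurable_fun [set: T] (fun t : T => Num.sqrt (1 + t ^+ 2)%R : T).
Proof.
apply: measurableT_comp.
  by apply: continuous_measurable_fun; exact: sqrt_continuous.
by apply: measurable_funD => //; exact: measurable_funX.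
Qed.

(* [ln] is total, with [ln 0 = 0], so that the formula also holds at [0]. *)
Lemma measurable_invr : measurable_fun [set: T] (fun x : T => x^-1%R : T).
Proof.
have -> : (fun x : T => x^-1%R : T) = (fun x => x * expR (- ln (x ^+ 2)))%R.
  apply/funext => x; have [->|x0] := eqVneq x 0%R; first by rewrite invr0 mul0r.
  rewrite expRN lnK ?posrE ?exprn_even_gt0//.
  by rewrite expr2 invfM mulrA divff// mul1r.
apply: measurable_funM => //; apply: measurableT_comp => //.
apply: measurableT_comp => //; apply: measurableT_comp; first exact: measurable_ln.
exact: measurable_funX.
Qed.

Lemma measurable_ratio_weight a b : measurable_fun [set: T] (ratio_weight a b : T -> T).
Proof.
apply: measurable_funM; first exact: measurable_indic.
apply: measurable_funM; first exact: measurable_funX.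
apply: (measurableT_comp measurable_invr).
by apply: measurable_funX; exact: measurable_c.
Qed.

(* Polar coordinates [r = s * t], [rho ^+ 2 = s ^+ 2 + r ^+ 2]. *)
Lemma ge0_integral_polar (f q : T -> \bar R) (a b : nat) :
  measurable_fun setT f -> (forall x, 0 <= f x) ->
  measurable_fun setT q -> (forall x, 0 <= q x) ->
  \int[mu]_s \int[mu]_r (f (s ^+ 2 + r ^+ 2)%R * q (r / s)%R *
                         (chi_weight a s * chi_weight b r)%:E) =
  (\int[mu]_t (q t * (ratio_weight a b t)%:E)) *
  (\int[mu]_r (f (r ^+ 2)%R * (chi_weight (a + b).+1 r)%:E)).
Proof.
move=> mf f0 mq q0.
pose c (t : R) := Num.sqrt (1 + t ^+ 2).
have cE t : (c t ^+ 2 = 1 + t ^+ 2)%R by rewrite /c sqr_sqrtr// addr_ge0 ?sqr_ge0.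
pose F (r : T) := f (r ^+ 2)%R * (chi_weight (a + b).+1 r)%:E.
have mF : measurable_fun setT F.
  apply: emeasurable_funM; first by apply: (measurableT_comp mf); exact: measurable_funX.
  by apply/measurable_EFinP; exact: measurable_chi_weight.
have F0 r : 0 <= F r by rewrite mule_ge0 ?lee_fin ?chi_weight_ge0.
(* [F] will be taken at [c t * s]; rescaling [s] then costs [1 / c t], which the additional factor
   [c t] compensates. *)
pose Q (t : T) := q t * (c t * ratio_weight a b t)%:E.
have mQ : measurable_fun setT Q.
  apply: emeasurable_funM => //; apply/measurable_EFinP.
  by apply: measurable_funM => //; exact: measurable_ratio_weight.
have Q0 t : 0 <= Q t.
  by rewrite mule_ge0 ?lee_fin// mulr_ge0 ?ratio_weight_ge0// sqrtr_ge0.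
pose K (st : T * T) := F (c st.2 * st.1)%R * Q st.2.
have mK : measurable_fun setT K.
  apply: emeasurable_funM; last exact: (measurableT_comp mQ).
  apply: (measurableT_comp mF); apply: measurable_funM => //.
  exact: (measurableT_comp measurable_c).
have K0 st : 0 <= K st by rewrite mule_ge0.
transitivity (\int[mu]_s \int[mu]_t K (s, t)).
  apply: eq_integral => s _.
  have [s0|s0] := ltP 0%R s; last first.
    rewrite !integral0_eq// => x _.
      by rewrite /K /F/= chi_weightE (pmulr_rgt0 _ (c_gt0 x)) ltNge s0/= mule0 mul0e.
    by rewrite chi_weightE ltNge s0/= mul0r mule0.
  have mq' : measurable_fun setT (fun r : T => q (r / s)%R).
    by apply: (measurableT_comp mq); exact: mulrr_measurable.
  have mf' : measurable_fun setT (fun r : T => f (s ^+ 2 + r ^+ 2)%R).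
    by apply: (measurableT_comp mf); apply: measurable_funD.
  pose G (r : T) := f (s ^+ 2 + r ^+ 2)%R * q (r / s)%R *
    (chi_weight a s * chi_weight b r)%:E.
  have mG : measurable_fun setT G.
    apply: emeasurable_funM; first exact: emeasurable_funM.
    apply/measurable_EFinP; apply: measurable_funM => //.
    exact: measurable_chi_weight.
  have G0 r : 0 <= G r by rewrite !mule_ge0// lee_fin mulr_ge0 ?chi_weight_ge0.
  rewrite -/(G _) (ge0_integral_lebesgue_scale s0 mG G0) -ge0_integralZl//; last 2 first.
  - by apply: (measurableT_comp mG); exact: mulrl_measurable.
  - by rewrite lee_fin ltW.
  apply: eq_integral => t _; rewrite /G /K /F /Q/=.
  have cs : ((c t * s) ^+ 2 = s ^+ 2 + (s * t) ^+ 2)%R by rewrite exprMn cE; ring.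
  rewrite cs mulrAC mulfV ?gt_eqF// mul1r.
  rewrite [RHS]muleACA [LHS]muleCA -!EFinM; congr (_ * EFin _).
  rewrite !chi_weightE ratio_weightE (pmulr_rgt0 _ (c_gt0 t)) (pmulr_rgt0 _ s0) s0.
  case: ifPn => t0; last by rewrite !mulr0.
  rewrite -/(c t) cs.
  rewrite (_ : (- (s ^+ 2 + (s * t) ^+ 2) / 2 =
    - s ^+ 2 / 2 + - (s * t) ^+ 2 / 2)%R); last by field.
  rewrite expRD !exprMn !exprS !exprD.
  have c0 : (c t != 0)%R by rewrite gt_eqF// c_gt0.
  by field; rewrite c0 !expf_neq0.
rewrite fubini_tonelli//.
transitivity (\int[mu]_t (q t * (ratio_weight a b t)%:E * \int[mu]_r F r)).
  apply: eq_integral => t _; rewrite /K/=.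
  rewrite ge0_integralZr//; last by apply: (measurableT_comp mF); exact: mulrl_measurable.
  rewrite (ge0_integral_lebesgue_scale (c_gt0 t) mF F0).
  by rewrite /Q EFinM [LHS]muleC !muleA; congr (_ * _); rewrite muleAC.
rewrite ge0_integralZr//.
- apply: emeasurable_funM => //; apply/measurable_EFinP.
  exact: measurable_ratio_weight.
- by move=> t _; rewrite mule_ge0// lee_fin ratio_weight_ge0.
- exact: integral_ge0.
Qed.

End polar.

(** * Even binomial sums, Gaussian even moments and the Beta integral *)

Section even_moments.
Context {R : realType}.

Lemma sum_ord_double (V : zmodType) (F : nat -> V) n :
  \sum_(i < n.*2.+1) F i = \sum_(i < n.+1) F i.*2 + \sum_(i < n) F i.*2.+1.
Proof.
elim: n => [|n IH]; first by rewrite big_ord0 addr0 !big_ord_recr !big_ord0.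
rewrite doubleS 2!big_ord_recr/= IH [\sum_(i < n.+2) _]big_ord_recr/=.
by rewrite [\sum_(i < n.+1) F i.*2.+1]big_ord_recr/= -!addrA; congr (_ + _);
  rewrite addrA addrC.
Qed.

(** Adding the values at [x] and [- x] cancels the odd powers. It is used to integrate out one
    symmetric coordinate. *)
Lemma exprD_exprNl_double (x y : R) n :
  (x + y) ^+ n.*2 + (- x + y) ^+ n.*2 =
  2 * \sum_(i < n.+1) 'C(n.*2, i.*2)%:R * (x ^+ i.*2 * y ^+ (n - i).*2).
Proof.
rewrite [x + y]addrC [- x + y]addrC !exprDn -big_split/=.
rewrite (sum_ord_double (fun i => y ^+ (n.*2 - i) * x ^+ i *+ 'C(n.*2, i) +
  y ^+ (n.*2 - i) * (- x) ^+ i *+ 'C(n.*2, i))).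
rewrite [X in _ + X]big1 ?addr0 => [|i _]; last first.
  by rewrite exprNn -signr_odd/= odd_double expr1 mulN1r mulrN mulNrn subrr.
rewrite mulr_sumr; apply: eq_bigr => i _.
rewrite -doubleB exprNn -signr_odd odd_double mul1r.
by rewrite -mulr2n -[LHS]mulr_natl -[X in 2 * X = _]mulr_natl (mulrC (y ^+ _)).
Qed.

(** The quotient of factorials is [(2 n - 1)!!], the moment of order [2 n] of the standard normal
    law. *)
Lemma chi_mass_double n :
  chi_mass n.*2 = (n.*2)`!%:R / (n`!%:R * 2 ^+ n) * chi_mass 0 :> R.
Proof.
elim: n => [|n IH]; first by rewrite !fact0 expr0 mulr1 divr1 mul1r.
rewrite doubleS chi_massSS IH !factS !natrM exprS.
have h1 : n`!%:R != 0 :> R by rewrite pnatr_eq0 -lt0n fact_gt0.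
have h2 : (2 : R) ^+ n != 0 by rewrite expf_neq0.
have h3 : (n.+1%:R : R) != 0 by rewrite pnatr_eq0.
have -> : n.*2.+2%:R = 2 * n.+1%:R :> R by rewrite -doubleS -mul2n natrM.
by field; rewrite h1 h2 nat1r h3.
Qed.

Local Open Scope ereal_scope.
Local Notation mu := (@lebesgue_measure R).
Local Notation T := (measurableTypeR R).

(** A Beta integral, read off from [ge0_integral_polar] with both functions constant. *)
Lemma integral_ratio_weight a b :
  \int[mu]_t (ratio_weight a b t)%:E =
  (chi_mass a * chi_mass b / chi_mass (a + b).+1)%:E.
Proof.
have := @ge0_integral_polar R (cst 1) (cst 1) a b (measurable_cst _) (fun=> lee01)
  (measurable_cst _) (fun=> lee01).
under [X in _ = X * _]eq_integral do rewrite mul1e.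
under [X in _ = _ * X]eq_integral do rewrite mul1e.
rewrite chi_massE.
under [LHS]eq_integral.
  move=> s _; under eq_integral do rewrite mule1 mul1e EFinM.
  rewrite ge0_integralZl//; last 3 first.
  - by apply/measurable_EFinP; exact: measurable_chi_weight.
  - by move=> r _; rewrite lee_fin chi_weight_ge0.
  - by rewrite lee_fin chi_weight_ge0.
  rewrite chi_massE; over.
rewrite /= ge0_integralZr//; last 3 first.
- by apply/measurable_EFinP; exact: measurable_chi_weight.
- by move=> r _; rewrite lee_fin chi_weight_ge0.
- by rewrite lee_fin ltW ?chi_mass_gt0.
rewrite chi_massE -EFinM.
have C0 := @chi_mass_gt0 R (a + b).+1.
case: (\int[mu]_t (ratio_weight a b t)%:E) => [x| |].
- by rewrite -EFinM => -[->]; congr EFin; rewrite mulfK// gt_eqF.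
- by rewrite gt0_mulye ?lte_fin.
- by rewrite gt0_mulNye ?lte_fin.
Qed.

End even_moments.

(** * Splitting off one coordinate of a product law *)

Section independent_coordinates.
Context {R : realType}.
Local Open Scope ereal_scope.
Local Notation T := (measurableTypeR R).

Lemma ge0_integral_indep_lawS n (P : 'I_n.+1 -> probability T R)
    (f : n.+1.-tuple T -> \bar R) :
  measurable_fun setT f -> (forall x, 0 <= f x) ->
  \int[indep_law P]_x f x =
  \int[P ord0]_a \int[indep_law (fun i => P (lift ord0 i))]_y f (cons_pair (a, y)).
Proof.
move=> mf f0; rewrite /= (ge0_integral_pushforward (@measurable_cons_pair R n))//.
rewrite preimage_setT fubini_tonelli1//=.
by apply: (measurableT_comp mf); exact: measurable_cons_pair.
Qed.

Lemma integral_indep_law0 (P : 'I_0 -> probability T R) (f : 0.-tuple T -> \bar R) :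
  measurable_fun setT f -> \int[indep_law P]_x f x = f [tuple].
Proof. by move=> mf; rewrite /= integral_dirac// diracE mem_set// mul1e. Qed.

Definition dotp n (x y : n.-tuple R) : R := (\sum_(i < n) tnth x i * tnth y i)%R.

Lemma sumsq_cons n a (y : n.-tuple R) :
  sumsq (cons_pair (a, y)) = (a ^+ 2 + sumsq y)%R.
Proof.
rewrite /sumsq big_ord_recl; congr (_ + _)%R.
by apply: eq_bigr => i _; rewrite tnthS.
Qed.

Lemma dotp_cons n a b (x y : n.-tuple R) :
  dotp (cons_pair (a, x)) (cons_pair (b, y)) = (a * b + dotp x y)%R.
Proof.
rewrite /dotp big_ord_recl; congr (_ + _)%R.
by apply: eq_bigr => i _; rewrite !tnthS.
Qed.

Lemma measurable_dotp n (x : n.-tuple R) :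
  measurable_fun [set: n.-tuple T] (dotp x : n.-tuple T -> T).
Proof.
apply: measurable_sum => i; apply: measurable_funM => //.
exact: measurable_tnth.
Qed.

Lemma cons_pairP n (x : n.+1.-tuple R) : exists a y, x = cons_pair (a, y).
Proof.
case/tupleP: x => a y; exists a, y; exact: val_inj.
Qed.

End independent_coordinates.

(** * Moments of a radial function times an even power of a linear form *)

Section gaussian_moments.
Context {R : realType}.
Local Open Scope ereal_scope.
Local Notation mu := (@lebesgue_measure R).
Local Notation T := (measurableTypeR R).
Local Notation N01 := (normal_prob (0 : R) 1).

Definition std_normal n : probability (n.-tuple T) R := indep_law (fun _ : 'I_n => N01).

Lemma ge0_integral_std_normalS n (f : n.+1.-tuple T -> \bar R) :
  measurable_fun setT f -> (forall x, 0 <= f x) ->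
  \int[std_normal n.+1]_x f x =
  \int[N01]_a \int[std_normal n]_y f (cons_pair (a, y)).
Proof. exact: ge0_integral_indep_lawS. Qed.

(** For dimension [n + 1]. The value is forced by [f = 1] in [ge0_integral_moment]: [dotp eta x] is
    centered normal of variance [sumsq eta], and dividing its moment by [chi_mass (n + j.*2)]
    removes the radial mass. *)
Definition moment_coef n j : R :=
  (j.*2)`!%:R / (j`!%:R * 2 ^+ j * chi_mass (n + j.*2)).

Lemma moment_coef_ge0 n j : (0 <= moment_coef n j)%R.
Proof. by rewrite divr_ge0// !mulr_ge0 ?exprn_ge0 ?chi_mass_ge0. Qed.

Lemma sumsq_ge0 n (x : n.-tuple R) : (0 <= sumsq x)%R.
Proof. by apply: sumr_ge0 => i _; exact: sqr_ge0. Qed.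

(** The factorials [(2 i)!] and [(2 (j - i))!] cancel those in ['C(j.*2, i.*2)] and leave
    ['C(j, i)], so the sum is a binomial expansion of [(x + y) ^+ j]. *)
Lemma moment_coefS n j (x y : R) :
  (\sum_(i < j.+1) 'C(j.*2, i.*2)%:R * x ^+ i * (y ^+ (j - i) * moment_coef n (j - i)) *
     (2 * normal_peak 1) * (chi_mass i.*2 * chi_mass (n + (j - i).*2) /
       chi_mass (i.*2 + (n + (j - i).*2)).+1) =
   (x + y) ^+ j * moment_coef n.+1 j)%R.
Proof.
have p0 : (2 * normal_peak 1 != 0 :> R)%R.
  by rewrite gt_eqF// mulr_gt0// normal_peak_gt0// oner_eq0.
have C0 : (chi_mass 0 = (2 * normal_peak 1)^-1 :> R)%R.
  by rewrite /chi_mass chi_mass0.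
rewrite addrC exprDn mulr_suml; apply: eq_bigr => i _.
have ij : (i <= j)%N by rewrite -ltnS.
have -> : (i.*2 + (n + (j - i).*2)).+1 = (n.+1 + j.*2)%N.
  by rewrite addnCA -doubleD subnKC// addSn.
rewrite chi_mass_double C0 /moment_coef.
have f0 (m : nat) : (m`!%:R : R) != 0%R by rewrite pnatr_eq0 -lt0n fact_gt0.
have c0 m : (chi_mass m : R) != 0%R by rewrite gt_eqF// chi_mass_gt0.
have e2 : (2 ^+ j = 2 ^+ i * 2 ^+ (j - i) :> R)%R by rewrite -exprD subnKC.
have bj : ('C(j, i)%:R = j`!%:R / (i`!%:R * (j - i)`!%:R) :> R)%R.
  by rewrite -(bin_fact ij) !natrM mulfK// mulf_neq0.
have b2j : ('C(j.*2, i.*2)%:R = (j.*2)`!%:R / ((i.*2)`!%:R * ((j - i).*2)`!%:R) :> R)%R.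
  rewrite doubleB; have ij2 : (i.*2 <= j.*2)%N by rewrite leq_double.
  by rewrite -(bin_fact ij2) !natrM mulfK// mulf_neq0.
rewrite -[(_ *+ 'C(j, i))%R]mulr_natr bj b2j e2.
have t0 (m : nat) : (2 ^+ m != 0 :> R)%R by rewrite expf_neq0.
move: (f0 j) (f0 i) (f0 (j - i)%N) (f0 i.*2) (f0 (j - i).*2) (t0 i) (t0 (j - i)%N)
  (c0 (n + (j - i).*2)%N) (c0 (n.+1 + j.*2)%N).
move: (i`!%:R)%R ((j - i)`!%:R)%R (i.*2`!%:R)%R ((j - i).*2`!%:R)%R => a1 a2 a3 a4.
move: (2 ^+ i)%R (2 ^+ (j - i))%R (x ^+ i)%R (y ^+ (j - i))%R => b1 b2 b3 b4.
move=> h1 h2 h3 h4 h5 h6 h7 h8 h9; field.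
by rewrite h1 h2 h3 h4 h5 h6 h7 h8 h9 gt_eqF// normal_peak_gt0// oner_eq0.
Qed.

(** Induction on the dimension instead of rotation invariance: symmetrizing in the first coordinate
    kills its odd powers, then [ge0_integral_polar] merges this coordinate with the radius of the
    others. *)
Lemma ge0_integral_moment n (eta : n.+1.-tuple R) (f : T -> \bar R) j :
  measurable_fun setT f -> (forall x, 0 <= f x) ->
  \int[std_normal n.+1]_x (f (sumsq x) * (dotp eta x ^+ j.*2)%:E) =
  (sumsq eta ^+ j * moment_coef n j)%:E *
    \int[mu]_r (f (r ^+ 2)%R * (chi_weight (n + j.*2) r)%:E).
Proof.
have even_ge0 (x : R) i : (0 <= x ^+ i.*2)%R by rewrite -mul2n exprM exprn_ge0// sqr_ge0.
have mint n' (eta' : n'.-tuple R) j' (f' : T -> \bar R) : measurable_fun setT f' ->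
   measurable_fun [set: n'.-tuple T] (fun x => f' (sumsq x) * (dotp eta' x ^+ j'.*2)%:E).
  move=> mf'; apply: emeasurable_funM.
    by apply: (measurableT_comp mf'); exact: measurable_sumsq.
  by apply/measurable_EFinP; apply: measurable_funX; exact: measurable_dotp.
have mcons n' b (g : n'.+1.-tuple T -> \bar R) : measurable_fun setT g ->
    measurable_fun setT (fun y : n'.-tuple T => g (cons_pair (b, y))).
  move=> mg; apply: (measurableT_comp mg).
  by apply: (measurableT_comp (@measurable_cons_pair R n')); exact: pair1_measurable.
elim: n eta f j => [|n IH] eta f j mf f0.
  have [a [y ->]] := cons_pairP eta.
  rewrite ge0_integral_std_normalS; last 2 first.
  - exact: mint.
  - by move=> x; rewrite mule_ge0// lee_fin.
  transitivity (\int[N01]_b ((a ^+ j.*2)%:E * (f (b ^+ 2)%R * (b ^+ j.*2)%:E))).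
    apply: eq_integral => b _; rewrite integral_indep_law0; last exact: mcons (mint _ _ _ _ mf).
    rewrite sumsq_cons dotp_cons /sumsq /dotp !big_ord0 !addr0 exprMn EFinM.
    by rewrite muleCA.
  rewrite ge0_integralZl ?lee_fin//; last 2 first.
  - apply: emeasurable_funM; last by apply/measurable_EFinP; exact: measurable_funX.
    by apply: (measurableT_comp mf); exact: measurable_funX.
  - by move=> b _; rewrite mule_ge0// lee_fin.
  rewrite ge0_integral_normal_sqr// muleA -EFinM; congr (EFin _ * _).
  rewrite sumsq_cons /sumsq big_ord0 addr0 -mul2n exprM; congr (_ * _)%R.
  have C0 : (chi_mass 0 = (2 * normal_peak 1)^-1 :> R)%R by rewrite /chi_mass chi_mass0.
  have cn := lt0r_neq0 (@chi_mass_gt0 R j.*2).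
  rewrite /moment_coef add0n -[LHS]invrK -C0 -[RHS]invrK; congr (_^-1)%R.
  have e := @chi_mass_double R j.
  have h1 : (j`!%:R : R) != 0%R by rewrite pnatr_eq0 -lt0n fact_gt0.
  have h2 : ((j.*2)`!%:R : R) != 0%R by rewrite pnatr_eq0 -lt0n fact_gt0.
  have h3 : (2 ^+ j != 0 :> R)%R by rewrite expf_neq0.
  by rewrite invf_div e; field; rewrite h1 h2 h3.
have [a [eta' ->]] := cons_pairP eta.
set S := sumsq eta'.
pose I := \int[mu]_r (f (r ^+ 2)%R * (chi_weight (n.+1 + j.*2) r)%:E).
have I0 : 0 <= I by apply: integral_ge0 => r _; rewrite mule_ge0// lee_fin chi_weight_ge0.
pose m i := (n + (j - i).*2)%N.
pose Phi i (u : T) := \int[mu]_r (f (u + r ^+ 2)%R * (chi_weight (m i) r)%:E).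
have mPhi i : measurable_fun setT (Phi i).
  pose g (ur : T * T) := f (ur.1 + ur.2 ^+ 2)%R * (chi_weight (m i) ur.2)%:E.
  have mg : measurable_fun setT g.
    apply: emeasurable_funM.
      apply: (measurableT_comp mf); apply: measurable_funD => //.
      by apply: measurable_funX.
    apply/measurable_EFinP; apply: (measurableT_comp (measurable_chi_weight _)).
    exact: measurable_snd.
  have g0 ur : 0 <= g ur by rewrite mule_ge0// lee_fin chi_weight_ge0.
  exact: (@measurable_fun_fubini_tonelli_F _ _ _ _ _ mu g mg g0).
have Phi0 i u : 0 <= Phi i u.
  by apply: integral_ge0 => r _; rewrite mule_ge0// lee_fin chi_weight_ge0.
pose G (b : T) := \int[std_normal n.+1]_y
  (f (b ^+ 2 + sumsq y)%R * ((a * b + dotp eta' y) ^+ j.*2)%:E).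
have mGint : measurable_fun setT (fun by_ : T * n.+1.-tuple T =>
    f (by_.1 ^+ 2 + sumsq by_.2)%R * ((a * by_.1 + dotp eta' by_.2) ^+ j.*2)%:E).
  apply: emeasurable_funM.
    apply: (measurableT_comp mf); apply: measurable_funD.
      by apply: measurable_funX.
    by apply: (measurableT_comp (@measurable_sumsq R n.+1)); exact: measurable_snd.
  apply/measurable_EFinP; apply: measurable_funX; apply: measurable_funD.
    by apply: measurable_funM => //.
  by apply: (measurableT_comp (measurable_dotp eta')); exact: measurable_snd.
have Gint0 by_ : 0 <= f (by_.1 ^+ 2 + sumsq by_.2)%R *
     ((a * by_.1 + dotp eta' by_.2) ^+ j.*2)%:E :> \bar R.
  by rewrite mule_ge0// lee_fin.
have mG : measurable_fun setT G.
  exact: (@measurable_fun_fubini_tonelli_F _ _ _ _ _ (std_normal n.+1) _ mGint Gint0).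
have G0 b : 0 <= G b by apply: integral_ge0 => y _; exact: (Gint0 (b, y)).
have -> : \int[std_normal n.+2]_x (f (sumsq x) *
    (dotp (cons_pair (a, eta')) x ^+ j.*2)%:E) = \int[N01]_b G b.
  rewrite ge0_integral_std_normalS; last 2 first.
  - exact: mint.
  - by move=> x; rewrite mule_ge0// lee_fin.
  apply: eq_integral => b _; apply: eq_integral => y _.
  by rewrite sumsq_cons dotp_cons.
pose c i : R := ('C(j.*2, i.*2)%:R * (a ^+ 2) ^+ i * (S ^+ (j - i) * moment_coef n (j - i)))%R.
have c0 i : (0 <= c i)%R.
  apply: mulr_ge0; apply: mulr_ge0; rewrite ?moment_coef_ge0//.
    by rewrite exprn_ge0// sqr_ge0.
  by rewrite exprn_ge0// sumsq_ge0.
have GE b : G b + G (- b)%R =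
    2%:E * \sum_(i < j.+1) ((c i)%:E * (Phi i (b ^+ 2)%R * (b ^+ i.*2)%:E)).
  have mfb : measurable_fun setT (fun u : T => f (b ^+ 2 + u)%R).
    by apply: (measurableT_comp mf); exact: measurable_funD.
  pose h i y := f (b ^+ 2 + sumsq y)%R * (dotp eta' y ^+ (j - i).*2)%:E.
  have h0 i y : 0 <= h i y by rewrite mule_ge0// lee_fin.
  have mh i : measurable_fun setT (h i) := mint _ eta' (j - i)%N _ mfb.
  pose d i := (2 * ('C(j.*2, i.*2)%:R * (a * b) ^+ i.*2))%R.
  have d0 i : (0 <= d i)%R by rewrite !mulr_ge0.
  transitivity (\int[std_normal n.+1]_y \sum_(i < j.+1) ((d i)%:E * h i y)).
    have mGb b' : measurable_fun setT (fun y : n.+1.-tuple T =>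
        f (b' ^+ 2 + sumsq y)%R * ((a * b' + dotp eta' y) ^+ j.*2)%:E).
      exact: (measurableT_comp mGint (pair1_measurable (b' : T))).
    rewrite /G -ge0_integralD//; last 2 first.
    - by move=> y _; exact: (Gint0 (b, y)).
    - by move=> y _; exact: (Gint0 ((- b)%R, y)).
    apply: eq_integral => y _; rewrite sqrrN -ge0_muleDr ?lee_fin//.
    rewrite -EFinD mulrN exprD_exprNl_double mulr_sumr -sumEFin ge0_sume_distrr; last first.
      by move=> i _; rewrite lee_fin !mulr_ge0.
    apply: eq_bigr => i _; rewrite /h muleCA -EFinM; congr (_ * EFin _).
    by rewrite /d; ring.
  rewrite ge0_integral_sum//; last 2 first.
  - by move=> i; apply: measurable_funeM; exact: mh.
  - by move=> i y _; rewrite mule_ge0// lee_fin.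
  rewrite ge0_sume_distrr; last first.
    by move=> i _; rewrite !mule_ge0// lee_fin.
  apply: eq_bigr => i _; rewrite ge0_integralZl//; [|exact: mh|by rewrite lee_fin].
  rewrite (IH eta' _ (j - i)%N mfb)// -/(Phi i (b ^+ 2)%R).
  rewrite (muleC (Phi _ _)) !muleA -!EFinM; congr (EFin _ * _).
  by rewrite /d /c -/S -exprM mul2n exprMn; ring.
have two : 2%:E * \int[N01]_b G b =
  2%:E * \sum_(i < j.+1) ((c i)%:E * \int[N01]_b (Phi i (b ^+ 2)%R * (b ^+ i.*2)%:E)).
  have mterm : forall l, measurable_fun setT (fun b : T => Phi l (b ^+ 2)%R * (b ^+ l.*2)%:E).
    move=> l.
    apply: emeasurable_funM.
      by apply: (measurableT_comp (mPhi l)); exact: measurable_funX.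
    by apply/measurable_EFinP; exact: measurable_funX.
  have term0 : forall l b, 0 <= Phi l (b ^+ 2)%R * (b ^+ l.*2)%:E.
    by move=> l b; rewrite mule_ge0// lee_fin.
  transitivity (\int[N01]_b (G b + G (- b)%R)).
    have mGo : measurable_fun setT (fun b : T => G (- b)%R).
      by apply: (measurableT_comp mG); exact: oppr_measurable.
    rewrite [RHS]ge0_integralD// -(ge0_integral_normal_opp mG G0).
    rewrite [in LHS](_ : 2%:E = 1 + 1)// ge0_muleDl ?mul1e ?lee_fin//.
  under eq_integral do rewrite GE.
  rewrite ge0_integralZl ?lee_fin//; last 2 first.
  - by apply: emeasurable_sum => i; exact: measurable_funeM.
  - by move=> b _; apply: sume_ge0 => i _; rewrite mule_ge0 ?lee_fin.
  rewrite ge0_integral_sum//; last 2 first.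
  - by move=> i; exact: measurable_funeM.
  - by move=> i y _; rewrite mule_ge0// lee_fin.
  by congr (_ * _); apply: eq_bigr => i _; rewrite ge0_integralZl ?lee_fin.
have -> : \int[N01]_b G b =
  \sum_(i < j.+1) ((c i)%:E * \int[N01]_b (Phi i (b ^+ 2)%R * (b ^+ i.*2)%:E)).
  (* The factor [2] is removed by multiplying by its inverse, which is valid even if the integrals
     are infinite. *)
  move: two; set x := integral _ _ _; set y := (\sum_(i < j.+1) _) => two.
  rewrite -[x]mul1e -[y]mul1e (_ : 1 = 2^-1%:E * 2%:E :> \bar R); last first.
    by rewrite -EFinM mulVf.
  by rewrite -!muleA two.
transitivity (\sum_(i < j.+1) ((c i * (2 * normal_peak 1) *
   (chi_mass i.*2 * chi_mass (m i) / chi_mass (i.*2 + m i).+1))%:E * I)).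
  apply: eq_bigr => i _; have ij : (i <= j)%N by rewrite -ltnS.
  rewrite ge0_integral_normal_sqr//.
  rewrite muleA -EFinM [in RHS]EFinM -[RHS]muleA; congr (_ * _).
  have mi : (i.*2 + m i).+1 = (n.+1 + j.*2)%N by rewrite /m addnCA -doubleD subnKC// addSn.
  have := @ge0_integral_polar R f (cst 1) i.*2 (m i) mf f0 (measurable_cst _) (fun=> lee01).
  under [X in _ = X * _]eq_integral do rewrite mul1e.
  rewrite integral_ratio_weight mi -/I. move=> <-.
  apply: eq_integral => s _; rewrite /Phi -ge0_integralZr//; last 3 first.
  - apply: emeasurable_funM; last by apply/measurable_EFinP; exact: measurable_chi_weight.
    apply: (measurableT_comp mf); apply: measurable_funD => //.
  - by move=> r _; rewrite mule_ge0// lee_fin chi_weight_ge0.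
  - by rewrite lee_fin chi_weight_ge0.
  by apply: eq_integral => r _; rewrite mule1 -muleA -EFinM (mulrC (chi_weight (m i) r)).
rewrite -ge0_sume_distrl; last first.
  move=> i _; rewrite lee_fin; apply: mulr_ge0.
    by apply: mulr_ge0 => //; rewrite mulr_ge0// normal_peak_ge0.
  by rewrite divr_ge0 ?mulr_ge0 ?chi_mass_ge0.
by rewrite sumEFin (moment_coefS n j (a ^+ 2) S) sumsq_cons.
Qed.

End gaussian_moments.

(** * Mixed moments of [q(T)], [|x| ^ 2] and [eta . x] *)

Section ratio_moments.
Context {R : realType}.
Local Open Scope ereal_scope.
Local Notation mu := (@lebesgue_measure R).
Local Notation T := (measurableTypeR R).

(* Law of [(X, S ^ 2)] for [theta = 0] and [sigma = 1]. *)
Definition std_law p k : probability (p.-tuple T * T)%type R :=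
  (std_normal p \x chi2 k)%E.

Definition sqratio p (xs : p.-tuple T * T) : T := (sumsq xs.1 / xs.2)%R.

(** The case [j = 0] of [ge0_integral_moment]; [moment_coef k 0] is the normalization
    [1 / chi_mass k]. *)
Lemma ge0_integral_chi2 k (f : T -> \bar R) :
  measurable_fun setT f -> (forall x, 0 <= f x) ->
  \int[chi2 k.+1]_s f s =
  (moment_coef k 0)%:E * \int[mu]_s (f (s ^+ 2)%R * (chi_weight k s)%:E).
Proof.
move=> mf f0.
rewrite /chi2 (ge0_integral_pushforward (@measurable_sumsq R k.+1))//.
rewrite preimage_setT.
have := @ge0_integral_moment R k [tuple 0%R | i < k.+1] f 0 mf f0.
rewrite expr0 mul1r addn0 => <-.
by apply: eq_integral => x _; rewrite expr0 mule1.
Qed.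

Lemma measurable_sqratio p : measurable_fun [set: p.-tuple T * T] (@sqratio p).
Proof.
apply: measurable_funM.
  by apply: (measurableT_comp (@measurable_sumsq R p)); exact: measurable_fst.
by apply: (measurableT_comp measurable_invr); exact: measurable_snd.
Qed.

Lemma chi_weight_exp n i (r : R) :
  ((r ^+ 2) ^+ i * chi_weight n r)%R = chi_weight (n + i.*2) r.
Proof.
rewrite !chi_weightE; case: ifPn => _; last by rewrite mulr0.
by rewrite mulrA -exprM mul2n -exprD addnC.
Qed.

(** With [r = |x|] and [S = s], the ratio [T = (r / s) ^+ 2] is an angular variable: polar
    coordinates in [(s, r)] separate it from the total radius, which contributes only a
    [chi_mass]. *)
Lemma ge0_integral_ratio_moment p k (eta : p.+1.-tuple R) (q : T -> \bar R) i j :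
  measurable_fun setT q -> (forall x, 0 <= q x) ->
  \int[std_law p.+1 k.+1]_xs
    (q (sqratio xs) * (sumsq xs.1 ^+ i * dotp eta xs.1 ^+ j.*2)%:E) =
  (sumsq eta ^+ j * moment_coef p j * moment_coef k 0 *
    chi_mass (k + (p + j.*2 + i.*2)).+1)%:E *
  \int[mu]_t (q (t ^+ 2)%R * (ratio_weight k (p + j.*2 + i.*2) t)%:E).
Proof.
move=> mq q0.
have even_ge0 (x : R) l : (0 <= x ^+ l.*2)%R by rewrite -mul2n exprM exprn_ge0// sqr_ge0.
have mQ : measurable_fun setT (fun xs : p.+1.-tuple T * T =>
    q (sqratio xs) * (sumsq xs.1 ^+ i * dotp eta xs.1 ^+ j.*2)%:E).
  apply: emeasurable_funM.
    by apply: (measurableT_comp mq); exact: measurable_sqratio.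
  apply/measurable_EFinP; apply: measurable_funM; apply: measurable_funX.
    by apply: (measurableT_comp (@measurable_sumsq R p.+1)); exact: measurable_fst.
  by apply: (measurableT_comp (measurable_dotp eta)); exact: measurable_fst.
have Q0 xs : 0 <= q (sqratio xs) * (sumsq xs.1 ^+ i * dotp eta xs.1 ^+ j.*2)%:E.
  by rewrite mule_ge0// lee_fin mulr_ge0// exprn_ge0// sumsq_ge0.
rewrite /std_law fubini_tonelli2//.
pose g (s r : T) := q (r ^+ 2 / s)%R * (chi_weight (p + j.*2 + i.*2) r)%:E.
have mqs s : measurable_fun setT (fun u : T => q (u / s)%R).
  by apply: (measurableT_comp mq); exact: mulrr_measurable.
have mg : measurable_fun setT (fun sr : T * T => g sr.1 sr.2).
  apply: emeasurable_funM.
    apply: (measurableT_comp mq); apply: measurable_funM.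
      by apply: measurable_funX; exact: measurable_snd.
    by apply: (measurableT_comp measurable_invr); exact: measurable_fst.
  apply/measurable_EFinP; apply: (measurableT_comp (measurable_chi_weight _)).
  exact: measurable_snd.
have g0 s r : 0 <= g s r by rewrite mule_ge0// lee_fin chi_weight_ge0.
pose G (s : T) := \int[mu]_r g s r.
have mG : measurable_fun setT G.
  exact: (@measurable_fun_fubini_tonelli_F _ _ _ _ _ mu _ mg (fun sr => g0 sr.1 sr.2)).
have G0 s : 0 <= G s by exact: integral_ge0.
transitivity (\int[chi2 k.+1]_s ((sumsq eta ^+ j * moment_coef p j)%:E * G s)).
  apply: eq_integral => s _; rewrite /fubini_G/=.
  (* [ge0_integral_moment] asks for a function nonnegative on the whole line; truncating [u] at [0]
     changes nothing at [u = sumsq x]. *)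
  have mqi : measurable_fun setT (fun u : T => q (u / s)%R * (Num.max u 0 ^+ i)%:E).
    apply: emeasurable_funM => //; apply/measurable_EFinP; apply: measurable_funX.
    exact: (measurable_maxr (f := id) (g := cst 0%R)).
  have qi0 u : 0 <= q (u / s)%R * (Num.max u 0 ^+ i)%:E.
    by rewrite mule_ge0// lee_fin exprn_ge0// le_max lexx orbT.
  have := ge0_integral_moment eta j mqi qi0.
  rewrite (_ : integral mu setT _ = G s); last first.
    apply: eq_integral => r _; rewrite max_l ?sqr_ge0// -muleA -EFinM.
    by rewrite chi_weight_exp.
  move=> <-; apply: eq_integral => x _.
  by rewrite max_l ?sumsq_ge0// EFinM muleA.
have c0 : (0 <= sumsq eta ^+ j * moment_coef p j)%R.
  by rewrite mulr_ge0 ?moment_coef_ge0// exprn_ge0// sumsq_ge0.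
rewrite ge0_integralZl ?lee_fin// ge0_integral_chi2// muleA -EFinM [in RHS]EFinM -muleA.
congr (_ * _).
have mq2 : measurable_fun setT (fun t : T => q (t ^+ 2)%R).
  by apply: (measurableT_comp mq); exact: measurable_funX.
have := @ge0_integral_polar R (cst 1) (fun t => q (t ^+ 2)%R) k (p + j.*2 + i.*2)
  (measurable_cst _) (fun=> lee01) mq2 (fun=> q0 _).
under [X in _ = _ * X]eq_integral do rewrite mul1e.
rewrite chi_massE muleC => <-.
apply: eq_integral => s _; rewrite /G -ge0_integralZr//; last 2 first.
- exact: (measurableT_comp mg (pair1_measurable ((s ^+ 2)%R : T))).
- by rewrite lee_fin chi_weight_ge0.
apply: eq_integral => r _; rewrite /g mul1e exprMn exprVn -muleA -EFinM.
by rewrite (mulrC (chi_weight k s)).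
Qed.

End ratio_moments.

(** * Power series of [cosh v] and [v sinh v] *)

Section hyperbolic_series.
Context {R : realType}.
Implicit Types v : R.

Definition coshR v : R := (expR v + expR (- v)) / 2.

(** The product [v sinh v] is kept whole because, unlike [sinh v], it is nonnegative for every [v]
    and expands in even powers with nonnegative coefficients. *)
Definition vsinhR v : R := v * (expR v - expR (- v)) / 2.

Lemma eq_cvgn (u w : nat -> R) (l : R) : u =1 w -> u @ \oo --> l -> w @ \oo --> l.
Proof. by move=> /funext ->. Qed.

Lemma cvg_double_succ : n.*2.+1 @[n --> \oo] --> \oo.
Proof.
move=> A [N _ NA]; exists N => // n /= Nn; apply: NA => /=.
by rewrite (leq_trans Nn)// -addnn -addSn leq_addl.
Qed.

Let sums_exp v : series (exp_coeff v) @ \oo --> expR v.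
Proof. exact: is_cvg_series_exp_coeff. Qed.

Let exp_coeffN v n : exp_coeff (- v) n = (-1) ^+ n * exp_coeff v n.
Proof. by rewrite /exp_coeff/= [(- v) ^+ n]exprNn mulrA. Qed.

Lemma sums_coshR v : series (fun j => (j.*2)`!%:R^-1 * v ^+ j.*2) @ \oo --> coshR v.
Proof.
rewrite -cvg_shiftS.
have h : (series (exp_coeff v) n + series (exp_coeff (- v)) n) / 2 @[n --> \oo] --> coshR v.
  by apply: cvgM; [apply: cvgD; exact: sums_exp|exact: cvg_cst].
apply: eq_cvgn (cvg_comp _ _ cvg_double_succ h) => n /=.
rewrite /series/= !big_mkord -big_split/=.
rewrite (sum_ord_double (fun i => exp_coeff v i + exp_coeff (- v) i)).
rewrite [X in _ + X]big1 ?addr0 => [|i _]; last first.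
  by rewrite exp_coeffN -signr_odd/= odd_double expr1 mulN1r subrr.
rewrite mulr_suml; apply: eq_bigr => i _.
by rewrite exp_coeffN -signr_odd odd_double mul1r /exp_coeff/=; field;
  rewrite pnatr_eq0 -lt0n fact_gt0.
Qed.

Lemma sums_vsinhR v :
  series (fun j => (j.*2.+1)`!%:R^-1 * v ^+ (j + 1).*2) @ \oo --> vsinhR v.
Proof.
have h : v * (series (exp_coeff v) n - series (exp_coeff (- v)) n) / 2 @[n --> \oo] --> vsinhR v.
  apply: cvgM; last exact: cvg_cst.
  by apply: cvgM; [exact: cvg_cst|apply: cvgB; exact: sums_exp].
apply: eq_cvgn (cvg_comp _ _ cvg_double_succ h) => n /=.
rewrite /series/= !big_mkord -sumrB.
rewrite (sum_ord_double (fun i => exp_coeff v i - exp_coeff (- v) i)).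
rewrite [X in X + _]big1 ?add0r => [|i _]; last first.
  by rewrite exp_coeffN -signr_odd odd_double mul1r subrr.
rewrite mulr_sumr mulr_suml; apply: eq_bigr => i _.
rewrite exp_coeffN -signr_odd/= odd_double expr1 mulN1r opprK /exp_coeff/= addn1 doubleS.
by rewrite [v ^+ _.+2]exprS; field; rewrite pnatr_eq0 -lt0n fact_gt0.
Qed.

Lemma nneseries_sums (u : nat -> R) (l : R) :
  series u @ \oo --> l -> (\sum_(j <oo) (u j)%:E = l%:E)%E.
Proof.
move=> ul; rewrite -(cvg_lim _ ul)// -EFin_lim; last exact: cvgP ul.
by congr (limn _); apply/funext => n; rewrite /= /series/= sumEFin.
Qed.

Lemma coshR_ge0 v : 0 <= coshR v.
Proof. by rewrite divr_ge0// addr_ge0// expR_ge0. Qed.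

Lemma vsinhR_ge0 v : 0 <= vsinhR v.
Proof.
rewrite /vsinhR divr_ge0//; have [v0|v0] := leP 0 v.
  by rewrite mulr_ge0// subr_ge0 ler_expR; lra.
by rewrite mulr_le0 ?(ltW v0)// subr_le0 ler_expR; lra.
Qed.

(** Iterating [chi_massSS] multiplies by [n + 1], [n + 3], and so on: twice the factors of a
    Pochhammer symbol. The parameters of the hypergeometric functions arise here. *)
Lemma chi_mass_pochhammer n j :
  chi_mass (n + j.*2) = chi_mass n * (2 ^+ j * pochhammer (n.+1%:R / 2) j) :> R.
Proof.
elim: j => [|j IH]; first by rewrite addn0 pochhammer0 expr0 !mulr1.
rewrite doubleS !addnS chi_massSS IH pochhammerS exprS.
rewrite -addSn natrD -mul2n natrM.
by field.
Qed.

End hyperbolic_series.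

(** * Termwise integration of the hyperbolic series *)

Section ratio_series.
Context {R : realType} (p k : nat) (eta : p.+1.-tuple R).
Local Open Scope ereal_scope.
Local Notation mu := (@lebesgue_measure R).
Local Notation T := (measurableTypeR R).

(** Nonnegative terms allow exchanging sum and integral on both sides. The pair [(i, d)] is [(1, 0)]
    for [|x| ^ 2 cosh v] and [(0, 1)] for [v sinh v]; since [i + d = 1] in both, the same ratio
    weights appear. *)
Lemma ge0_integral_ratio_series (q : T -> R) (c : nat -> R) (i d : nat)
    (A B : R -> R) :
  measurable_fun setT q -> (forall x, 0 <= q x)%R -> (forall j, 0 <= c j)%R ->
  (forall v, series (fun j => c j * v ^+ (j + d).*2)%R @ \oo --> A v) ->
  (forall t, series (fun j => c j * (sumsq eta ^+ (j + d) * moment_coef p (j + d) *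
     moment_coef k 0 * chi_mass (k + (p + (j + d).*2 + i.*2)).+1) *
     ratio_weight k (p + (j + d).*2 + i.*2) t)%R @ \oo --> B t) ->
  \int[std_law p.+1 k.+1]_xs
     (q (sqratio xs) * (sumsq xs.1 ^+ i * A (dotp eta xs.1)))%:E =
  \int[mu]_t (q (t ^+ 2) * B t)%:E.
Proof.
move=> mq q0 c0 hA hB.
have even_ge0 (x : R) l : (0 <= x ^+ l.*2)%R by rewrite -mul2n exprM exprn_ge0// sqr_ge0.
pose m j := (p + (j + d).*2 + i.*2)%N.
pose C j := (sumsq eta ^+ (j + d) * moment_coef p (j + d) * moment_coef k 0 *
   chi_mass (k + m j).+1)%R.
have C0 j : (0 <= C j)%R.
  apply: mulr_ge0; last exact: chi_mass_ge0.
  apply: mulr_ge0; last exact: moment_coef_ge0.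
  by rewrite mulr_ge0 ?moment_coef_ge0// exprn_ge0// sumsq_ge0.
have mqe : measurable_fun setT (fun x : T => (q x)%:E) by exact/measurable_EFinP.
pose F j (xs : p.+1.-tuple T * T) :=
  (q (sqratio xs))%:E * (sumsq xs.1 ^+ i * dotp eta xs.1 ^+ (j + d).*2)%:E.
have mF j : measurable_fun setT (F j).
  apply: emeasurable_funM.
    by apply: (measurableT_comp mqe); exact: measurable_sqratio.
  apply/measurable_EFinP; apply: measurable_funM; apply: measurable_funX.
    by apply: (measurableT_comp (@measurable_sumsq R p.+1)); exact: measurable_fst.
  by apply: (measurableT_comp (measurable_dotp eta)); exact: measurable_fst.
have F0 j xs : 0 <= F j xs.
  by rewrite mule_ge0// lee_fin// mulr_ge0// exprn_ge0// sumsq_ge0.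
transitivity (\int[std_law p.+1 k.+1]_xs \sum_(j <oo) ((c j)%:E * F j xs)).
  apply: eq_integral => xs _.
  apply/esym; under eq_eseriesr do rewrite /F -!EFinM.
  apply: nneseries_sums.
  have := @sumsZ R (q (sqratio xs) * sumsq xs.1 ^+ i)%R _ _ (hA (dotp eta xs.1)).
  rewrite -mulrA; apply: eq_sums => j; ring.
rewrite integral_nneseries//; last 2 first.
- by move=> j; exact: measurable_funeM.
- by move=> j xs _; rewrite mule_ge0// lee_fin.
have mw j : measurable_fun setT (fun t : T => (q (t ^+ 2))%:E * (ratio_weight k (m j) t)%:E).
  apply: emeasurable_funM.
    by apply: (measurableT_comp mqe); exact: measurable_funX.
  by apply/measurable_EFinP; exact: measurable_ratio_weight.
have w0 j t : 0 <= (q (t ^+ 2))%:E * (ratio_weight k (m j) t)%:E.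
  by rewrite mule_ge0// lee_fin// ratio_weight_ge0.
transitivity (\sum_(j <oo) \int[mu]_t ((c j * C j)%:E *
    ((q (t ^+ 2)%R)%:E * (ratio_weight k (m j) t)%:E))).
  apply: eq_eseriesr => j _; rewrite ge0_integralZl ?lee_fin//.
  rewrite (ge0_integral_ratio_moment k eta i (j + d) mqe) => [|x]; last by rewrite lee_fin.
  rewrite [RHS]ge0_integralZl//; last by rewrite lee_fin mulr_ge0.
  by rewrite muleA -EFinM.
rewrite -integral_nneseries//; last 2 first.
- by move=> j; exact: measurable_funeM.
- by move=> j t _; rewrite mule_ge0// lee_fin mulr_ge0.
apply: eq_integral => t _; under eq_eseriesr do rewrite -!EFinM.
apply: nneseries_sums.
have := @sumsZ R (q (t ^+ 2)%R) _ _ (hB t).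
apply: eq_sums => j; rewrite -/(m j) -/(C j); ring.
Qed.

End ratio_series.

(** * Summation into hypergeometric functions *)

Section hypergeometric_integrals.
Context {R : realType} (p k : nat) (eta : p.+1.-tuple R).
Local Notation mu := (@lebesgue_measure R).
Local Notation T := (measurableTypeR R).
Local Notation a := ((k.+1%:R + p.+1%:R - 0) / 2 + 1 : R).
Local Notation b := (p.+1%:R / 2 : R).
Local Notation z t := (sumsq eta * t ^+ 2 / (2 * (1 + t ^+ 2)) : R).

(** The constant of the term [j = 0] in the [cosh] series; factoring it out of both integrals leaves
    only hypergeometric functions. *)
Definition ratio_coef : R := moment_coef k 0 * chi_mass (k + p).+3 / chi_mass p.

Lemma ratio_coef_gt0 : 0 < ratio_coef.
Proof.
apply: divr_gt0; last exact: chi_mass_gt0.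
apply: mulr_gt0; last exact: chi_mass_gt0.
apply: divr_gt0; first by rewrite ltr0n fact_gt0.
by apply: mulr_gt0; [rewrite expr0 mulr1 ltr0n|exact: chi_mass_gt0].
Qed.

Let a_gt0 : 0 < a.
Proof. by rewrite subr0 addr_gt0. Qed.

Let b_gt0 : 0 < b. Proof. by rewrite divr_gt0. Qed.

Let fact_neq0 (m : nat) : (m`!%:R : R) != 0.
Proof. by rewrite pnatr_eq0 -lt0n fact_gt0. Qed.

(** Each step in [j] contributes [t ^+ 2 / (1 + t ^+ 2)], which with [sumsq eta / 2] forms the
    argument of [hBU] at [T = t ^+ 2]. *)
Let ratio_weight_shift j (t : R) : ratio_weight k (p.+2 + j.*2) t =
  ratio_weight k p.+2 t * (t ^+ 2 / (1 + t ^+ 2)) ^+ j.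
Proof.
rewrite !ratio_weightE; case: ifPn => t0; last by rewrite mul0r.
have c0 : 0 < Num.sqrt (1 + t ^+ 2) by rewrite sqrtr_gt0 ltr_pwDl ?ltr01 ?sqr_ge0.
have cE : Num.sqrt (1 + t ^+ 2) ^+ 2 = 1 + t ^+ 2 by rewrite sqr_sqrtr// addr_ge0 ?sqr_ge0.
set c := Num.sqrt _ in c0 cE *; rewrite -cE.
rewrite (_ : (k + (p.+2 + j.*2)).+2 = (k + p.+2).+2 + j.*2)%N; last by rewrite addnA.
rewrite expr_div_n -!exprM mul2n !(exprD _ _ j.*2).
by field; rewrite !expf_neq0// gt_eqF.
Qed.

(** The total radius carries the exponent [k + p + 3], and [(k + p + 4) / 2] is the first parameter
    of [hBU] for [l = 0] in dimensions [p + 1] and [k + 1]. This singles out [l = 0]. *)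
Let pochhammer_a j : chi_mass ((k + p).+3 + j.*2) =
  chi_mass (k + p).+3 * (2 ^+ j * pochhammer a j) :> R.
Proof.
rewrite chi_mass_pochhammer; congr (_ * (_ * pochhammer _ _)).
by rewrite -!natr1 natrD; field.
Qed.

Let pochhammer_b1 j : chi_mass (p.+2 + j.*2) =
  p.+1%:R * chi_mass p * (2 ^+ j * pochhammer (b + 1) j) :> R.
Proof.
rewrite chi_mass_pochhammer chi_massSS; congr (_ * (_ * pochhammer _ _)).
by rewrite -!natr1; field.
Qed.

Lemma ge0_integral_coshR (q : T -> R) :
  measurable_fun setT q -> (forall x, 0 <= q x) ->
  (\int[std_law p.+1 k.+1]_xs
     (q (sqratio xs) * (sumsq xs.1 * coshR (dotp eta xs.1)))%:E =
   \int[mu]_t (q (t ^+ 2) * (ratio_coef * ratio_weight k p.+2 t * hyp1F1 a b (z t)))%:E)%E.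
Proof.
move=> mq q0.
have := @ge0_integral_ratio_series R p k eta q (fun j => (j.*2)`!%:R^-1) 1 0 coshR
  (fun t => ratio_coef * ratio_weight k p.+2 t * hyp1F1 a b (z t)) mq q0.
under eq_integral do rewrite expr1; apply.
- by move=> j; rewrite invr_ge0.
- by move=> v; apply: eq_sums (@sums_coshR R v) => j; rewrite addn0.
move=> t; have := @sumsZ R (ratio_coef * ratio_weight k p.+2 t) _ _
  (@sums_hyp R a b (z t) a_gt0 b_gt0).
apply: eq_sums => j; rewrite addn0 /=.
rewrite (_ : p + j.*2 + 2 = p.+2 + j.*2)%N; last by rewrite addnC addnA.
rewrite ratio_weight_shift.
rewrite (_ : (k + (p.+2 + j.*2)).+1 = (k + p).+3 + j.*2)%N; last first.
  by rewrite addnA !addnS !addSn.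
rewrite pochhammer_a /ratio_coef {2}/moment_coef chi_mass_pochhammer /hyp_term.
rewrite (_ : z t = sumsq eta * (t ^+ 2 / (1 + t ^+ 2)) / 2); last first.
  by rewrite invfM; ring.
move: (t ^+ 2 / (1 + t ^+ 2)) => r; rewrite !exprMn exprVn.
have h1 := lt0r_neq0 (@pochhammer_gt0 R b j b_gt0).
have h2 := lt0r_neq0 (@chi_mass_gt0 R p).
have h3 : (2 : R) ^+ j != 0 by rewrite expf_neq0.
have := fact_neq0 j; have := fact_neq0 j.*2.
move: (pochhammer a j) (pochhammer b j) (chi_mass p : R) (2 ^+ j : R) (j`!%:R : R)
  (j.*2`!%:R : R) h1 h2 h3 => x1 x2 x3 x4 x5 x6 h1 h2 h3 h4 h5.
by field; rewrite h1 h2 h3 h4 h5.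
Qed.

(** Compared with [cosh], the power of [v] is shifted by two: the mass [chi_mass p.+2] replaces
    [chi_mass p], which raises the second parameter to [b + 1] and yields the factor
    [sumsq eta / p.+1]. *)
Lemma ge0_integral_vsinhR (q : T -> R) :
  measurable_fun setT q -> (forall x, 0 <= q x) ->
  (\int[std_law p.+1 k.+1]_xs (q (sqratio xs) * vsinhR (dotp eta xs.1))%:E =
   \int[mu]_t (q (t ^+ 2) * (ratio_coef * ratio_weight k p.+2 t *
     (sumsq eta / p.+1%:R * hyp1F1 a (b + 1) (z t))))%:E)%E.
Proof.
move=> mq q0.
have := @ge0_integral_ratio_series R p k eta q (fun j => (j.*2.+1)`!%:R^-1) 0 1 vsinhR
  (fun t => ratio_coef * ratio_weight k p.+2 t *
     (sumsq eta / p.+1%:R * hyp1F1 a (b + 1) (z t))) mq q0.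
under eq_integral do rewrite expr0 mul1r; apply.
- by move=> j; rewrite invr_ge0.
- by move=> v; exact: sums_vsinhR.
have b1 : 0 < b + 1 by rewrite addr_gt0.
move=> t; have := @sumsZ R (ratio_coef * ratio_weight k p.+2 t * (sumsq eta / p.+1%:R)) _ _
  (@sums_hyp R a (b + 1) (z t) a_gt0 b1).
rewrite -[X in _ --> X]mulrA; apply: eq_sums => j; rewrite addn1 doubleS addn0 /=.
rewrite (_ : p + j.*2.+2 = p.+2 + j.*2)%N; last by rewrite !addnS !addSn.
rewrite ratio_weight_shift.
rewrite (_ : (k + (p.+2 + j.*2)).+1 = (k + p).+3 + j.*2)%N; last first.
  by rewrite addnA !addnS !addSn.
rewrite pochhammer_a /ratio_coef {2}/moment_coef.
rewrite (_ : p + j.+1.*2 = p.+2 + j.*2)%N; last by rewrite doubleS !addnS !addSn.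
rewrite pochhammer_b1 /hyp_term.
rewrite (_ : z t = sumsq eta * (t ^+ 2 / (1 + t ^+ 2)) / 2); last first.
  by rewrite invfM; ring.
move: (t ^+ 2 / (1 + t ^+ 2)) => r; rewrite !exprMn exprVn doubleS !factS !natrM !exprS.
have h1 := lt0r_neq0 (@pochhammer_gt0 R (b + 1) j b1).
have h2 := lt0r_neq0 (@chi_mass_gt0 R p).
have h3 : (2 : R) ^+ j != 0 by rewrite expf_neq0.
have h4 : p.+1%:R != 0 :> R by rewrite pnatr_eq0.
have h5 : j.+1%:R != 0 :> R by rewrite pnatr_eq0.
have h6 : j.*2.+1%:R != 0 :> R by rewrite pnatr_eq0.
have -> : j.*2.+2%:R = 2 * j.+1%:R :> R by rewrite -doubleS -mul2n natrM.
have := fact_neq0 j; have := fact_neq0 j.*2.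
move: (pochhammer a j) (pochhammer (b + 1) j) (chi_mass p : R) (2 ^+ j : R) (j`!%:R : R)
  (j.*2`!%:R : R) (p.+1%:R : R) (j.+1%:R : R) (j.*2.+1%:R : R) h1 h2 h3 h4 h5 h6.
move=> x1 x2 x3 x4 x5 x6 x7 x8 x9 h1 h2 h3 h4 h5 h6 h7 h8.
by field; rewrite h1 h2 h3 h4 h5 h6 h7 h8.
Qed.

End hypergeometric_integrals.

(** * The risk as an integral against the standard law *)

Section risk.
Context {R : realType}.
Local Notation T := (measurableTypeR R).
Local Notation N01 := (normal_prob (0 : R) 1).

Lemma scale_tuple_cons n (c a : R) (y : n.-tuple R) :
  scale_tuple c (cons_pair (a, y)) = cons_pair (c * a, scale_tuple c y).
Proof.
apply: eq_from_tnth => i; rewrite tnth_mktuple.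
by case: (unliftP ord0 i) => [j ->|->] //=; rewrite !tnthS tnth_mktuple.
Qed.

Lemma measurable_scale_tuple n (c : R) :
  measurable_fun [set: n.-tuple T] (scale_tuple c : n.-tuple T -> n.-tuple T).
Proof.
apply/measurable_fun_tnthP => i.
rewrite (_ : _ \o _ = fun x => c * tnth x i); last first.
  by apply/funext => x /=; rewrite tnth_mktuple.
by apply: measurable_funM => //; exact: measurable_tnth.
Qed.

Lemma sumsq_scale n c (x : n.-tuple R) : sumsq (scale_tuple c x) = c ^+ 2 * sumsq x.
Proof.
by rewrite /sumsq mulr_sumr; apply: eq_bigr => i _; rewrite tnth_mktuple exprMn.
Qed.

Lemma dotp_scaler n c (x y : n.-tuple R) : dotp x (scale_tuple c y) = c * dotp x y.
Proof.
by rewrite /dotp mulr_sumr; apply: eq_bigr => i _; rewrite tnth_mktuple mulrCA.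
Qed.

Lemma dotp_scalel n c (x y : n.-tuple R) : dotp (scale_tuple c x) y = c * dotp x y.
Proof.
by rewrite /dotp mulr_sumr; apply: eq_bigr => i _; rewrite tnth_mktuple mulrA.
Qed.

Lemma sumsq_sub n (x y : n.-tuple R) :
  sumsq (sub_tuple x y) = sumsq x - 2 * dotp y x + sumsq y.
Proof.
rewrite /sumsq /dotp mulr_sumr -sumrB -big_split/=; apply: eq_bigr => i _.
by rewrite tnth_mktuple; ring.
Qed.

Lemma enorm_sqr n (x : n.-tuple R) : enorm x ^+ 2 = sumsq x.
Proof. by rewrite sqr_sqrtr// sumsq_ge0. Qed.

Lemma ge0_integral_mvnormalS n a (y : n.-tuple R) s (f : n.+1.-tuple T -> \bar R) :
  measurable_fun setT f -> (forall x, 0 <= f x)%E ->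
  (\int[mvnormal (cons_pair (a, y)) s]_x f x =
   \int[normal_prob a s]_b \int[mvnormal y s]_x f (cons_pair (b, x)))%E.
Proof.
move=> mf f0.
pose P i : probability T R := normal_prob (tnth (cons_pair (a, y)) i) s.
have h := ge0_integral_indep_lawS P mf f0.
have e : (fun i => P (lift ord0 i)) = (fun i => normal_prob (tnth y i) s : probability T R).
  by apply/funext => i; rewrite /P tnthS.
by rewrite e in h.
Qed.

Lemma ge0_integral_mvnormal_tilt n (theta : n.-tuple R) s (f : n.-tuple T -> \bar R) :
  0 < s -> measurable_fun setT f -> (forall x, 0 <= f x)%E ->
  (\int[mvnormal theta s]_x f x =
   \int[std_normal n]_x (f (scale_tuple s x) *
     (expR (dotp (scale_tuple s^-1 theta) x - s ^- 2 * sumsq theta / 2))%:E))%E.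
Proof.
move=> s0.
have me n' (eta : n'.-tuple R) (c : R) :
    measurable_fun [set: n'.-tuple T] (fun x => (expR (dotp eta x - c))%:E).
  apply/measurable_EFinP; apply: measurableT_comp => //.
  by apply: measurable_funB => //; exact: measurable_dotp.
elim: n theta f => [|n IH] theta f mf f0.
  rewrite !integral_indep_law0//; last first.
    apply: emeasurable_funM; last exact: me.
    by apply: (measurableT_comp mf); exact: measurable_scale_tuple.
  rewrite /dotp /sumsq !big_ord0 mulr0 mul0r subr0 expR0 mule1.
  by congr f; apply: eq_from_tnth => -[].
have [a [y ->]] := cons_pairP theta.
apply: (etrans (ge0_integral_mvnormalS a y s mf f0)).
pose g (b : T) (x : n.-tuple T) := f (cons_pair (b, x)).
have mg : measurable_fun setT (fun bx : T * n.-tuple T => g bx.1 bx.2).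
  rewrite (_ : (fun bx => _) = f \o @cons_pair R n); last by apply/funext => -[].
  by apply: (measurableT_comp mf); exact: measurable_cons_pair.
have g0 b x : (0 <= g b x)%E by exact: f0.
have mgb b : measurable_fun setT (g b) := measurableT_comp mg (pair1_measurable b).
pose G (b : T) := (\int[mvnormal y s]_x g b x)%E.
have mG : measurable_fun setT G.
  exact: (@measurable_fun_fubini_tonelli_F _ _ _ _ _ (mvnormal y s) _ mg (fun bx => g0 bx.1 bx.2)).
have G0 b : (0 <= G b)%E by exact: integral_ge0.
apply: (etrans (ge0_integral_normal_tilt a s0 mG G0)); apply/esym.
apply: etrans; first apply: ge0_integral_std_normalS.
- apply: emeasurable_funM; last exact: me.
  by apply: (measurableT_comp mf); exact: measurable_scale_tuple.
- by move=> x; rewrite mule_ge0// lee_fin expR_ge0.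
apply/esym.
apply: eq_integral => b _.
rewrite /G (IH y (g (s * b)) (mgb _) (g0 _)).
pose F (x : n.-tuple T) := (g (s * b)%R (scale_tuple s x) *
  (expR (dotp (scale_tuple s^-1 y) x - s ^- 2 * sumsq y / 2))%:E)%E.
have mF : measurable_fun setT F.
  apply: emeasurable_funM; last exact: me.
  by apply: (measurableT_comp (mgb _)); exact: measurable_scale_tuple.
have F0 x : (0 <= F x)%E by rewrite /F mule_ge0// lee_fin expR_ge0.
apply: etrans; first apply/esym/(@ge0_integralZr _ _ _ (std_normal n) _ measurableT _ mF).
- by [].
- by rewrite lee_fin expR_ge0.
apply: eq_integral => x _; rewrite /F /g !scale_tuple_cons dotp_cons sumsq_cons.
rewrite -muleA -EFinM -expRD; congr (_ * EFin (expR _))%E.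
by field; rewrite gt_eqF.
Qed.

Lemma ge0_integral_model_law p k (theta : p.-tuple R) s (F : p.-tuple T * T -> \bar R) :
  0 < s -> measurable_fun setT F -> (forall x, 0 <= F x)%E ->
  (\int[model_law k theta s]_xs F xs =
   \int[std_law p k]_xs (F (scale_tuple s xs.1, (s ^+ 2 * xs.2)%R) *
     (expR (dotp (scale_tuple s^-1 theta) xs.1 - s ^- 2 * sumsq theta / 2))%:E))%E.
Proof.
move=> s0 mF F0.
have me : measurable_fun [set: p.-tuple T]
    (fun x => (expR (dotp (scale_tuple s^-1 theta) x - s ^- 2 * sumsq theta / 2))%:E).
  apply/measurable_EFinP; apply: measurableT_comp => //.
  by apply: measurable_funB => //; exact: measurable_dotp.
have mFs : measurable_fun setT (fun xs : p.-tuple T * T => F (xs.1, (s ^+ 2 * xs.2)%R)).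
  apply: (measurableT_comp mF); apply: measurable_fun_pair => //=.
  exact: (measurable_funM (measurable_cst _) measurable_snd).
have mFss : measurable_fun setT
    (fun xs : p.-tuple T * T => F (scale_tuple s xs.1, (s ^+ 2 * xs.2)%R)).
  apply: (measurableT_comp mF); apply: measurable_fun_pair => //=.
    exact: (measurableT_comp (@measurable_scale_tuple _ _) measurable_fst).
  exact: (measurable_funM (measurable_cst _) measurable_snd).
pose G x := (\int[chi2 k]_u F (x, (s ^+ 2 * u)%R))%E.
have mG : measurable_fun setT G.
  exact: (@measurable_fun_fubini_tonelli_F _ _ _ _ _ (chi2 k) _ mFs (fun xs => F0 _)).
have G0 x : (0 <= G x)%E by exact: integral_ge0.
rewrite /model_law fubini_tonelli1// /fubini_F.
transitivity (\int[mvnormal theta s]_x G x)%E.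
  apply: eq_integral => x _.
  rewrite (ge0_integral_pushforward (measurable_scaler (s ^+ 2)))//.
  exact: (measurableT_comp mF (pair1_measurable x)).
rewrite ge0_integral_mvnormal_tilt// /std_law fubini_tonelli1//; last 2 first.
- by apply: emeasurable_funM => //; exact: (measurableT_comp me).
- by move=> xs; rewrite mule_ge0// lee_fin expR_ge0.
apply: eq_integral => x _; rewrite /fubini_F/= ge0_integralZr//.
exact: (measurableT_comp mFss (pair1_measurable x)).
Qed.

Lemma ge0_integral_std_normal_opp n (f : n.-tuple T -> \bar R) :
  measurable_fun setT f -> (forall x, 0 <= f x)%E ->
  (\int[std_normal n]_x f x = \int[std_normal n]_x f (scale_tuple (-1)%R x))%E.
Proof.
elim: n f => [|n IH] f mf f0.
  rewrite !integral_indep_law0//; last first.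
    by apply: (measurableT_comp mf); exact: measurable_scale_tuple.
  by congr f; apply: eq_from_tnth => -[].
pose g (b : T) (x : n.-tuple T) := f (cons_pair (b, x)).
have mg : measurable_fun setT (fun bx : T * n.-tuple T => g bx.1 bx.2).
  rewrite (_ : (fun bx => _) = f \o @cons_pair R n); last by apply/funext => -[].
  by apply: (measurableT_comp mf); exact: measurable_cons_pair.
have mgb b : measurable_fun setT (g b) := measurableT_comp mg (pair1_measurable b).
have mfo : measurable_fun setT (fun x : n.+1.-tuple T => f (scale_tuple (-1) x)).
  by apply: (measurableT_comp mf); exact: measurable_scale_tuple.
pose G (b : T) := (\int[std_normal n]_x g b x)%E.
have mG : measurable_fun setT G.
  exact: (@measurable_fun_fubini_tonelli_F _ _ _ _ _ (std_normal n) _ mg (fun bx => f0 _)).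
have G0 b : (0 <= G b)%E by apply: integral_ge0 => x _; exact: f0.
apply: (etrans (ge0_integral_std_normalS mf f0)).
apply: (etrans (ge0_integral_normal_opp mG G0)).
apply/esym/(etrans (ge0_integral_std_normalS mfo (fun x => f0 _))).
apply: eq_integral => b _.
apply: etrans (esym (IH _ (mgb (- b)) (fun x => f0 _))).
by apply: eq_integral => x _; rewrite /g scale_tuple_cons mulN1r.
Qed.

Lemma ge0_integral_std_law_opp p k (F : p.-tuple T * T -> \bar R) :
  measurable_fun setT F -> (forall x, 0 <= F x)%E ->
  (\int[std_law p k]_xs F xs = \int[std_law p k]_xs F (scale_tuple (-1)%R xs.1, xs.2))%E.
Proof.
move=> mF F0.
have mFo : measurable_fun setT (fun xs : p.-tuple T * T => F (scale_tuple (-1) xs.1, xs.2)).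
  apply: (measurableT_comp mF); apply: measurable_fun_pair => //=.
  exact: (measurableT_comp (@measurable_scale_tuple _ _) measurable_fst).
pose G x := (\int[chi2 k]_s F (x, s))%E.
have mG : measurable_fun setT G.
  exact: (@measurable_fun_fubini_tonelli_F _ _ _ _ _ (chi2 k) _ mF F0).
have G0 x : (0 <= G x)%E by exact: integral_ge0.
apply: (etrans (@fubini_tonelli1 _ _ _ _ _ (std_normal p) (chi2 k) _ mF F0)).
apply: (etrans (ge0_integral_std_normal_opp mG G0)); apply/esym.
exact: (@fubini_tonelli1 _ _ _ _ _ (std_normal p) (chi2 k) _ mFo (fun=> F0 _)).
Qed.

(* The integrand of the risk at [(theta, sigma) = (eta, 1)], symmetrized under
   [x |-> - x]. *)
Definition sym_loss p (eta : p.-tuple R) (h : R -> R) (xs : p.-tuple T * T) : R :=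
  2 * (h (sqratio xs) ^+ 2 * sumsq xs.1 + sumsq eta) * coshR (dotp eta xs.1)
  - 4 * h (sqratio xs) * vsinhR (dotp eta xs.1).

Let loss p (eta : p.-tuple R) (h : R -> R) (xs : p.-tuple T * T) : R :=
  sumsq (sub_tuple (scale_tuple (h (sqratio xs)) xs.1) eta).

Let sym_lossE p (eta : p.-tuple R) h xs : sym_loss eta h xs =
  loss eta h xs * expR (dotp eta xs.1) +
  loss eta h (scale_tuple (-1) xs.1, xs.2) * expR (- dotp eta xs.1).
Proof.
rewrite /loss /sqratio/= !sumsq_sub !sumsq_scale !dotp_scaler sqrrN expr1n mul1r.
by rewrite /sym_loss /coshR /vsinhR /sqratio; field.
Qed.

(** Hidden by the subtraction, but clear from the form as a sum of two losses with exponential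
    weights. *)
Lemma sym_loss_ge0 p (eta : p.-tuple R) h xs : 0 <= sym_loss eta h xs.
Proof. by rewrite sym_lossE addr_ge0// mulr_ge0 ?expR_ge0// sumsq_ge0. Qed.

Let measurable_loss p (eta : p.-tuple R) (h : T -> T) : measurable_fun setT h ->
  measurable_fun setT (loss eta h : p.-tuple T * T -> T).
Proof.
move=> mh; rewrite (_ : loss eta h = fun xs => (h (sqratio xs)) ^+ 2 * sumsq xs.1
   - 2 * (h (sqratio xs) * dotp eta xs.1) + sumsq eta); last first.
  by apply/funext => xs; rewrite /loss sumsq_sub sumsq_scale dotp_scaler.
have mhs : measurable_fun setT (fun xs : p.-tuple T * T => h (sqratio xs)).
  by apply: (measurableT_comp mh); exact: measurable_sqratio.
have md : measurable_fun setT (fun xs : p.-tuple T * T => dotp eta xs.1).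
  by apply: (measurableT_comp (measurable_dotp eta)); exact: measurable_fst.
have ms : measurable_fun setT (fun xs : p.-tuple T * T => sumsq xs.1).
  by apply: (measurableT_comp (@measurable_sumsq R p)); exact: measurable_fst.
apply: measurable_funD => //; apply: measurable_funB.
  by apply: measurable_funM => //; exact: measurable_funX.
by apply: measurable_funM => //; exact: measurable_funM.
Qed.

Lemma measurable_sym_loss p (eta : p.-tuple R) (h : T -> T) : measurable_fun setT h ->
  measurable_fun setT (sym_loss eta h : p.-tuple T * T -> T).
Proof.
move=> mh; rewrite (funext (sym_lossE eta h)).
have ml := measurable_loss eta mh.
have md : measurable_fun setT (fun xs : p.-tuple T * T => dotp eta xs.1).
  by apply: (measurableT_comp (measurable_dotp eta)); exact: measurable_fst.
have mneg : measurable_fun setT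
    (fun xs : p.-tuple T * T => (scale_tuple (-1) xs.1, xs.2) : p.-tuple T * T).
  apply: measurable_fun_pair => //=.
  exact: (measurableT_comp (@measurable_scale_tuple _ _) measurable_fst).
apply: measurable_funD; apply: measurable_funM => //.
- exact: measurableT_comp.
- exact: (measurableT_comp ml mneg).
- by apply: measurableT_comp => //; exact: measurableT_comp.
Qed.

(** [T] is invariant under [(x, u) |-> (s x, s ^+ 2 u)], so the loss scales by [s ^+ 2] and only
    [theta / s] matters. The positive prefactor is common to all multipliers, hence comparing risks
    is comparing integrals of [sym_loss]. *)
Lemma risk_equivariant p k (theta : p.-tuple R) s (h : T -> T) :
  0 < s -> measurable_fun setT h ->
  (risk k (theta, s) (equivariant h) =
   (expR (- (s ^- 2 * sumsq theta / 2)) / 2)%:E *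
   \int[std_law p k]_xs (sym_loss (scale_tuple s^-1 theta) h xs)%:E)%E.
Proof.
move=> s0 mh.
have alg (J : \bar R) (e : R) : (0 <= J)%E -> 0 <= e ->
    ((s ^- 2)%:E * ((s ^+ 2 * e)%:E * J) = (e / 2)%:E * (J + J))%E.
  move=> J0 e0; rewrite muleA -EFinM mulKf ?expf_neq0 ?gt_eqF//.
  rewrite ge0_muleDr// -ge0_muleDl ?lee_fin ?divr_ge0// -EFinD.
  by rewrite -splitr.
set eta := scale_tuple s^-1 theta; set c := s ^- 2 * sumsq theta / 2.
have ml := measurable_loss eta mh.
have md : measurable_fun setT (fun xs : p.-tuple T * T => dotp eta xs.1).
  by apply: (measurableT_comp (measurable_dotp eta)); exact: measurable_fst.
have mle : measurable_fun setT (fun xs : p.-tuple T * T =>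
   (loss eta h xs * expR (dotp eta xs.1))%:E).
  apply/measurable_EFinP; apply: measurable_funM => //.
  exact: measurableT_comp.
have le0 xs : (0 <= (loss eta h xs * expR (dotp eta xs.1))%:E)%E.
  by rewrite lee_fin mulr_ge0 ?expR_ge0// sumsq_ge0.
have mneg : measurable_fun setT
    (fun xs : p.-tuple T * T => (scale_tuple (-1) xs.1, xs.2) : p.-tuple T * T).
  apply: measurable_fun_pair => //=.
  exact: (measurableT_comp (@measurable_scale_tuple _ _) measurable_fst).
have lossE xs : loss theta h (scale_tuple s xs.1, s ^+ 2 * xs.2) = s ^+ 2 * loss eta h xs.
  rewrite /loss /sqratio/= !sumsq_sub !sumsq_scale !dotp_scaler dotp_scalel.
  rewrite -mulf_div divff ?expf_neq0 ?gt_eqF// mul1r.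
  by field; rewrite gt_eqF.
have mlt := measurable_loss theta mh.
pose I := (\int[std_law p k]_xs (loss eta h xs * expR (dotp eta xs.1))%:E)%E.
have I0 : (0 <= I)%E by exact: integral_ge0.
have symI : (\int[std_law p k]_xs (sym_loss eta h xs)%:E = I + I)%E.
  rewrite {2}/I (ge0_integral_std_law_opp k mle le0) /I -ge0_integralD//; last first.
    exact: (measurableT_comp mle mneg).
  by apply: eq_integral => xs _; rewrite sym_lossE /= dotp_scaler mulN1r -EFinD.
have riskE : (risk k (theta, s) (equivariant h) =
    (s ^- 2)%:E * \int[model_law k theta s]_xs (loss theta h xs)%:E)%E.
  rewrite /risk unlock; congr (_ * _)%E; apply: eq_integral => xs _.
  by rewrite enorm_sqr /equivariant enorm_sqr.
have mlE : measurable_fun setT (fun xs => (loss theta h xs)%:E) by exact/measurable_EFinP.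
have lE0 xs : (0 <= (loss theta h xs)%:E)%E by rewrite lee_fin sumsq_ge0.
rewrite riskE symI (ge0_integral_model_law k theta s0 mlE lE0).
rewrite (_ : integral _ _ _ = (s ^+ 2 * expR (- c))%:E * I)%E; last first.
  rewrite /I -ge0_integralZl//; last by rewrite lee_fin mulr_ge0 ?expR_ge0 ?sqr_ge0.
  apply: eq_integral => xs _; rewrite -!EFinM lossE; congr EFin.
  by rewrite -/eta -/c expRD; ring.
by apply: alg => //; exact: expR_ge0.
Qed.

End risk.

(** * Comparison of the risks of two ordered multipliers *)

Section domination.
Context {R : realType}.
Local Notation mu := (@lebesgue_measure R).
Local Notation T := (measurableTypeR R).

Lemma hyp1F1_homo (a b z z' : R) : 0 < a -> 0 < b -> 0 <= z -> z <= z' ->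
  hyp1F1 a b z <= hyp1F1 a b z'.
Proof.
move=> a0 b0 z0 zz'.
apply: sums_ler (@sums_hyp R a b z a0 b0) (@sums_hyp R a b z' a0 b0) => i.
rewrite /hyp_term ler_wpM2l ?divr_ge0 ?(ltW (pochhammer_gt0 _ _))//.
by rewrite ler_wpM2r ?invr_ge0// lerXn2r// nnegrE// (le_trans z0).
Qed.

Lemma measurable_hyp1F1 (a b : R) : 0 < a -> 0 < b ->
  measurable_fun [set: T] (hyp1F1 a b : T -> T).
Proof.
move=> a0 b0; apply: (@measurable_fun_cvg _ _ _ _ (fun n z => series (hyp_term a b z) n)).
  move=> n; apply: measurable_sum => i.
  by apply: measurable_funM => //; apply: measurable_funM.
by move=> z _; exact: sums_hyp.
Qed.

Let measurable_expRN : measurable_fun [set: T] (fun x : T => expR (- x) : T).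
Proof. by apply: measurableT_comp. Qed.

Lemma measurable_coshR : measurable_fun [set: T] (@coshR R : T -> T).
Proof. by apply: measurable_funM => //; exact: measurable_funD. Qed.

Lemma measurable_vsinhR : measurable_fun [set: T] (@vsinhR R : T -> T).
Proof.
apply: measurable_funM => //; apply: measurable_funM => //; exact: measurable_funB.
Qed.

(** [chi2] is the law of a sum of squares, so negative [s] carry no mass; multipliers may be altered
    at negative ratios. *)
Lemma eq_integral_std_law p k (F G : p.-tuple T * T -> \bar R) :
  measurable_fun setT F -> (forall xs, 0 <= F xs)%E ->
  measurable_fun setT G -> (forall xs, 0 <= G xs)%E ->
  (forall x s, 0 <= s -> F (x, s) = G (x, s)) ->
  (\int[std_law p k]_xs F xs = \int[std_law p k]_xs G xs)%E.
Proof.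
move=> mF F0 mG G0 FG.
have h (H : p.-tuple T * T -> \bar R) : measurable_fun setT H -> (forall xs, 0 <= H xs)%E ->
    (\int[std_law p k]_xs H xs = \int[std_normal p]_x \int[std_normal k]_y H (x, sumsq y))%E.
  move=> mH H0; apply: (etrans (@fubini_tonelli1 _ _ _ _ _ (std_normal p) (chi2 k) _ mH H0)).
  apply: eq_integral => x _; rewrite /fubini_F.
  have mHx : measurable_fun setT (fun s => H (x, s)) := measurableT_comp mH (pair1_measurable x).
  exact: (ge0_integral_pushforward (@measurable_sumsq R k) _ measurableT mHx).
rewrite (h _ mF F0) (h _ mG G0).
apply: eq_integral => x _; apply: eq_integral => y _.
by rewrite FG// sumsq_ge0.
Qed.

Section fixed_dimensions.
Variables p k : nat.
Local Notation a := ((k.+1%:R + p.+1%:R - 0) / 2 + 1 : R).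
Local Notation b := (p.+1%:R / 2 : R).
Local Notation z L t := (L * t ^+ 2 / (2 * (1 + t ^+ 2)) : R).
Local Notation K := (@ratio_coef R p k).
Local Notation u := (ratio_weight k p.+2).
Local Notation H m t := (hBU p.+1 k.+1 m 0 t).

Let a_gt0 : 0 < a. Proof. by rewrite subr0 addr_gt0. Qed.
Let b_gt0 : 0 < b. Proof. by rewrite divr_gt0. Qed.

Let z_ge0 (L t : R) : 0 <= L -> 0 <= z L t.
Proof.
move=> L0; apply: divr_ge0; first by rewrite mulr_ge0// sqr_ge0.
by rewrite mulr_ge0// addr_ge0// sqr_ge0.
Qed.

Let z_le (L t : R) : 0 <= L -> z L t <= L / 2.
Proof.
move=> L0; have t1 : 0 < 1 + t ^+ 2 by rewrite ltr_pwDl ?ltr01 ?sqr_ge0.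
rewrite ler_pdivrMr ?mulr_gt0// [leRHS]mulrA divfK// ler_wpM2l//.
by rewrite lerDr.
Qed.

Lemma integral_ratio_bounded (f : R -> R) (C : R) : measurable_fun [set: T] (f : T -> T) ->
  (forall t, 0 <= f t <= C * u t) -> (\int[mu]_t (f t)%:E < +oo)%E.
Proof.
move=> mf fC.
have C0 : 0 <= C.
  (* The weight is positive at [1], so the bound at [t = 1] gives the sign of [C]. *)
  rewrite -(@pmulr_rge0 _ (u 1)).
    by have /andP[f0 fu] := fC 1; rewrite mulrC (le_trans f0).
  by rewrite ratio_weightE ltr01 expr1n mul1r invr_gt0 exprn_gt0// sqrtr_gt0.
apply: (@le_lt_trans _ _ (C%:E * \int[mu]_t (u t)%:E)%E).
  rewrite -ge0_integralZl ?lee_fin//; last 2 first.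
  - by apply/measurable_EFinP; exact: measurable_ratio_weight.
  - by move=> t _; rewrite lee_fin ratio_weight_ge0.
  apply: ge0_le_integral => //.
  - by move=> t _; rewrite lee_fin; have /andP[] := fC t.
  - exact/measurable_EFinP.
  - by apply: measurable_funeM; apply/measurable_EFinP; exact: measurable_ratio_weight.
  - by move=> t _; rewrite -EFinM lee_fin; have /andP[] := fC t.
by rewrite integral_ratio_weight -EFinM ltry.
Qed.

Let measurable_z (L : R) : measurable_fun [set: T] (fun t : T => z L t : T).
Proof.
apply: measurable_funM; first by apply: measurable_funM => //; exact: measurable_funX.
apply: (measurableT_comp measurable_invr).
by apply: measurable_funM => //; apply: measurable_funD => //; exact: measurable_funX.
Qed.

Section ordered_multipliers.
Variables (m M t0 : R) (h1 h2 : T -> T).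
Hypotheses (m_gt0 : 0 < m) (mh1 : measurable_fun setT h1) (mh2 : measurable_fun setT h2).
Hypothesis h12 : forall t, 0 <= h1 t <= h2 t.
Hypothesis h2M : forall t, h2 t <= M.
Hypothesis Hh1 : forall t, 0 < t -> h1 t < h2 t -> H m t <= h1 t.
Hypothesis lt_h12 : forall t, t0 < t -> h1 t < h2 t.
Variable eta : p.+1.-tuple R.
Hypothesis eta_le : sumsq eta <= m ^+ 2.

Let L := sumsq eta.
Let L_ge0 : 0 <= L. Proof. exact: sumsq_ge0. Qed.
Let q t := h2 t - h1 t.
Let q_ge0 t : 0 <= q t. Proof. by rewrite subr_ge0; have /andP[] := h12 t. Qed.
Let h1_ge0 t : 0 <= h1 t. Proof. by have /andP[] := h12 t. Qed.
Let h2_ge0 t : 0 <= h2 t.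
Proof. by have /andP[h10 /(le_trans h10)] := h12 t. Qed.
Let M_ge0 : 0 <= M. Proof. exact: le_trans (h2_ge0 0) (h2M 0). Qed.
Let h1M t : h1 t <= M.
Proof. by have /andP[_ /le_trans] := h12 t; apply. Qed.

Let mq : measurable_fun setT q. Proof. exact: measurable_funB. Qed.

Let F0 t := hyp1F1 a b (z L t).
Let F1 t := hyp1F1 a (b + 1) (z L t).

Let F0_gt0 t : 0 < F0 t.
Proof. by rewrite (lt_le_trans ltr01)// hyp1F1_ge1 ?z_ge0. Qed.

Let b1_gt0 : 0 < b + 1. Proof. by rewrite addr_gt0. Qed.

Let F1_gt0 t : 0 < F1 t.
Proof. by rewrite (lt_le_trans ltr01)// hyp1F1_ge1 ?z_ge0. Qed.

Let mF0 : measurable_fun [set: T] (F0 : T -> T).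
Proof. exact: (measurableT_comp (measurable_hyp1F1 a_gt0 b_gt0) (measurable_z L)). Qed.

Let mF1 : measurable_fun [set: T] (F1 : T -> T).
Proof. exact: (measurableT_comp (measurable_hyp1F1 a_gt0 b1_gt0) (measurable_z L)). Qed.

Let K_ge0 : 0 <= K. Proof. exact/ltW/ratio_coef_gt0. Qed.

(* Integrands, after integration over the law of the ratio, of the two sides of
   [S h2 + 4 q v sinh v = S h1 + 2 q (h1 + h2) |x| ^ 2 cosh v]. *)
Let fA t := 4 * q (t ^+ 2) * (K * u t * (L / p.+1%:R * F1 t)).
Let fB t := 2 * q (t ^+ 2) * (h1 (t ^+ 2) + h2 (t ^+ 2)) * (K * u t * F0 t).

Let fA_ge0 t : 0 <= fA t.
Proof.
rewrite /fA; apply: mulr_ge0; first by rewrite mulr_ge0.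
apply: mulr_ge0; first by rewrite mulr_ge0 ?ratio_weight_ge0.
by rewrite mulr_ge0 ?divr_ge0// ltW.
Qed.

Let fB_ge0 t : 0 <= fB t.
Proof.
rewrite /fB; apply: mulr_ge0; first by rewrite !mulr_ge0// addr_ge0.
by rewrite mulr_ge0 ?(ltW (F0_gt0 t))// mulr_ge0// ratio_weight_ge0.
Qed.

Let msq (f : T -> T) : measurable_fun setT f ->
  measurable_fun [set: T] (fun t : T => f (t ^+ 2) : T).
Proof. by move=> mf; apply: (measurableT_comp mf); exact: measurable_funX. Qed.

Let mfA : measurable_fun [set: T] (fA : T -> T).
Proof.
apply: measurable_funM.
  by apply: measurable_funM => //; exact: msq.
apply: measurable_funM; last exact: measurable_funM.
by apply: measurable_funM => //; exact: measurable_ratio_weight.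
Qed.

Let mfB : measurable_fun [set: T] (fB : T -> T).
Proof.
apply: measurable_funM.
  apply: measurable_funM; last by apply: measurable_funD; exact: msq.
  by apply: measurable_funM => //; exact: msq.
apply: measurable_funM => //.
by apply: measurable_funM => //; exact: measurable_ratio_weight.
Qed.

(** Where [q] is nonzero, [hBU] at [|eta|] is at most [hBU] at [m], hence at most [h1] and [h2]; so
    twice its value is at most [h1 + h2]. *)
Let fA_le_fB t : fA t <= fB t.
Proof.
rewrite /fA /fB; have [tle0|tgt0] := leP t 0.
  by rewrite ratio_weightE ltNge tle0/= !(mulr0, mul0r).
have u0 := ratio_weight_ge0 k p.+2 t.
have [q0|] := eqVneq (q (t ^+ 2)) 0; first by rewrite q0 !(mulr0, mul0r).
move=> qn0; have qgt0 : 0 < q (t ^+ 2) by rewrite lt_neqAle eq_sym qn0/=.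
have lt12 : h1 (t ^+ 2) < h2 (t ^+ 2) by rewrite -subr_gt0.
have t20 : 0 < t ^+ 2 by rewrite exprn_gt0.
have := Hh1 t20 lt12.
have sL : Num.sqrt L <= m.
  by rewrite -(ler_pXn2r (n := 2)) ?nnegrE ?sqrtr_ge0 ?(ltW m_gt0)// sqr_sqrtr.
move/(le_trans (hBU_homo_m k.+1 (ltn0Sn p) (sqrtr_ge0 L) sL t20)).
rewrite /hBU sqr_sqrtr// -/(F0 t) -/(F1 t) mulrA ler_pdivrMr// => le1.
set h := h1 (t ^+ 2) in le1 lt12 *; set h' := h2 (t ^+ 2) in lt12 *.
rewrite (_ : 4 * _ * _ = 2 * q (t ^+ 2) * (K * u t) * (2 * (L / p.+1%:R * F1 t))); last by ring.
rewrite [leRHS](_ : _ = 2 * q (t ^+ 2) * (K * u t) * ((h + h') * F0 t)); last by ring.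
apply: ler_wpM2l; first by apply: mulr_ge0; apply: mulr_ge0.
have : h * F0 t <= h' * F0 t by rewrite ler_pM2r// ltW.
move=> le2; rewrite [leRHS]mulrDl mulr_natl mulr2n.
by apply: lerD => //; exact: le_trans le1 le2.
Qed.

(** Needed to cancel this term in [S_balance]. The argument [z] stays below [L / 2] for all [t], so
    the hypergeometric factor is bounded. *)
Let intA_fin : (\int[mu]_t (fA t)%:E < +oo)%E.
Proof.
pose C := 4 * M * (K * (L / p.+1%:R * hyp1F1 a (b + 1) (L / 2))).
apply: (@integral_ratio_bounded _ C mfA) => t; rewrite fA_ge0/=.
rewrite /fA /C; set D := hyp1F1 a (b + 1) (L / 2).
have FD : F1 t <= D by apply: hyp1F1_homo => //; [exact: z_ge0|exact: z_le].
have qM : q (t ^+ 2) <= M by rewrite lerBlDr (le_trans (h2M _))// lerDl.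
have u0 := ratio_weight_ge0 k p.+2 t.
rewrite (_ : 4 * _ * _ = 4 * K * u t * (L / p.+1%:R) * (q (t ^+ 2) * F1 t)); last by ring.
rewrite [leRHS](_ : _ = 4 * K * u t * (L / p.+1%:R) * (M * D)); last by ring.
apply: ler_wpM2l.
  by apply: mulr_ge0; [apply: mulr_ge0 => //; apply: mulr_ge0|apply: divr_ge0].
by apply: ler_pM => //; exact: ltW.
Qed.

Let S (h : T -> T) := (\int[std_law p.+1 k.+1]_xs (sym_loss eta h xs)%:E)%E.

(** The difference of two symmetrized losses, with negative terms moved across so that all four
    integrals are of nonnegative functions. *)
Let S_balance : (S h2 + \int[mu]_t (fA t)%:E = S h1 + \int[mu]_t (fB t)%:E)%E.
Proof.
have mS h : measurable_fun setT h ->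
    measurable_fun setT (fun xs : p.+1.-tuple T * T => (sym_loss eta h xs)%:E).
  by move=> mh; apply/measurable_EFinP; exact: measurable_sym_loss.
have S0 h xs : (0 <= (sym_loss eta h xs)%:E)%E by rewrite lee_fin sym_loss_ge0.
pose qA t := 4 * q t.
pose qB t := 2 * q t * (h1 t + h2 t).
have mqA : measurable_fun setT qA by exact: measurable_funM.
have mqB : measurable_fun setT qB.
  by apply: measurable_funM; [exact: measurable_funM|exact: measurable_funD].
have qA0 t : 0 <= qA t by rewrite mulr_ge0.
have qB0 t : 0 <= qB t by rewrite !mulr_ge0// addr_ge0.
pose IA (xs : p.+1.-tuple T * T) := qA (sqratio xs) * vsinhR (dotp eta xs.1).
pose IB (xs : p.+1.-tuple T * T) := qB (sqratio xs) * (sumsq xs.1 * coshR (dotp eta xs.1)).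
have EA : (\int[mu]_t (fA t)%:E = \int[std_law p.+1 k.+1]_xs (IA xs)%:E)%E.
  exact/esym/(ge0_integral_vsinhR k eta mqA qA0).
have EB : (\int[mu]_t (fB t)%:E = \int[std_law p.+1 k.+1]_xs (IB xs)%:E)%E.
  exact/esym/(ge0_integral_coshR k eta mqB qB0).
have md : measurable_fun setT (fun xs : p.+1.-tuple T * T => dotp eta xs.1).
  by apply: (measurableT_comp (measurable_dotp eta)); exact: measurable_fst.
have mIA : measurable_fun setT (fun xs => (IA xs)%:E).
  apply/measurable_EFinP/measurable_funM.
    exact: (measurableT_comp mqA (@measurable_sqratio R p.+1)).
  exact: (measurableT_comp measurable_vsinhR md).
have mIB : measurable_fun setT (fun xs => (IB xs)%:E).
  apply/measurable_EFinP/measurable_funM.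
    exact: (measurableT_comp mqB (@measurable_sqratio R p.+1)).
  apply: measurable_funM; last exact: (measurableT_comp measurable_coshR md).
  by apply: (measurableT_comp (@measurable_sumsq R p.+1)); exact: measurable_fst.
have IA0 xs : (0 <= (IA xs)%:E)%E by rewrite lee_fin mulr_ge0// vsinhR_ge0.
have IB0 xs : (0 <= (IB xs)%:E)%E.
  by rewrite lee_fin mulr_ge0// mulr_ge0 ?coshR_ge0// sumsq_ge0.
have D (F G : p.+1.-tuple T * T -> \bar R) : measurable_fun setT F -> (forall xs, 0 <= F xs)%E ->
    measurable_fun setT G -> (forall xs, 0 <= G xs)%E ->
    (\int[std_law p.+1 k.+1]_xs F xs + \int[std_law p.+1 k.+1]_xs G xs =
     \int[std_law p.+1 k.+1]_xs (F xs + G xs))%E.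
  by move=> ? ? ? ?; rewrite ge0_integralD.
rewrite EA EB /S (D _ _ (mS _ mh2) (S0 h2) mIA IA0) (D _ _ (mS _ mh1) (S0 h1) mIB IB0).
apply: eq_integral => xs _; rewrite -!EFinD; congr EFin.
by rewrite /sym_loss /IA /IB /qA /qB /q; ring.
Qed.

Lemma integral_sym_loss_le : (S h1 <= S h2)%E.
Proof.
have A0 : (0 <= \int[mu]_t (fA t)%:E)%E by apply: integral_ge0 => t _; rewrite lee_fin.
have AB : (\int[mu]_t (fA t)%:E <= \int[mu]_t (fB t)%:E)%E.
  apply: ge0_le_integral => //; try exact/measurable_EFinP;
    by move=> t _; rewrite lee_fin.
have Afin : (\int[mu]_t (fA t)%:E)%E \is a fin_num by rewrite ge0_fin_numE.
by have := leeD2l (S h1) AB; rewrite -S_balance leeD2rE.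
Qed.

Let int_fB_gt0 : (0 < \int[mu]_t (fB t)%:E)%E.
Proof.
rewrite lt_neqAle integral_ge0 ?andbT => [|t _]; last by rewrite lee_fin.
apply/negP => /eqP/esym int0.
have mE : measurable_fun [set: T] (fun t => (fB t)%:E) by exact/measurable_EFinP.
have : (\int[mu]_t `|(fB t)%:E| = 0)%E.
  by rewrite -int0; apply: eq_integral => t _; rewrite gee0_abs// lee_fin.
move/(ae_eq_integral_abs mu measurableT mE) => [N [mN N0 subN]].
(* Beyond [1] one has [t < t ^+ 2], so [t ^+ 2] exceeds [t0] on the whole interval, where [fB] is
   then positive on a set of measure [1]. *)
pose T0 := Num.max t0 1.
pose A : set T := [set` `]T0, T0 + 1[].
have sub : A `<=` N.
  move=> t; rewrite /A/= in_itv/= => /andP[T0t _]; apply: subN => /= /(_ I) [] /eqP.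
  have t1 : 1 < t by apply: le_lt_trans T0t; rewrite le_max lexx orbT.
  have t0t2 : t0 < t ^+ 2.
    apply: (@lt_trans _ _ t); first by apply: le_lt_trans T0t; rewrite le_max lexx.
    by rewrite expr2 ltr_pMl// (lt_trans ltr01).
  have lt12 := lt_h12 t0t2.
  apply/negP; rewrite gt_eqF// /fB mulr_gt0//.
    apply: mulr_gt0; first by rewrite mulr_gt0// subr_gt0.
    exact: ltr_wpDl (h1_ge0 _) (le_lt_trans (h1_ge0 _) lt12).
  apply: mulr_gt0 => //; apply: mulr_gt0; first exact: ratio_coef_gt0.
  rewrite ratio_weightE (lt_trans ltr01 t1); apply: divr_gt0.
    by rewrite exprn_gt0// (lt_trans ltr01 t1).
  by rewrite exprn_gt0// sqrtr_gt0 ltr_pwDl ?ltr01 ?sqr_ge0.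
have : (mu A <= mu N)%E.
  by apply: le_measure => //; rewrite inE//; exact: measurable_itv.
rewrite [X in (_ <= X)%E](_ : _ = 0%E)//.
rewrite /A lebesgue_measure_itv/= lte_fin ltrDl ltr01 -EFinD addrAC subrr add0r.
by rewrite lee_fin ler10.
Qed.

(** At [eta = 0] the integrand [fA] vanishes and the risks differ by the positive integral of [fB];
    finiteness of [S h1] makes the inequality strict. *)
Lemma integral_sym_loss_lt : sumsq eta = 0 -> (S h1 < S h2)%E.
Proof.
move=> eta0; have L0 : L = 0 by [].
have intA0 : (\int[mu]_t (fA t)%:E = 0)%E.
  by apply: integral0_eq => t _; rewrite /fA L0 !(mul0r, mulr0).
pose g (t : T) := 2 * h1 t ^+ 2 : T.
have mg : measurable_fun setT g by apply: measurable_funM => //; exact: measurable_funX.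
have g0 t : 0 <= g t by rewrite mulr_ge0// sqr_ge0.
have S1fin : S h1 \is a fin_num.
  rewrite ge0_fin_numE; last by apply: integral_ge0 => xs _; rewrite lee_fin sym_loss_ge0.
  pose I1 (xs : p.+1.-tuple T * T) := g (sqratio xs) * (sumsq xs.1 * coshR (dotp eta xs.1)).
  have mI1 : measurable_fun setT (fun xs => (I1 xs)%:E).
    apply/measurable_EFinP/measurable_funM.
      exact: (measurableT_comp mg (@measurable_sqratio R p.+1)).
    apply: measurable_funM.
      by apply: (measurableT_comp (@measurable_sumsq R p.+1)); exact: measurable_fst.
    apply: (measurableT_comp measurable_coshR).
    by apply: (measurableT_comp (measurable_dotp eta)); exact: measurable_fst.
  apply: (@le_lt_trans _ _ (\int[std_law p.+1 k.+1]_xs (I1 xs)%:E)%E).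
    apply: ge0_le_integral => //.
    - by move=> xs _; rewrite lee_fin sym_loss_ge0.
    - by apply/measurable_EFinP; exact: measurable_sym_loss.
    - move=> xs _; rewrite lee_fin /sym_loss /I1 /g eta0 addr0.
      rewrite mulrA -[leRHS]mulrA mulrA lerBlDr mulrA lerDl.
      by rewrite mulr_ge0 ?vsinhR_ge0// mulr_ge0.
  rewrite (ge0_integral_coshR k eta mg g0).
  apply: (@integral_ratio_bounded _ (2 * M ^+ 2 * (K * hyp1F1 a b (L / 2)))).
    apply: measurable_funM; first exact: msq.
    by apply: measurable_funM => //; apply: measurable_funM => //; exact: measurable_ratio_weight.
  move=> t; have u0 := ratio_weight_ge0 k p.+2 t; apply/andP; split.
    by rewrite mulr_ge0// mulr_ge0 ?(ltW (F0_gt0 t))// mulr_ge0.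
  have FD : F0 t <= hyp1F1 a b (L / 2) by apply: hyp1F1_homo => //; [exact: z_ge0|exact: z_le].
  rewrite -/(F0 t) /g; set D := hyp1F1 a b (L / 2) in FD *.
  rewrite (_ : 2 * _ * _ = 2 * K * u t * (h1 (t ^+ 2) ^+ 2 * F0 t)); last by ring.
  rewrite [leRHS](_ : _ = 2 * K * u t * (M ^+ 2 * D)); last by ring.
  apply: ler_wpM2l; first by apply: mulr_ge0 => //; apply: mulr_ge0.
  apply: ler_pM => //; first by rewrite sqr_ge0.
  - exact: ltW.
  - by rewrite lerXn2r// nnegrE.
by have := S_balance; rewrite intA0 adde0 => ->; rewrite lteDl.
Qed.

End ordered_multipliers.

End fixed_dimensions.
End domination.

(** * Domination criterion for equivariant estimators *)

Section equivariant_domination.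
Context {R : realType}.
Local Notation T := (measurableTypeR R).

Lemma measurable_equivariant p (h : T -> T) : measurable_fun setT h ->
  is_estimator (equivariant h : decision p).
Proof.
move=> mh; apply/measurable_fun_tnthP => i.
rewrite (_ : _ \o _ = fun xs : p.-tuple T * T => h (sqratio xs) * tnth xs.1 i); last first.
  by apply/funext => xs /=; rewrite tnth_mktuple enorm_sqr.
apply: measurable_funM.
  exact: (measurableT_comp mh (@measurable_sqratio R p)).
exact: (measurableT_comp (@measurable_tnth _ _ _ i) measurable_fst).
Qed.

Lemma delta_X_equivariant p : delta_X p = equivariant (cst 1) :> @decision R p.
Proof.
by apply/funext => xs; apply: eq_from_tnth => i; rewrite tnth_mktuple mul1r.
Qed.

(** The bound [M] makes the cancelled integrals finite, and [t0] provides a half-line of ratios on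
    which the multipliers differ. *)
Lemma dominates_equivariant p k (m M t0 : R) (h1 h2 : T -> T) :
  (0 < p)%N -> (0 < k)%N -> 0 < m ->
  measurable_fun setT h1 -> measurable_fun setT h2 ->
  (forall t, 0 <= t -> 0 <= h1 t <= h2 t) -> (forall t, 0 <= t -> h2 t <= M) ->
  (forall t, 0 < t -> h1 t < h2 t -> hBU p k m 0 t <= h1 t) ->
  (forall t, 0 < t -> t0 < t -> h1 t < h2 t) ->
  dominates k m (equivariant h1 : decision p) (equivariant h2).
Proof.
case: p k => [//|p] [//|k] _ _ m0 mh1 mh2 h12 h2M Hh1 lt_h12.
(* The hypotheses concern nonnegative ratios only; composing with the absolute value extends them to
   the line without changing the risk. *)
pose g (h : T -> T) (t : R) := h `|t|.
have mg (h : T -> T) : measurable_fun setT h -> measurable_fun setT (g h).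
  by move=> mh; apply: (measurableT_comp mh); exact: normr_measurable.
have g12 t : 0 <= g h1 t <= g h2 t by exact: h12.
have g2M t : g h2 t <= M by exact: h2M.
have Hg1 t : 0 < t -> g h1 t < g h2 t -> hBU p.+1 k.+1 m 0 t <= g h1 t.
  by move=> t1; rewrite /g gtr0_norm//; exact: Hh1.
have lt_g12 t : Num.max t0 0 < t -> g h1 t < g h2 t.
  by rewrite gt_max => /andP[t0t t1]; rewrite /g gtr0_norm//; exact: lt_h12.
have gE eta (h : T -> T) : measurable_fun setT h ->
    (\int[std_law p.+1 k.+1]_xs (sym_loss eta h xs)%:E =
     \int[std_law p.+1 k.+1]_xs (sym_loss eta (g h) xs)%:E)%E.
  move=> mh; apply: eq_integral_std_law.
  - by apply/measurable_EFinP; exact: measurable_sym_loss.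
  - by move=> xs; rewrite lee_fin sym_loss_ge0.
  - by apply/measurable_EFinP; apply: measurable_sym_loss; exact: mg.
  - by move=> xs; rewrite lee_fin sym_loss_ge0.
  - move=> x s s0; rewrite /sym_loss /g ger0_norm//.
    by rewrite /sqratio/= divr_ge0// sumsq_ge0.
have c0 (x : R) : 0 < expR x / 2 by rewrite divr_gt0// expR_gt0.
split=> [[theta s]|].
  move=> [/= s0 le_m].
  rewrite (risk_equivariant k.+1 theta s0 mh1) (risk_equivariant k.+1 theta s0 mh2).
  apply: lee_wpmul2l; first by rewrite lee_fin ltW.
  rewrite (gE _ _ mh1) (gE _ _ mh2).
  apply: (integral_sym_loss_le m0 (mg _ mh1) (mg _ mh2) g12 g2M Hg1).
  rewrite sumsq_scale -enorm_sqr -exprMn mulrC lerXn2r ?nnegrE ?(ltW m0)//.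
  by rewrite divr_ge0 ?sqrtr_ge0// ltW.
(* The zero mean belongs to every parameter space and is where strict improvement is available. *)
pose theta0 : p.+1.-tuple R := [tuple 0 | i < p.+1].
have sq0 : sumsq theta0 = 0.
  by rewrite /sumsq big1// => i _; rewrite tnth_mktuple expr0n.
exists (theta0, 1).
  by split=> //=; rewrite /enorm sq0 sqrtr0 mul0r ltW.
rewrite (risk_equivariant k.+1 theta0 ltr01 mh1) (risk_equivariant k.+1 theta0 ltr01 mh2).
rewrite lte_pmul2l ?lte_fin//.
rewrite (gE _ _ mh1) (gE _ _ mh2).
have eta0 : sumsq (scale_tuple 1^-1 theta0) = 0 by rewrite sumsq_scale sq0 mulr0.
exact: (integral_sym_loss_lt k (mg _ mh1) (mg _ mh2) g12 g2M lt_g12 eta0).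
Qed.

Lemma measurable_hBU p k (m l : R) : (0 < p)%N -> l < k%:R + p%:R ->
  measurable_fun [set: T] (hBU p k m l : T -> T).
Proof.
move=> p0 lkp.
have b0 : 0 < p%:R / 2 :> R by rewrite divr_gt0// ltr0n.
have a0 : 0 < (k%:R + p%:R - l) / 2 + 1 :> R by rewrite addr_gt0// divr_gt0// subr_gt0.
have mz : measurable_fun [set: T] (fun t : T => m ^+ 2 * t / (2 * (1 + t)) : T).
  apply: measurable_funM; first exact: measurable_funM.
  apply: (measurableT_comp measurable_invr).
  by apply: measurable_funM => //; exact: measurable_funD.
apply: measurable_funM => //; apply: measurable_funM.
  exact: (measurableT_comp (measurable_hyp1F1 a0 (addr_gt0 b0 ltr01)) mz).
apply: (measurableT_comp measurable_invr).
exact: (measurableT_comp (measurable_hyp1F1 a0 b0) mz).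
Qed.

Lemma measurable_hmle p k (m : R) : measurable_fun [set: T] (hmle p k m : T -> T).
Proof.
apply: measurable_fun_ifT => //.
- exact: measurable_fun_ltr.
- apply: (measurable_minr (g := cst 1)) => //.
  apply: measurable_funM => //; apply: measurable_funB => //.
  apply: measurableT_comp.
    by apply: continuous_measurable_fun; exact: sqrt_continuous.
  apply: measurable_funD => //; apply: measurable_funM => //.
  apply: measurable_funM; first exact: measurable_funD.
  exact: measurable_invr.
Qed.

End equivariant_domination.

(** * Comparisons of the multipliers with each other and with [1] *)

Section comparisons.
Context {R : realType} (p k : nat) (m : R).
Hypotheses (p_gt0 : (0 < p)%N) (k_gt0 : (0 < k)%N) (m_gt0 : 0 < m).

Let pk_gt0 : 0 < k%:R + p%:R :> R.
Proof. by rewrite -natrD ltr0n addn_gt0 p_gt0 orbT. Qed.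

Let p_gt0' : 0 < p%:R :> R. Proof. by rewrite ltr0n. Qed.

Lemma hBU_le1 l t : m <= Num.sqrt p%:R -> l < k%:R + p%:R -> 0 <= t ->
  hBU p k m l t <= 1.
Proof.
move=> mp lkp t0; apply: le_trans (hBU_le _ _ _ _) _ => //.
by rewrite ler_pdivrMr// mul1r -[leRHS]sqr_sqrtr ?ler0n// lerXn2r ?nnegrE ?sqrtr_ge0// ltW.
Qed.

(** Strictness comes from strict growth in [l]: the weak bound is applied at the midpoint [l'] of
    [l] and [k + p]. *)
Lemma hBU_lt1 l t : m <= Num.sqrt p%:R -> l < k%:R + p%:R -> 0 < t ->
  hBU p k m l t < 1.
Proof.
move=> mp lkp t0; pose l' := (l + (k%:R + p%:R)) / 2.
have [ll' l'kp] : l < l' /\ l' < k%:R + p%:R by rewrite /l'; split; lra.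
by apply: lt_le_trans (hBU_lt_l p_gt0 m_gt0 ll' l'kp t0) _; rewrite hBU_le1// ltW.
Qed.

Lemma hmle0 : hmle p k m 0 = 1.
Proof. by rewrite /hmle ltxx. Qed.

Lemma hBU_lt_hmle t : (2 <= p)%N \/ (p = 1%N /\ k = 1%N) -> 0 < t ->
  hBU p k m 0 t < 1 -> hBU p k m 0 t < hmle p k m t.
Proof.
by move=> pk t0 H1; rewrite hmleE// lt_min H1 andbT; exact: hBU_lt_mle_root.
Qed.

(** Where the cap [1] is inactive, [hmle] is the root itself, so the comparison holds for every
    [m]. *)
Lemma hBU_lt_hmle_lt1 t : (2 <= p)%N \/ (p = 1%N /\ k = 1%N) -> 0 < t ->
  hmle p k m t < 1 -> hBU p k m 0 t < hmle p k m t.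
Proof.
move=> pk t0; rewrite hmleE// gt_min ltxx orbF => r1.
rewrite lt_min; have h := hBU_lt_mle_root p_gt0 m_gt0 t0 pk.
by rewrite h (lt_trans h r1).
Qed.

Lemma hmle_lt1 t : m ^+ 2 / (p%:R + k%:R) < t -> hmle p k m t < 1.
Proof.
move=> mt; have t0 : 0 < t.
  by apply: le_lt_trans mt; rewrite divr_ge0 ?sqr_ge0// addrC ltW.
by rewrite hmleE// gt_min mle_root_lt1.
Qed.

End comparisons.

Theorem corollary3p1 (R : realType) (p k : nat) (m : R)
    (hp : (1 <= p)%N) (hk : (1 <= k)%N) (hm : 0 < m) :
  [/\ ((2 <= p)%N /\ (2 <= k)%N) \/ (k = 1%N /\ m <= Num.sqrt p%:R) ->
        dominates k m (delta_mle p k m) (delta_X p),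
      m <= Num.sqrt p%:R -> (2 <= p)%N \/ (p = 1%N /\ k = 1%N) ->
        dominates k m (delta_BU p k m 0) (delta_mle p k m),
      m <= Num.sqrt p%:R ->
        forall l : R, 0 <= l < k%:R + p%:R ->
        dominates k m (delta_BU p k m l) (delta_X p),
      forall l : R, 0 < l < k%:R + p%:R ->
        inadmissible k m (delta_BU p k m l) /\
        dominates k m (delta_BU p k m 0) (delta_BU p k m l)
    & Num.sqrt p%:R < m -> (2 <= p)%N -> (2 <= k)%N ->
        inadmissible k m (delta_mle p k m) /\
        dominates k m
          (equivariant (fun t => Num.min (hmle p k m t) (hBU p k m 0 t)))
          (delta_mle p k m)].
Proof.
have pk0 : 0 < k%:R + p%:R :> R by rewrite -natrD ltr0n addn_gt0 hp orbT.
have mB l : l < k%:R + p%:R -> measurable_fun setT (hBU p k m l) by exact: measurable_hBU.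
have mM := measurable_hmle p k m.
(* Both alternatives of the first claim lead to the dimensions covered by [hBU_lt_mle_root]. *)
have pk_mle : ((2 <= p)%N /\ (2 <= k)%N) \/ (k = 1%N /\ m <= Num.sqrt p%:R) ->
    (2 <= p)%N \/ (p = 1%N /\ k = 1%N).
  case=> [[? _]|[k1 _]]; first by left.
  have [p2|p1] := leqP 2 p; first by left.
  by right; split=> //; apply/eqP; rewrite eqn_leq hp -ltnS p1.
split.
- move=> /pk_mle pk; rewrite delta_X_equivariant.
  (* The two multipliers differ only where the cap is inactive, which is certain beyond this
     threshold. *)
  apply: (@dominates_equivariant _ _ _ _ 1 (m ^+ 2 / (p%:R + k%:R))) => //.
  + by move=> t _; rewrite hmle_ge0//= hmle_le1.
  + by move=> t t0 m1; apply/ltW/hBU_lt_hmle_lt1.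
  + by move=> t _; exact: hmle_lt1.
- move=> mp pk; apply: (@dominates_equivariant _ _ _ _ 1 0) => //.
  + exact: mB.
  (* At ratio [0] the multiplier [hmle] is [1] by convention and is treated apart. *)
  + move=> t; rewrite le_eqVlt => /predU1P[<-|t0].
      by rewrite hBU_ge0//= hmle0 hBU_le1.
    by rewrite hBU_ge0 ?(ltW t0)//= ltW// hBU_lt_hmle// hBU_lt1.
  + by move=> t _; exact: hmle_le1.
  + by move=> t t0 _; rewrite hBU_lt_hmle// hBU_lt1.
- move=> mp l /andP[l0 lkp]; rewrite delta_X_equivariant.
  apply: (@dominates_equivariant _ _ _ _ 1 0) => //.
  + exact: mB.
  + by move=> t t0; rewrite hBU_ge0//= hBU_le1.
  + by move=> t t0 _; apply: hBU_homo_l => //; exact: ltW.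
  + by move=> t t0 _; exact: hBU_lt1.
- move=> l /andP[l0 lkp].
  have dom : dominates k m (delta_BU p k m 0) (delta_BU p k m l).
    (* With [m] unrestricted, [1] need not bound the multiplier; [m ^+ 2 / p] always does. *)
    apply: (@dominates_equivariant _ _ _ _ (m ^+ 2 / p%:R) 0) => //.
    + exact: mB.
    + exact: mB.
    + by move=> t t0; rewrite hBU_ge0//= hBU_homo_l// ltW.
    + by move=> t t0; exact: hBU_le.
    + by move=> t t0 _; exact: hBU_lt_l.
  split=> //; exists (delta_BU p k m 0) => //.
  by apply: measurable_equivariant; exact: mB.
- move=> mp p2 k2; have pk : (2 <= p)%N \/ (p = 1%N /\ k = 1%N) by left.
  have mmin : measurable_fun setT (fun t => Num.min (hmle p k m t) (hBU p k m 0 t)).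
    by apply: measurable_minr => //; exact: mB.
  have dom : dominates k m
      (equivariant (fun t => Num.min (hmle p k m t) (hBU p k m 0 t))) (delta_mle p k m).
    apply: (@dominates_equivariant _ _ _ _ 1 (m ^+ 2 / (p%:R + k%:R))) => //.
    + by move=> t t0; rewrite le_min hmle_ge0// hBU_ge0//= ge_min lexx.
    + by move=> t _; exact: hmle_le1.
    (* Where the minimum is below [hmle], it equals [hBU], so the criterion holds with equality. *)
    + by move=> t t0; rewrite gt_min ltxx/= le_min lexx andbT => /ltW.
    + by move=> t t0 /(hmle_lt1 hp hm) m1; rewrite gt_min ltxx/= hBU_lt_hmle_lt1.
  split=> //; exists (equivariant (fun t => Num.min (hmle p k m t) (hBU p k m 0 t))) => //.
  exact: measurable_equivariant.
Qed.
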